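(* Let $G$, $X$, $f$, $\sigma$, $d=\deg f$, $\mathcal S$, $\mathcal M=\mathcal S_f$ and $\lambda$ be as in the context (in particular $\operatorname{supp}\mathcal S=X$ and $\mathcal M_\lambda$ is an irreducible $G$-module), write $b_\lambda(s)=\prod_{i=1}^d(s+\lambda_i)$ with $\lambda_i\in\mathbb Q$, and let $\alpha\in\mathbb Q$. Then the isomorphism $\iota_+\mathcal M\cong \mathcal M[s]f^s$ induces an isomorphism of $(\mathbb C[s],G)$-modules $$(V^{\alpha}\iota_{+}\mathcal M)_{\lambda}\;\cong\;(p_{\lambda,\alpha}(s))\cdot \mathcal M_{\lambda}f^s ,$$ where $(p(s))$ denotes the ideal of $\mathbb C[s]$ generated by $p(s)$, and $$p_{\lambda,\alpha}(s)=\prod_{i=1}^{d}[s+\lambda_i]_{\lceil \alpha-\lambda_i\rceil}.$$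
   Context: Setup. $G$ is a connected reductive linear algebraic group over $\mathbb C$, acting linearly on an affine space $X$ (a finite-dimensional representation). $f$ is a nonzero regular function on $X$, semi-invariant of weight $\sigma\in\mathrm{Hom}(G,\mathbb C^* )$, i.e. $f(g\cdot x)=\sigma(g)^{-1}f(x)$. $\mathcal S$ is a simple (strongly) $G$-equivariant left $\mathscr D_X$-module with support $X$, $\mathcal M=\mathcal S_f$ is its localization along $f$, and $\mathcal M$ is assumed regular holonomic with quasi-unipotent monodromy along $f$. $\Lambda$ is the set of integral dominant weights of $G$; for $\lambda\in\Lambda$ the $\lambda$-isotypic component is denoted by a subscript $\lambda$. Fix $\lambda$ such that $\mathcal M_\lambda$ is an irreducible $G$-module. Then $f$ is homogeneous; $d=\deg f$. Graph embedding and $V$-filtration. $\iota:X\to X\times\mathbb C$, $x\mapsto(x,f(x))$; $t$ is the coordinate on $\mathbb C$, $s=-\partial_t t$, $\iota_+\mathcal M=\bigoplus_{\ell\ge0}\mathcal M\otimes\partial_t^\ell$. $\mathcal M[s]f^s$ is a $\mathscr D_X\langle s,t\rangle$-module via $\xi\cdot(ms^\ell f^s)=(\xi(m)s^\ell+ms^{\ell+1}\xi(f)/f)f^s$ for vector fields $\xi$, $s$ acting by multiplication, and $t\cdot(ms^\ell f^s)=(m(s+1)^\ell f)f^s$. There is an isomorphism of $\mathscr D_X\langle s,t\rangle$-modules $\mathcal M[s]f^s\cong\iota_+\mathcal M$, $ms^\ell f^s\mapsto m\otimes(-\partial_tt)^\ell$. $V^\bullet\iota_+\mathcal M$ is the Kashiwara–Malgrange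 filtration along $t=0$: the unique exhaustive decreasing filtration, indexed discretely and left-continuously by $\mathbb Q$, by coherent $\mathscr D_X\langle s,t\rangle$-modules with $tV^\alpha\subseteq V^{\alpha+1}$ (equality for $\alpha\gg0$), $\partial_tV^\alpha\subseteq V^{\alpha-1}$, and $s+\alpha$ nilpotent on $V^\alpha/V^{>\alpha}$. $G$ acts on $X\times\mathbb C$ by $g(x,t)=(gx,\sigma(g)^{-1}t)$, which makes $\iota_+\mathcal M$ a $G$-module with $V^\alpha\iota_+\mathcal M$ stable; on $\mathcal M[s]f^s$ this is the action for which $s$ and $f^s$ are $G$-invariant. Polynomials. For $w\in\iota_+\mathcal M$, $b_w(s)$ is the monic polynomial of least degree with $P\cdot(tw)=b_w(s)w$ for some $P\in\mathscr D_X\langle s,t\rangle$; $b_m:=b_{mf^s}$ for $m\in\mathcal M$. For $0\neq m\in\mathcal M_\lambda$ the polynomial $b_m(s)$ has degree $d$ and does not depend on $m$; it is denoted $b_\lambda(s)=\prod_{i=1}^d(s+\lambda_i)$, $\lambda_i\in\mathbb Q$. (It satisfies $\partial f\cdot mf^{s+1}=b_\lambda(s)mf^s$ for a suitably normalized semi-invariant constant coefficient operator $\partial f$ of weight $-\sigma$.) For $m\in\mathcal M$, $\alpha\in\mathbb Q$, $p_{m,\alpha}(s)\in\mathbb C[s]$ is the monic polynomial $p(s)$ of smallest degree such that $p(s)mf^s\in V^\alpha\iota_+\mathcal M$; it is the same for all nonzero $m\in\mathcal M_\lambda$ and is then denoted $p_{\lambda,\alpha}(s)$. Finally $[s+a]_k=\prod_{i=0}^{k-1}(s+a+i)$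 if $k\ge1$ and $[s+a]_k=1$ otherwise. *)

(* Defs.v *)
From HB Require Import structures.
From mathcomp Require Import all_boot all_order all_algebra finmap.
From mathcomp Require mpoly monalg.
Import -(notations) monalg.
Import mpoly.

Set Implicit Arguments.
Unset Strict Implicit.
Unset Printing Implicit Defensive.

Import Order.TTheory GRing.Theory Num.Theory.
Local Open Scope ring_scope.

Section Operators.
Variables (C : fieldType) (W : lmodType C).
Implicit Types (A : (W -> W) -> Prop) (U : W -> Prop).

Definition subspace U :=
  U 0 /\ forall (a : C) (u v : W), U u -> U v -> U (a *: u + v).

Definition stable A U := forall P u, A P -> U u -> U (P u).

Definition whole : W -> Prop := fun=> True.

(* The image in End(W) of the C-algebra generated by A. *)
Inductive gen_alg A : (W -> W) -> Prop :=
| gen_alg_scal c : gen_alg A (fun w => c *: w)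
| gen_alg_base P : A P -> gen_alg A P
| gen_alg_add P Q :
    gen_alg A P -> gen_alg A Q -> gen_alg A (fun w => P w + Q w)
| gen_alg_comp P Q :
    gen_alg A P -> gen_alg A Q -> gen_alg A (fun w => P (Q w)).

(* The A-submodule generated by gs; for A empty, the linear span of gs. *)
Definition gen_mod A (gs : seq W) (u : W) :=
  forall U, subspace U -> stable A U -> (forall g, g \in gs -> U g) -> U u.

Definition fin_gen A U := exists gs, forall u, U u <-> gen_mod A gs u.

(* Step k of the filtration of the algebra generated by A0 and A1 in which
   A0 has degree 0 and A1 has degree 1. *)
Inductive filt_alg (A0 A1 : (W -> W) -> Prop) : nat -> (W -> W) -> Prop :=
| filt_alg_scal c : filt_alg A0 A1 0 (fun w => c *: w)
| filt_alg_incl k P : filt_alg A0 A1 k P -> filt_alg A0 A1 k.+1 P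
| filt_alg_add k P Q : filt_alg A0 A1 k P -> filt_alg A0 A1 k Q ->
    filt_alg A0 A1 k (fun w => P w + Q w)
| filt_alg_mul0 k P Q : A0 P -> filt_alg A0 A1 k Q ->
    filt_alg A0 A1 k (fun w => P (Q w))
| filt_alg_mul1 k P Q : A1 P -> filt_alg A0 A1 k Q ->
    filt_alg A0 A1 k.+1 (fun w => P (Q w)).

Definition no_op : (W -> W) -> Prop := fun=> False.
Definition family n (x : 'I_n -> W -> W) : (W -> W) -> Prop :=
  fun P => exists i, P = x i.
Definition op_union A B : (W -> W) -> Prop := fun P => A P \/ B P.

(* q(S) w for a polynomial q and an operator S *)
Definition op_poly (q : {poly C}) (S : W -> W) (w : W) : W :=
  \sum_(i < size q) q`_i *: iter i S w.

End Operators.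

(* [x] and [d] are the operators by which the coordinates of an affine space
  and the corresponding partial derivatives act on [W]. *)

Section WeylAlgebra.
Variables (C : fieldType) (W : lmodType C) (n : nat).
Variables (x d : 'I_n -> W -> W).

(* Finitely generated of Bernstein dimension at most n (hence equal to n, or
   W = 0), the dimension being read off the Bernstein filtration
   deg x_i = deg d_i = 1. *)
Definition holonomic :=
  exists (gs : seq W) (c : nat),
    (forall u, gen_mod (op_union (family x) (family d)) gs u) /\
    forall k : nat, exists2 bs : seq W, (size bs <= c * k.+1 ^ n)%N &
      forall P g,
        filt_alg (@no_op _ W) (op_union (family x) (family d)) k P ->
        g \in gs -> gen_mod (@no_op _ W) bs (P g).

(* Good filtration for the order filtration of differential operators. *)
Definition good_filtration (F : int -> W -> Prop) :=
  [/\ forall k, subspace (F k) /\ fin_gen (family x) (F k),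
      forall k u, F k u -> F (k + 1) u,
      forall k i u, F k u -> F (k + 1) (d i u),
      (exists k, forall u, F k u -> u = 0) /\ (forall u, exists k, F k u) &
      exists k0, forall k, k0 <= k -> forall u, F (k + 1) u ->
        exists (v : W) (vs : 'I_n -> W),
          [/\ F k v, forall i, F k (vs i) & u = v + \sum_i d i (vs i)]].

(* Kashiwara-Kawai: a holonomic module has regular singularities iff it has a
   good filtration F such that Ann(gr^F W), which defines the characteristic
   variety, is a radical ideal.  As this ideal of C[x, xi] is homogeneous in
   xi, it suffices to test the symbols of operators P of order at most r. *)
Definition regular_singularities :=
  exists2 F, good_filtration F &
    forall (r : nat) P, filt_alg (family x) (family d) r P ->
    forall N : nat,
      (forall k u, F k u -> F (k + (r * N)%N%:Z - 1) (iter N P u)) ->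
      forall k u, F k u -> F (k + r%:Z - 1) (P u).

End WeylAlgebra.

(* As the space is affine, a quasi-coherent D-module is given by its global
   sections: a module over the polynomial ring with an integrable connection. *)
Record dmodule (C : fieldType) (n : nat) := DModule {
  dm_car :> lmodType C;
  dm_O : {mpoly C[n]} -> dm_car -> dm_car;
  dm_d : 'I_n -> dm_car -> dm_car;
  dm_O_scal : forall c m, dm_O c%:MP m = c *: m;
  dm_O_addl : forall p q m, dm_O (p + q) m = dm_O p m + dm_O q m;
  dm_O_addr : forall p m m', dm_O p (m + m') = dm_O p m + dm_O p m';
  dm_O_mul : forall p q m, dm_O (p * q) m = dm_O p (dm_O q m);
  dm_d_add : forall i m m', dm_d i (m + m') = dm_d i m + dm_d i m';
  dm_d_leibniz : forall i p m,
    dm_d i (dm_O p m) = dm_O p^`M(i) m + dm_O p (dm_d i m);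
  dm_d_comm : forall i j m, dm_d i (dm_d j m) = dm_d j (dm_d i m)
}.

Section DModules.
Variables (C : fieldType) (n : nat).

Definition dm_x (M : dmodule C n) (i : 'I_n) : M -> M := dm_O 'X_i.

Definition dm_hom (M M' : dmodule C n) (h : M -> M') :=
  [/\ forall m m', h (m + m') = h m + h m',
      forall p m, h (dm_O p m) = dm_O p (h m) &
      forall i m, h (dm_d i m) = dm_d i (h m)].

(* [loc] exhibits M' as the localization of M along f. *)
Definition is_localization (f : {mpoly C[n]}) (M M' : dmodule C n)
    (loc : M -> M') :=
  [/\ dm_hom loc,
      bijective (dm_O f : M' -> M'),
      forall u : M', exists k m, dm_O (f ^+ k) u = loc m &
      forall m, loc m = 0 -> exists k, dm_O (f ^+ k) m = 0].

(* The stalk of M at every point of affine space is nonzero. *)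
Definition full_support (M : dmodule C n) :=
  forall x : 'I_n -> C, exists m : M,
    forall h : {mpoly C[n]}, h.@[x] != 0 -> dm_O h m <> 0.

(* Regularity is meant in the algebraic sense, i.e. including at infinity: it
   is required of the direct image of M to projective n-space.  On the chart
   x_i <> 0 at infinity this is the localization of M along x_i, regarded as a
   module over the Weyl algebra in y_i = 1/x_i and y_j = x_j/x_i, for which
   d/dy_j = x_i d/dx_j and d/dy_i = - x_i sum_j x_j d/dx_j. *)
Definition regular_holonomic (M : dmodule C n) :=
  [/\ holonomic (@dm_x M) (@dm_d _ _ M),
      regular_singularities (@dm_x M) (@dm_d _ _ M) &
      forall i : 'I_n,
        exists (M' : dmodule C n) (loc : M -> M') (y dy : 'I_n -> M' -> M'),
        [/\ is_localization 'X_i loc,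
            forall u, dm_x i (y i u) = u /\
              dy i u = - dm_x i (\sum_j dm_x j (dm_d j u)),
            forall j u, j != i ->
              y j u = dm_x j (y i u) /\ dy j u = dm_x i (dm_d j u) &
            regular_singularities y dy]].

End DModules.

Section Groups.
Variables (C : fieldType) (N : nat).
Implicit Types (G A B : 'M[C]_N -> Prop).

Definition entries (g : 'M[C]_N) : 'I_(N * N) -> C := fun k => mxvec g 0 k.

Definition closed_in_GL A :=
  exists I : {mpoly C[N * N]} -> Prop,
    forall g, A g <-> g \in unitmx /\ forall p, I p -> p.@[entries g] = 0.

Definition linear_algebraic_group G :=
  [/\ closed_in_GL G, G 1%:M, forall g h, G g -> G h -> G (g *m h) &
      forall g, G g -> G (invmx g)].

Definition zariski_connected G :=
  forall A B, closed_in_GL A -> closed_in_GL B ->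
    (forall g, G g <-> A g \/ B g) -> (forall g, ~ (A g /\ B g)) ->
    (forall g, ~ A g) \/ (forall g, ~ B g).

(* The pair (p, k) stands for the regular function p / det ^ k on GL_N. *)
Definition regfun : Type := {mpoly C[N * N]} * nat.
Definition rf_eval (a : regfun) (g : 'M[C]_N) : C :=
  a.1.@[entries g] / \det g ^+ a.2.
(* The derivative of p / det ^ k at the identity in the direction Y. *)
Definition rf_deriv (a : regfun) (Y : 'M[C]_N) : C :=
  \sum_k (a.1^`M(k)).@[entries 1%:M] * entries Y k
  - a.1.@[entries 1%:M] * \tr Y *+ a.2.

Definition lie_algebra G (Y : 'M[C]_N) :=
  forall a : regfun, (forall g, G g -> rf_eval a g = 0) -> rf_deriv a Y = 0.

Definition regular_on G (a : 'M[C]_N -> C) :=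
  exists r : regfun, forall g, G g -> a g = rf_eval r g.

Definition alg_character G (sigma : 'M[C]_N -> C) :=
  [/\ regular_on G sigma, forall g, G g -> sigma g != 0 &
      forall g h, G g -> G h -> sigma (g *m h) = sigma g * sigma h].

Section Modules.
Variables (W : lmodType C) (tau : 'M[C]_N -> W -> W).

(* tau g w = sum_i a_i(g) v_i on G *)
Definition orbit_expansion G (w : W) k (a : 'I_k -> regfun) (v : 'I_k -> W) :=
  forall g, G g -> tau g w = \sum_i rf_eval (a i) g *: v i.

Definition rational_rep G :=
  [/\ forall g, G g -> forall (c : C) (u v : W),
        tau g (c *: u + v) = c *: tau g u + tau g v,
      forall w, tau 1%:M w = w,
      forall g h w, G g -> G h -> tau (g *m h) w = tau g (tau h w) &
      forall w, exists k (a : 'I_k -> regfun) (v : 'I_k -> W),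
        orbit_expansion G w a v].

(* z is the image of w under the differential of tau at Y. *)
Definition lie_action G (Y : 'M[C]_N) (w z : W) :=
  exists k (a : 'I_k -> regfun) (v : 'I_k -> W),
    orbit_expansion G w a v /\ z = \sum_i rf_deriv (a i) Y *: v i.

Definition G_subspace G (U : W -> Prop) :=
  subspace U /\ forall g u, G g -> U u -> U (tau g u).

Definition irreducible G (U : W -> Prop) :=
  [/\ G_subspace G U, exists2 u, U u & u <> 0 &
      forall U', G_subspace G U' -> (forall u, U' u -> U u) ->
        (forall u, U' u -> u = 0) \/ (forall u, U u -> U' u)].

Definition completely_reducible G :=
  forall U, G_subspace G U -> exists U',
    [/\ G_subspace G U', forall u, U u -> U' u -> u = 0 &
        forall w, exists u u', [/\ U u, U' u' & w = u + u']].

(* The isotypic component in U of the irreducible representation tauL: the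
   sum of the submodules of U isomorphic to it. *)
Definition isotypic G l (tauL : 'M[C]_N -> 'cV[C]_l -> 'cV[C]_l)
    (U : W -> Prop) (w : W) :=
  exists k (h : 'I_k -> 'cV[C]_l -> W) (v : 'I_k -> 'cV[C]_l),
    [/\ forall i (c : C) a b, h i (c *: a + b) = c *: h i a + h i b,
        forall i, injective (h i),
        forall i g a, G g -> h i (tauL g a) = tau g (h i a),
        forall i a, U (h i a) &
        w = \sum_i h i (v i)].

End Modules.

(* Reductive group over a field of characteristic zero, defined as in Goodman
   and Wallach, Symmetry, Representations, and Invariants. *)
Definition reductive G :=
  forall l (tau : 'M[C]_N -> 'cV[C]_l -> 'cV[C]_l),
    rational_rep tau G -> completely_reducible tau G.

End Groups.

Section Equivariance.
Variables (C : fieldType) (N n : nat) (G : 'M[C]_N -> Prop).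
Variable (rho : 'M[C]_N -> 'M[C]_n).

Definition linear_action := rational_rep (fun g (v : 'cV[C]_n) => rho g *m v) G.

Definition semi_invariant (sigma : 'M[C]_N -> C) (f : {mpoly C[n]}) :=
  forall g (v : 'cV[C]_n), G g ->
    f.@[fun i => (rho g *m v) i 0] = (sigma g)^-1 * f.@[fun i => v i 0].

(* (g h)(v) = h (g^-1 v) *)
Definition act_fun (g : 'M[C]_N) (h : {mpoly C[n]}) : {mpoly C[n]} :=
  h \mPo [tuple \sum_j rho (invmx g) i j *: 'X_j | i < n].

(* Strong equivariance: the action is compatible with the D-module structure,
   with g d_j = sum_i rho(g)_ij d_i, and its differential is the action of
   Lie(G) through the vector fields Y |-> - sum_ij drho(Y)_ij x_j d_i, which
   differentiate the action [act_fun] on functions. *)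
Definition equivariant (M : dmodule C n) (tau : 'M[C]_N -> M -> M) :=
  [/\ rational_rep tau G,
      forall g p m, G g -> tau g (dm_O p m) = dm_O (act_fun g p) (tau g m),
      forall g j m, G g ->
        tau g (dm_d j m) = \sum_i rho g i j *: dm_d i (tau g m) &
      forall Y (r : 'I_n -> 'I_n -> regfun C N), lie_algebra G Y ->
        (forall g i j, G g -> rho g i j = rf_eval (r i j) g) ->
        forall m, lie_action tau G Y m
          (- \sum_i \sum_j rf_deriv (r i j) Y *: dm_x j (dm_d i m))].

Definition simple_equivariant (M : dmodule C n) (tau : 'M[C]_N -> M -> M) :=
  [/\ equivariant tau, exists m : M, m <> 0 &
      forall U : M -> Prop, G_subspace tau G U ->
        (forall p m, U m -> U (dm_O p m)) -> (forall i m, U m -> U (dm_d i m)) ->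
        (forall m, U m -> m = 0) \/ (forall m, U m)].

End Equivariance.

(* Finitely supported sequences (m_l) of vectors of M.  They represent both
   the elements sum_l m_l (x) dt^l of iota_+ M and the elements
   sum_l m_l s^l f^s of M[s]f^s. *)
Definition fseq (C : fieldType) (M : lmodType C) := malg nat M.

Section FSeq.
Variables (C : fieldType) (M : lmodType C).
HB.instance Definition _ := GRing.Zmodule.on (fseq M).

Definition fseq_scale (c : C) (u : fseq M) : fseq M :=
  mkmalg [fsfun l in monalg.msupp u => c *: monalg.mcoeff l u].

Lemma fseq_scaleE c u l : monalg.mcoeff l (fseq_scale c u) = c *: monalg.mcoeff l u.
Proof.
rewrite /fseq_scale monalg.mcoeffE; case: ifPn => // lu.
by rewrite monalg.mcoeff_outdom ?scaler0.
Qed.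

Fact fseq_scaleA a b u :
  fseq_scale a (fseq_scale b u) = fseq_scale (a * b) u.
Proof. by apply/malgP=> l; rewrite !fseq_scaleE scalerA. Qed.
Fact fseq_scale1 : left_id 1 fseq_scale.
Proof. by move=> u; apply/malgP=> l; rewrite fseq_scaleE scale1r. Qed.
Fact fseq_scaleDr : right_distributive fseq_scale +%R.
Proof.
by move=> c u v; apply/malgP=> l; rewrite !(fseq_scaleE, monalg.mcoeffD) scalerDr.
Qed.
Fact fseq_scaleDl u : {morph fseq_scale^~ u : a b / a + b}.
Proof.
by move=> a b; apply/malgP=> l; rewrite !(fseq_scaleE, monalg.mcoeffD) scalerDl.
Qed.
HB.instance Definition _ := GRing.Zmodule_isLmodule.Build C (fseq M)
  fseq_scaleA fseq_scale1 fseq_scaleDr fseq_scaleDl.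

(* The sequence with m in position l and 0 elsewhere. *)
Definition fmono (l : nat) (m : M) : fseq M := mkmalgU l m.

Definition fseq_ext (W : lmodType C) (h : nat -> M -> W) (u : fseq M) : W :=
  \sum_(l <- monalg.msupp u) h l (monalg.mcoeff l u).

End FSeq.

Section Graph.
Variables (C : fieldType) (n : nat) (f : {mpoly C[n]}) (M : dmodule C n).

Definition iota_O (p : {mpoly C[n]}) : fseq M -> fseq M :=
  fseq_ext (fun l m => fmono l (dm_O p m)).
Definition iota_d (i : 'I_n) : fseq M -> fseq M :=
  fseq_ext (fun l m => fmono l (dm_d i m) - fmono l.+1 (dm_O f^`M(i) m)).
Definition iota_dt : fseq M -> fseq M := fseq_ext (fun l m => fmono l.+1 m).
Definition iota_t : fseq M -> fseq M :=
  fseq_ext (fun l m => fmono l (dm_O f m) - fmono l.-1 (m *+ l)).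
Definition iota_s (u : fseq M) : fseq M := - iota_dt (iota_t u).

Inductive Dst_gen : (fseq M -> fseq M) -> Prop :=
| Dst_O p : Dst_gen (iota_O p)
| Dst_d i : Dst_gen (iota_d i)
| Dst_s : Dst_gen iota_s
| Dst_t : Dst_gen iota_t.

Definition Dst := gen_alg Dst_gen.

Definition mfs_s : fseq M -> fseq M := fseq_ext (fun l m => fmono l.+1 m).

(* The isomorphism M[s]f^s -> iota_+ M, m s^l f^s |-> m (x) (- dt t)^l. *)
Definition mfs_to_iota : fseq M -> fseq M :=
  fseq_ext (fun l m => iter l iota_s (fmono 0 m)).

Definition divides_bfun (w : fseq M) (b : {poly C}) :=
  exists2 P, Dst P & P (iota_t w) = op_poly b iota_s w.

Definition is_bfun (w : fseq M) (b : {poly C}) :=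
  [/\ b \is monic, divides_bfun w b &
      forall q, q \is monic -> divides_bfun w q -> (size b <= size q)%N].

(* b_m for m in M: the element m f^s of M[s]f^s corresponds to m (x) 1. *)
Definition is_bfun_of (m : M) (b : {poly C}) :=
  is_bfun (mfs_to_iota (fmono 0 m)) b.

Section GroupAction.
Variables (N : nat) (sigma : 'M[C]_N -> C) (tau : 'M[C]_N -> M -> M).

Definition iota_act (g : 'M[C]_N) : fseq M -> fseq M :=
  fseq_ext (fun l m => fmono l (sigma g ^- l *: tau g m)).
Definition mfs_act (g : 'M[C]_N) : fseq M -> fseq M :=
  fseq_ext (fun l m => fmono l (tau g m)).

End GroupAction.

(* (p(s)) . U f^s for a subset U of M *)
Definition ideal_mul (p : {poly C}) (U : M -> Prop) (u : fseq M) :=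
  exists k (q : 'I_k -> {poly C}) (m : 'I_k -> M),
    (forall i, U (m i)) /\
    u = \sum_i op_poly (q i * p) mfs_s (fmono 0 (m i)).

End Graph.

(* h restricts to an isomorphism of (C[s], G)-modules from A to B. *)
Definition sG_isomorphism (C : fieldType) (N : nat) (G : 'M[C]_N -> Prop)
    (W W' : lmodType C) (s : W -> W) (s' : W' -> W')
    (act : 'M[C]_N -> W -> W) (act' : 'M[C]_N -> W' -> W')
    (h : W -> W') (A : W -> Prop) (B : W' -> Prop) :=
  [/\ G_subspace act G A /\ (forall u, A u -> A (s u)),
      G_subspace act' G B /\ (forall u, B u -> B (s' u)),
      [/\ forall (c : C) u v, A u -> A v -> h (c *: u + v) = c *: h u + h v,
          forall u, A u -> h (s u) = s' (h u) &
          forall g u, G g -> A u -> h (act g u) = act' g (h u)],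
      forall u, A u -> B (h u) &
      (forall u v, A u -> A v -> h u = h v -> u = v) /\
      (forall w, B w -> exists2 u, A u & h u = w)].

Section VFiltration.
Variables (C : numFieldType) (n : nat) (f : {mpoly C[n]}) (M : dmodule C n).

(* The Kashiwara-Malgrange filtration along t = 0.  As D_X<s, t> is
   noetherian, coherent means finitely generated.  Discrete and left-continuous
   indexing means that, for some r > 0, V is constant on every interval
   ]i/r, (i+1)/r]. *)
Definition is_Vfiltration (V : rat -> fseq M -> Prop) :=
  [/\ [/\ forall a b w, a <= b -> V b w -> V a w,
          forall w, exists a, V a w &
          exists2 r : nat, (0 < r)%N & forall a w,
            V a w <-> V ((Num.ceil (r%:R * a))%:~R / r%:R) w],
      forall a, fin_gen (@Dst_gen _ _ f M) (V a),
      (forall a w, V a w -> V (a + 1) (iota_t f w)) /\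
      (exists a0, forall a, a0 <= a -> forall w, V (a + 1) w ->
         exists2 w', V a w' & w = iota_t f w'),
      forall a w, V a w -> V (a - 1) (iota_dt w) &
      forall a, exists k : nat, forall w, V a w ->
        exists2 b, a < b &
          V b (iter k (fun u => iota_s f u + ratr a *: u) w)].

(* The monodromy on the nearby cycles of M along f is exp(2 pi i s) acting on
   gr_V (iota_+ M), and the eigenvalues of s there are roots of b-functions of
   elements of iota_+ M: the monodromy is quasi-unipotent when they are all
   rational. *)
Definition quasi_unipotent_monodromy :=
  forall w : fseq M, exists2 b, is_bfun f w b &
    forall a : C, root b a -> exists q : rat, a = ratr q.

Definition p_condition (V : rat -> fseq M -> Prop) (alpha : rat) (m : M)
    (q : {poly C}) :=
  V alpha (mfs_to_iota f (op_poly q (@mfs_s _ _ M) (fmono 0 m))).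

(* p is the polynomial p_{m,alpha}. *)
Definition is_pV (V : rat -> fseq M -> Prop) (alpha : rat) (m : M)
    (p : {poly C}) :=
  [/\ p \is monic, p_condition V alpha m p &
      forall q, q \is monic -> p_condition V alpha m q -> (size p <= size q)%N].

End VFiltration.

(* deg f; msize f is the total degree plus one. *)
Definition total_degree (C : fieldType) n (f : {mpoly C[n]}) : nat :=
  (mpoly.msize f).-1.

(* [s + a]_k *)
Definition rising (C : fieldType) (a : C) (k : int) : {poly C} :=
  if 1 <= k then \prod_(i < `|k|%N) ('X + (a + i%:R)%:P) else 1.

(* Main.v *)
Require Import Defs.
From HB Require Import structures.
From mathcomp Require Import all_boot all_order all_algebra finmap.
From mathcomp Require mpoly monalg.
Import -(notations) monalg.
Import mpoly.
From mathcomp Require Import complex reals.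
Import Order.TTheory GRing.Theory Num.Theory.
Local Open Scope ring_scope.
From mathcomp Require Import all_field ring lra zify boolp.

(** Write N for iota_+ M, e m for the element m (x) 1 of N, E for the isotypic
    component M_lambda, and b for b_lambda.

    Everything rests on one differential operator.  As G is reductive, the
    nonzero linear form taking a tensor phi of rank d = deg f to
    (sum phi_{i1 ... id} d_{i1} ... d_{id} f)(0) is nonzero on a semi-invariant
    tensor; the latter is a homogeneous constant coefficient operator Q of
    order d, of weight inverse to that of f, with Q f a nonzero constant
    ([dual_operator]).  On the other hand M is torsion free, so Schur's lemma
    and the s-expansion of the elements of N show that every equivariant map
    E -> N has the form x |-> q(s) e x ([hom_polynomial_in_s]).  Hence
    Q t e x = b'(s) e x on E for some polynomial b'.  Its coefficient in
    degree d is the symbol of Q at grad f, divided by f^(d-1).  This symbol is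
    not zero: otherwise Q f^(k+1) = beta(k) f^k with a nonzero polynomial beta
    of degree less than d, and this is impossible by a growth argument
    ([power_identity_degree]).  Indeed, for coefficients in a number field, the
    coefficients of Q^k f^(k+j) are divisible by (kd)! up to factors
    exponential in k, while beta(j) ... beta(j+k-1) is at most
    (k!)^(d-1) C^k.  So b' has degree d, and the minimality of the b-function
    gives b' = b after rescaling Q ([dual_b_function]).

    It follows that q(s) e x lies in V^alpha if and only if p_{lambda,alpha}
    divides q ([V_generator_dvd]).  Two estimates enter.  Since Q preserves V
    and t raises it by one, b(s) b(s+1) ... b(s+k-1) e x lies in V^(a+k) as soon
    as e x lies in V^a.  In the other direction, V^(A+k) is contained in the
    D_X[s]-module generated by the e (f^k x); for w in that module, Q^h t^h w
    lies in b(s+k+r) ... b(s+k+h-1) N for a fixed r and all large h, and for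
    w = q(s) e x this forces b(s) ... b(s+k-1) to divide q.  The nilpotency of
    s + c on the graded pieces then decides factor by factor: in
    b(s) ... b(s+k-1) the factors s + c with c < alpha are needed and those
    with c >= alpha are superfluous, which leaves p_{lambda,alpha}.

    Finally an embedding of the representation lambda into V^alpha is an
    equivariant map x |-> q(s) e x, and p_{lambda,alpha} divides this q; so the
    isotypic component of V^alpha is the image of (p_{lambda,alpha}) E f^s
    ([graph_isomorphism]). *)

Set Implicit Arguments.
Unset Strict Implicit.
Unset Printing Implicit Defensive.

(** * Factorials *)

Lemma exp_ltn_fact (A B : nat) : exists2 k, (0 < k)%N & (A * B ^ k < k`!)%N.
Proof.
have fact_ge (M u : nat) : (M ^ u <= (M + u)`!)%N.
  elim: u => [|u IHu]; first by rewrite fact_gt0.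
  by rewrite addnS factS expnS leq_mul // -addnS leq_addr.
pose C := (2 * B.+1)%N; pose t := (A * B.+1 ^ C)%N.
exists (C + t)%N; first by rewrite addn_gt0 /C mul2n.
apply: leq_trans (fact_ge C t); have -> : (C ^ t = 2 ^ t * B.+1 ^ t)%N by rewrite -expnMn.
rewrite expnD.
have ltt : (t < 2 ^ t)%N by apply: ltn_expl.
apply: (@leq_ltn_trans (t * B.+1 ^ t)%N); last by rewrite ltn_pmul2r ?expn_gt0.
have leX (u : nat) : (B ^ u <= B.+1 ^ u)%N by case: u => // u; rewrite leq_exp2r.
by rewrite mulnA leq_mul // leq_mul.
Qed.

Lemma fact_mul_leq (a k : nat) : (a`! ^ k <= (k * a)`!)%N.
Proof.
elim: k => // k IHk; rewrite expnS mulSn.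
apply: leq_trans (leq_mul (leqnn _) IHk) _.
by rewrite -(@bin_fact (a + k * a) a) ?leq_addr // addKn leq_pmull // bin_gt0 leq_addr.
Qed.

Definition mfact n (a : 'X_{1..n}) : nat := (\prod_(i < n) (a i)`!)%N.

(** A number of exponential size ([fact_cofactor_leq]) such that m! divides
    a! times it, for all exponents a of degree m in n variables.  By the
    pigeonhole principle some entry of a is at least j = (m-1)/n + 1 (rounded
    down); lowering that entry by j divides m! / a! by
    binomial(m, j) / binomial(a_i, j), whence the recursion.  The first argument
    bounds the number of recursive calls. *)
Fixpoint fact_cofactor_rec n (fuel m : nat) : nat :=
  if fuel is fuel'.+1 then
    if m is 0 then 1%N else
    let j := (m.-1 %/ n).+1 in ('C(m, j) * fact_cofactor_rec n fuel' (m - j))%N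
  else 1%N.
Definition fact_cofactor n m := fact_cofactor_rec n m m.
Lemma max_part n (a : 'X_{1..n}) : (0 < mdeg a)%N ->
  exists i : 'I_n, ((mdeg a).-1 %/ n < a i)%N.
Proof.
case: n a => [|n] a a0.
  by move: a0; rewrite mdegE big_ord0.
apply/existsP; apply: contraLR a0 => /existsPn H.
rewrite -leqNgt; case E: (mdeg a) => [|m] //.
exfalso; have : (mdeg a <= n.+1 * (m %/ n.+1))%N.
  rewrite mdegE; apply: leq_trans (_ : (\sum_(i < n.+1) m %/ n.+1 <= _)%N).
    by apply: leq_sum => i _; have := H i; rewrite E -leqNgt.
  by rewrite sum_nat_const card_ord.
rewrite E mulnC => /leq_trans/(_ (leq_trunc_div _ _)); by rewrite ltnn.
Qed.

Lemma fact_cofactor_recP n fuel (a : 'X_{1..n}) : (mdeg a <= fuel)%N ->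
  ((mdeg a)`! %| mfact a * fact_cofactor_rec n fuel (mdeg a))%N.
Proof.
elim: fuel a => [|fuel IH] a; first by rewrite leqn0 => /eqP ->.
case E: (mdeg a) => [|m] //= lem; rewrite -E.
have [|i lti] := @max_part n a; first by rewrite E.
rewrite E /= in lti; set j := (m %/ n).+1 in lti *.
have j0 : (0 < j)%N by [].
clearbody j.
pose b := (a - U_(i) *+ j)%MM.
have ab : a = (b + U_(i) *+ j)%MM.
  rewrite submK //; apply/mnm_lepP=> k; rewrite mulmnE mnm1E.
  by case: eqP => [<-|_]; rewrite ?mul1n ?mul0n.
have db : (mdeg b = m.+1 - j)%N.
  by rewrite -E {1}ab mdegD mdegMn mdeg1 mul1n addnK.
have lej : (j <= m.+1)%N.
  by rewrite -E ab mdegD mdegMn mdeg1 mul1n leq_addl.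
have /dvdnP[q Hq] : ((mdeg b)`! %| mfact b * fact_cofactor_rec n fuel (m.+1 - j))%N.
  by rewrite -db; apply: IH; rewrite db leq_subLR (leq_trans lem) // -add1n leq_add2r.
have mf : mfact a = ('C(a i, j) * j`! * mfact b)%N.
  rewrite /mfact (bigD1 i) //= [in RHS](bigD1 i) //=.
  have bi : b i = (a i - j)%N by rewrite mnmBE mulmnE mnm1E eqxx mul1n.
  rewrite bi -(@bin_fact (a i) j) // -!mulnA; congr (_ * (_ * (_ * _)))%N.
  by apply: eq_bigr => k ki; rewrite mnmBE mulmnE mnm1E eq_sym (negbTE ki) mul0n subn0.
apply/dvdnP; exists ('C(a i, j) * q)%N.
rewrite E -(bin_fact lej) mf.
transitivity ('C(a i, j) * j`! * 'C(m.+1, j) * (mfact b * fact_cofactor_rec n fuel (m.+1 - j)))%N; first ring.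
rewrite Hq db; ring.
Qed.

Lemma fact_cofactorP n (a : 'X_{1..n}) :
  ((mdeg a)`! %| mfact a * fact_cofactor n (mdeg a))%N.
Proof. exact: fact_cofactor_recP. Qed.

(** A step from m to m - j costs a factor binomial(m, j) <= 2^m, and
    m <= n j. *)
Lemma fact_cofactor_leq n m : (0 < n)%N -> (fact_cofactor n m <= 2 ^ (n * m))%N.
Proof.
move=> n0; rewrite /fact_cofactor; have := leqnn m; move: {2 3}m => fuel.
elim: fuel m => [|fuel IH] m; first by rewrite expn_gt0.
case: m => [|m] lem /=; first by rewrite expn_gt0.
set j := (m %/ n).+1.
have lej : (j <= m.+1)%N by rewrite ltnS leq_div.
have bin_le : ('C(m.+1, j) <= 2 ^ m.+1)%N.
  have := expnDn 1 1 m.+1; rewrite addn1 => ->.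
  rewrite (bigD1 (Ordinal (n:=m.+2) (m:=j) lej)) //= !exp1n !muln1; exact: leq_addr.
apply: leq_trans (leq_mul bin_le (IH (m.+1 - j)%N _)) _.
  by rewrite leq_subLR (leq_trans lem) // addSn ltnS leq_addl.
rewrite -expnD leq_exp2l // mulnBr.
have : (m.+1 <= n * j)%N by rewrite /j mulnC; apply: ltn_ceil.
have : (n * j <= n * m.+1)%N by rewrite leq_mul2l lej orbT.
lia.
Qed.
Lemma fact_cofactor_gt0 n m : (0 < fact_cofactor n m)%N.
Proof.
rewrite /fact_cofactor; move: {1}m => k; elim: k m => [|k IH] [|m] //=.
by rewrite muln_gt0 IH andbT bin_gt0 ltnS leq_div.
Qed.

(** * Linear maps and subspaces *)

Lemma linear_scale (R : nzRingType) (U V : lmodType R) (T : U -> V) c u :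
  linear T -> T (c *: u) = c *: T u.
Proof.
move=> lT; have T0 : T 0 = 0.
  by have /eqP := lT 1 0 0; rewrite scaler0 addr0 scale1r -subr_eq0 opprD addNKr oppr_eq0 => /eqP.
by have := lT c u 0; rewrite T0 !addr0.
Qed.

Lemma linear_comp (R : nzRingType) (U V W : lmodType R) (F : V -> W) (K : U -> V) :
  linear F -> linear K -> linear (F \o K).
Proof. by move=> lF lK c u v; rewrite /= lK lF. Qed.

Section Subspaces.
Variable C : fieldType.

Lemma subspaceD (W : lmodType C) (P : W -> Prop) u v : subspace P -> P u -> P v -> P (u + v).
Proof. by move=> [_ h] Pu Pv; rewrite -[u]scale1r; apply: h. Qed.
Lemma subspaceZ (W : lmodType C) (P : W -> Prop) c u : subspace P -> P u -> P (c *: u).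
Proof. by move=> [h0 h] Pu; rewrite -[_ *: _]addr0; apply: h. Qed.
Lemma subspace_sum (W : lmodType C) (P : W -> Prop) (I : Type) (r : seq I) (Pr : pred I) F :
  subspace P -> (forall i, Pr i -> P (F i)) -> P (\sum_(i <- r | Pr i) F i).
Proof. by move=> sP h; apply: big_ind => //; [case: sP|move=> u v; apply: subspaceD]. Qed.
Definition span_of (W : lmodType C) (D : W -> Prop) (u : W) :=
  exists k (w : 'I_k -> W), (forall i, D (w i)) /\ u = \sum_i w i.

Lemma span_of_subspace (W : lmodType C) (D : W -> Prop) :
  (forall c w, D w -> D (c *: w)) -> subspace (span_of D).
Proof.
move=> DZ; split; first by exists 0%N, (fun=> 0); split; [case|rewrite big_ord0].
move=> c u v [k [w [Dw ->]]] [k' [w' [Dw' ->]]].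
exists (k + k')%N, (fun i => match split i with inl j => c *: w j | inr j => w' j end); split.
  by move=> i; case: (split i) => j //; apply: DZ.
rewrite big_split_ord scaler_sumr /=; congr (_ + _); apply: eq_bigr => i _.
  by rewrite -[lshift _ i]/(unsplit (inl i)) unsplitK.
by rewrite -[rshift _ i]/(unsplit (inr i)) unsplitK.
Qed.

Lemma span_of_ind (W : lmodType C) (D P : W -> Prop) u :
  subspace P -> (forall w, D w -> P w) -> span_of D u -> P u.
Proof.
by move=> sP DP [k [w [Dw ->]]]; apply: subspace_sum => // i _; apply: DP.
Qed.

Lemma span_of_mem (W : lmodType C) (D : W -> Prop) w : D w -> span_of D w.
Proof. by move=> Dw; exists 1%N, (fun=> w); split=> //; rewrite big_ord1. Qed.

Lemma span_of_stable (W : lmodType C) (D : W -> Prop) (T : W -> W) :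
  (forall c w, D w -> D (c *: w)) -> linear T -> (forall w, D w -> D (T w)) ->
  forall u, span_of D u -> span_of D (T u).
Proof.
move=> DZ lT DT u; have [s0 sD] := span_of_subspace DZ.
apply: (span_of_ind (P := fun u => span_of D (T u))) => [|w Dw]; last by apply/span_of_mem/DT.
split; last by move=> c v v' Hv Hv'; rewrite lT; apply: sD.
by rewrite -(scale0r (0 : W)) (linear_scale _ _ lT) scale0r.
Qed.
End Subspaces.

(** * Constant coefficient operators *)

Section ConstantCoefficient.
Variables (R : nzRingType) (W : lmodType R) (n : nat) (D : 'I_n -> W -> W).

(** The operator sum_w phi(w) D_{w_1} ... D_{w_d} over the words w of length d.
    Its coefficients form a tensor rather than a symmetric polynomial, so that
    a group may act on them and no commutation of the D_i is presupposed. *)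
Fixpoint tensor_op d (phi : seq 'I_n -> R) (w : W) : W :=
  if d is d'.+1 then \sum_i D i (tensor_op d' (fun s => phi (i :: s)) w)
  else phi [::] *: w.

Lemma eq_tensor_op d phi psi w : (forall s, size s = d -> phi s = psi s) ->
  tensor_op d phi w = tensor_op d psi w.
Proof.
elim: d phi psi => [|d IH] phi psi E /=; first by rewrite E.
by apply: eq_bigr => i _; rewrite (IH _ (fun s => psi (i :: s))) // => s hs; rewrite E //= hs.
Qed.
End ConstantCoefficient.

Section ConstantCoefficientLinear.
Variables (R : comNzRingType) (W : lmodType R) (n : nat) (D : 'I_n -> {linear W -> W}).
Lemma tensor_op_linear d phi : linear (tensor_op (fun i => D i) d phi).
Proof.
elim: d phi => [|d IH] phi c u v /=; first by rewrite scalerDr !scalerA mulrC.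
rewrite scaler_sumr -big_split /=; apply: eq_bigr => i _.
by rewrite IH linearP.
Qed.
End ConstantCoefficientLinear.

Notation diff_op := (tensor_op (fun i p => mderiv i p)).

(** * The growth argument *)

Lemma nat_roots_bounded (L : fieldType) (p : {poly L}) :
  (forall m, (0 < m)%N -> m%:R != 0 :> L) -> p != 0 ->
  exists j, forall i, (j <= i)%N -> p.[i%:R] != 0.
Proof.
move=> charL; have [k] := ubnP (size p); elim: k p => // k IH p ltpk p0.
have [[i0 /factor_theorem[q pq]]|noroot] := pselect (exists i : nat, root p i%:R); last first.
  by exists 0%N => i _; apply/negP => ri; apply: noroot; exists i.
have q0 : q != 0 by apply: contraNneq p0 => q0; rewrite pq q0 mul0r.
have [|j Hj] := IH q _ q0.
  by move: ltpk; rewrite pq size_Mmonic ?monicXsubC // size_XsubC addn2.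
exists (maxn j i0.+1) => i; rewrite geq_max => /andP[ji i0i].
rewrite pq hornerM mulf_neq0 ?Hj // !hornerE -natrB; last exact: ltnW.
by rewrite charL // subn_gt0.
Qed.

Section Estimate.
Variables (L : fieldType) (charL : forall m, (0 < m)%N -> m%:R != 0 :> L) (Int : L -> Prop) (nu : L -> rat).
Hypothesis Int0 : Int 0.
Hypothesis Int1 : Int 1.
Hypothesis IntD : forall x y, Int x -> Int y -> Int (x + y).
Hypothesis IntM : forall x y, Int x -> Int y -> Int (x * y).
Hypothesis Int_den : forall x, exists2 N, (0 < N)%N & Int (x *+ N).
Hypothesis nu_ge0 : forall x, 0 <= nu x.
Hypothesis nuD : forall x y, nu (x + y) <= nu x + nu y.
Hypothesis nu0 : nu 0 = 0.
Hypothesis nuM : forall x y, nu (x * y) <= nu x * nu y.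
Hypothesis nuMn : forall x k, nu (x *+ k) = nu x *+ k.
Hypothesis nu_Int : forall x, Int x -> x != 0 -> 1 <= nu x.

Lemma IntMn x k : Int x -> Int (x *+ k).
Proof. by move=> Ix; elim: k => // k IH; rewrite mulrS; apply: IntD. Qed.

Lemma Int_sum (I : eqType) (r : seq I) (P : pred I) F :
  (forall i, i \in r -> P i -> Int (F i)) -> Int (\sum_(i <- r | P i) F i).
Proof. by move=> H; rewrite big_seq_cond; apply: big_ind => // i /andP[]; apply: H. Qed.

Lemma Int_dens (r : seq L) : exists2 N, (0 < N)%N & forall x, x \in r -> Int (x *+ N).
Proof.
elim: r => [|x r [N N0 HN]]; first by exists 1%N.
have [N' N'0 HN'] := Int_den x; exists (N * N')%N; first by rewrite muln_gt0 N0.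
move=> y; rewrite inE => /predU1P[->|/HN Hy]; last by rewrite mulrnA; apply: IntMn.
by rewrite mulnC mulrnA; apply: IntMn.
Qed.

Variables (n d : nat) (phi : seq 'I_n -> L) (f : {mpoly L[n]}) (b : {poly L}).
Hypotheses (b0 : b != 0) (sb : (size b <= d)%N) (f0 : f != 0).
Hypothesis Qf : forall k, diff_op d phi (f ^+ k.+1) = b.[k%:R] *: f ^+ k.

Local Notation Q := (diff_op d phi).

Lemma diff_op_linear : linear Q.
Proof. exact: (@tensor_op_linear L {mpoly L[n]} n (fun i => mderiv i) d phi). Qed.

Lemma iter_diff_op j k :
  iter k Q (f ^+ (k + j)) = (\prod_(i < k) b.[(j + i)%:R]) *: f ^+ j.
Proof.
have itZ e c p : iter e Q (c *: p) = c *: iter e Q p.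
  by elim: e => //= e ->; rewrite linear_scale //; apply: diff_op_linear.
elim: k => [|k IH]; first by rewrite big_ord0 scale1r.
rewrite iterSr addSn Qf itZ IH // scalerA big_ord_recr /= mulrC; congr (_ * _.[_] *: _).
by rewrite addnC.
Qed.

Inductive deriv_span (Cf : L -> Prop) (F : {mpoly L[n]}) (m : nat) : {mpoly L[n]} -> Prop :=
| deriv_span_nil : deriv_span Cf F m 0
| deriv_span_cons c (a : 'X_{1..n}) x : Cf c -> mdeg a = m -> deriv_span Cf F m x ->
    deriv_span Cf F m (c *: F^`M[a] + x).

Lemma deriv_spanD Cf F m x y : deriv_span Cf F m x -> deriv_span Cf F m y -> deriv_span Cf F m (x + y).
Proof. by elim=> [|c a {}x Cc am _ IH] Hy; rewrite ?add0r // -addrA; apply: deriv_span_cons => //; apply: IH. Qed.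

Lemma deriv_span_deriv Cf F m x i : deriv_span Cf F m x -> deriv_span Cf F m.+1 (mderiv i x).
Proof.
elim=> [|c a {}x Cc am _ IH]; first by rewrite linear0; apply: deriv_span_nil.
rewrite linearD linearZ /= -mderivmU1m -mderivmDm.
by apply: deriv_span_cons => //; rewrite mdegD mdeg1 am addn1.
Qed.

Lemma deriv_span_tensor_op (Cf Cf' : L -> Prop) F m x e psi :
  (forall s c, size s = e -> Cf c -> Cf' (psi s * c)) ->
  deriv_span Cf F m x -> deriv_span Cf' F (e + m) (diff_op e psi x).
Proof.
move=> H Hx; elim: e psi H => [|e IH] psi H /=.
  elim: Hx => [|c a {}x Cc am _ IHx]; first by rewrite scaler0; apply: deriv_span_nil.
  by rewrite scalerDr scalerA; apply: deriv_span_cons => //; apply: H.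
apply: (big_ind (deriv_span Cf' F (e + m).+1)); [exact: deriv_span_nil|exact: deriv_spanD|].
move=> i _; apply: deriv_span_deriv; apply: IH => s c se Cc.
by apply: H => //=; rewrite se.
Qed.

(** [Int] stands for an order of the number field [L] and [nu] for the size of
    a number.  Iterating [Qf] gives Q^k f^(k+j) = b(j) ... b(j+k-1) f^j, and the
    coefficients of this have size at most C^k (k!)^(d-1).  But Q^k F is a
    combination of derivatives of order kd of F, and the coefficients of the
    derivative of exponent a are divisible by a!, hence by (kd)! up to an
    exponential factor.  A nonzero element of [Int] has size at least 1, so
    (kd)!, which is at least (k!)^d, would be bounded by C^k (k!)^(d-1). *)
Lemma growth_contradiction : False.
Proof.
have d0 : (0 < d)%N by apply: leq_trans sb; rewrite size_poly_gt0.
(* from j on, b has no natural root and the products below do not vanish *)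
have [j Hj] : exists j, forall i, (j <= i)%N -> b.[i%:R] != 0.
  exact: nat_roots_bounded.
have n0 : (0 < n)%N.
  rewrite lt0n; apply/eqP => n0; have := Qf j.
  have -> : Q (f ^+ j.+1) = 0.
    case: (d) d0 => // d' _ /=; apply: big1 => -[i lti]; exfalso.
    by move: lti; rewrite n0.
  by move/esym/eqP; rewrite scaler_eq0 (negbTE (Hj _ (leqnn _))) expf_eq0 (negbTE f0) andbF.
(* N clears the denominators of the coefficients of Q and f *)
have [N N0 HN] := Int_dens ([seq phi t | t : d.-tuple 'I_n] ++ [seq f@_m | m <- msupp f]).
have HNphi s : size s = d -> Int (phi s *+ N).
  move=> /eqP hs; apply: HN; rewrite mem_cat; apply/orP; left.
  by apply/codomP; exists (Tuple hs).
have HNf m : Int (f@_m *+ N).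
  have [mf|mf] := boolP (m \in msupp f); last by rewrite memN_msupp_eq0 // mul0rn.
  by apply: HN; rewrite mem_cat; apply/orP; right; apply: map_f.
have HNfk k m : Int ((f ^+ k)@_m *+ N ^ k).
  elim: k m => [|k IH] m; first by rewrite expr0 mcoeff1; case: eqP => _.
  rewrite exprS mcoeffM -sumrMnl; apply: Int_sum => -[m1 m2] _ _ /=.
  by rewrite expnS mulrnA -mulrnAl -mulrnAr; apply: IntM.
have HQ k F : deriv_span (fun c => Int (c *+ N ^ k)) F (k * d) (iter k Q F).
  elim: k => [|k IH] /=.
    rewrite [X in deriv_span _ _ _ X](_ : F = 1 *: F^`M[0] + 0); last by rewrite mderivm0m scale1r addr0.
    by apply: deriv_span_cons; [rewrite expn0|rewrite mdeg0|exact: deriv_span_nil].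
  rewrite mulSn; apply: deriv_span_tensor_op IH => s c hs Ic.
  by rewrite expnS mulrnA -mulrnAl -mulrnAr; apply: IntM => //; apply: HNphi.
(* lower bound: divisibility by (kd)! *)
have Hcoef k u : exists2 y, Int y &
   (iter k Q (f ^+ (k + j)))@_u *+ (N ^ (k + (k + j)) * fact_cofactor n (k * d)) = y *+ (k * d)`!.
  elim: (HQ k (f ^+ (k + j))) => [|c a x Cc am _ [y Iy Hy]]; first by exists 0 => //; rewrite mcoeff0 !mul0rn.
  rewrite mcoeffD mcoeffZ mcoeff_mderivm mulrnDl {}Hy.
  have /dvdnP[q Hq] : ((k * d)`! %| (\prod_(i < n) ((a + u)%MM i) ^_ (a i)) * fact_cofactor n (k * d))%N.
    apply: dvdn_trans (_ : _ %| mfact a * fact_cofactor n (k * d))%N _; first by rewrite -am fact_cofactorP.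
    rewrite dvdn_mul //; apply/dvdnP; exists (\prod_(i < n) 'C((a + u)%MM i, a i))%N.
    by rewrite /mfact -big_split; apply: eq_bigr => i _; rewrite -bin_ffact.
  exists ((c *+ N ^ k) * ((f ^+ (k + j))@_(a + u) *+ N ^ (k + j)) *+ q + y).
    by apply: IntD => //; apply: IntMn; apply: IntM.
  rewrite mulrnDl; congr (_ + _).
  rewrite -[in RHS]mulrnA -Hq expnD !mulrnAr !mulrnAl -!mulrnA; congr (_ *+ _).
  ring.
have [u Hu] : exists u, (f ^+ j)@_u != 0.
  apply: contrapT => H; have /eqP : f ^+ j = 0.
    by apply/mpolyP => m; rewrite mcoeff0; apply/eqP/negP => /negP ne; apply: H; exists m.
  by rewrite expf_eq0 (negbTE f0) andbF.
(* upper bound: the size of the values of b grows like a power d - 1 *)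
have nu_nat (x : L) i : nu (x * i%:R) = nu x * i%:R.
  by rewrite mulr_natr nuMn mulr_natr.
have nub x : nu b.[x%:R] <= (\sum_(i < size b) nu b`_i) * (x.+1 ^ d.-1)%:R.
  rewrite horner_coef mulr_suml.
  apply: le_trans (_ : \sum_(i < size b) nu (b`_i * x%:R ^+ i) <= _).
    by elim/big_ind2: _ => [|x1 x2 y1 y2 h1 h2|i _] //; rewrite ?nu0 // (le_trans (nuD _ _)) ?lerD.
  apply: ler_sum => i _; rewrite -natrX nu_nat ler_wpM2l // ler_nat.
  have : (i <= d.-1)%N by rewrite -ltnS prednK // (leq_trans (ltn_ord i)).
  move=> id; apply: leq_trans (_ : x.+1 ^ i <= _)%N; last by rewrite leq_pexp2l.
  by case: (nat_of_ord i) => // i'; rewrite leq_exp2r.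
set S0 := \sum_(i < size b) nu b`_i in nub.
have S00 : 0 <= S0 by apply: sumr_ge0.
have [B HB] : exists B : nat, S0 <= B%:R.
  by exists (Num.bound S0); apply: ltW; have := archi_boundP S00.
have [K HK] : exists K : nat, nu (f ^+ j)@_u <= K%:R.
  by exists (Num.bound (nu (f ^+ j)@_u)); apply: ltW; apply: archi_boundP.
pose B1 := (B * j.+1 ^ d.-1)%N.
have nuprod k : nu ((\prod_(i < k) b.[(j + i)%:R]) * (f ^+ j)@_u) <= (B1 ^ k * k`! ^ d.-1 * K)%:R.
  elim: k => [|k IH]; first by rewrite big_ord0 mul1r !mul1n exp1n mul1n.
  rewrite big_ord_recr /= mulrAC.
  apply: le_trans (nuM _ _) _.
  have -> : (B1 ^ k.+1 * k.+1`! ^ d.-1 * K = (B1 ^ k * k`! ^ d.-1 * K) * (B1 * k.+1 ^ d.-1))%N.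
    by rewrite expnS factS expnMn; ring.
  rewrite natrM; apply: ler_pM => //.
  apply: le_trans (nub _) _; rewrite natrM /B1 natrM -mulrA; apply: ler_pM => //.
  rewrite -natrM ler_nat -expnMn; case: d.-1 => // e; rewrite leq_exp2r //; nia.
have main k : ((k * d)`! <= N ^ (k + (k + j)) * 2 ^ (n * (k * d)) * (B1 ^ k * k`! ^ d.-1 * K))%N.
  have [y Iy] := Hcoef k u; rewrite iter_diff_op mcoeffZ => Hy.
  have y0 : y != 0.
    apply/eqP => y0; move/eqP: Hy; rewrite y0 mul0rn -mulr_natr !mulf_eq0 (negbTE Hu) orbF.
    rewrite (negbTE (charL _)) ?muln_gt0 ?expn_gt0 ?N0 ?fact_cofactor_gt0 // orbF.
    by apply/negP/prodf_neq0 => i _; apply: Hj; apply: leq_addr.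
  have := nu_Int Iy y0.
  have : nu (y *+ (k * d)`!) <= (N ^ (k + (k + j)) * fact_cofactor n (k * d) * (B1 ^ k * k`! ^ d.-1 * K))%:R.
    rewrite -Hy nuMn [X in _ <= X]natrM -[X in X <= _]mulr_natl. by rewrite ler_wpM2l.
  rewrite nuMn => h1 h2.
  rewrite -(ler_nat rat); apply: le_trans (_ : (N ^ (k + (k + j)) * fact_cofactor n (k * d) * (B1 ^ k * k`! ^ d.-1 * K))%:R <= _).
    by apply: le_trans h1; rewrite -[X in _ <= X]mulr_natr ler_peMl.
  by rewrite ler_nat leq_mul // leq_mul // fact_cofactor_leq.
have [k k0 Hk] := exp_ltn_fact (N ^ j * K) (N ^ 2 * 2 ^ (n * d) * B1).
have := main k; rewrite leqNgt => /negP; apply.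
have := fact_mul_leq k d; rewrite [(d * k)%N]mulnC; apply: leq_trans.
have fact0 : (0 < k`! ^ d.-1)%N by rewrite expn_gt0 fact_gt0.
rewrite -(ltn_pmul2r fact0) -expnS prednK // in Hk.
apply: leq_ltn_trans Hk; apply: eq_leq; rewrite !expnMn !expnD -!expnM.
have -> : (n * (k * d) = n * d * k)%N by ring.
by ring.
Qed.
End Estimate.

(** * Moving the coefficients to a number field *)

Section NumberField.
Variable L : fieldExtType rat.
Local Notation e := (vbasis {:L}).
Local Notation mx x i k := (coord e k (x * e`_i)).

(** In a basis of [L], multiplication by x is a rational matrix.  Call x
    integral when its entries are integers, and measure x by the sum of their
    absolute values: this size is at least 1 when x is integral and nonzero, and
    it is submultiplicative because matrices are multiplied. *)
Definition order_int (x : L) : Prop := forall i k : 'I_(\dim {:L}), mx x i k \is a Num.int.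
Definition order_norm (x : L) : rat := \sum_(i < \dim {:L}) \sum_(k < \dim {:L}) `|mx x i k|.

Lemma vbasis_expansion (y : L) : y = \sum_(k < \dim {:L}) coord e k y *: e`_k.
Proof. exact: (coord_vbasis (memvf y)). Qed.

Lemma mult_coordM (x y : L) (i k : 'I_(\dim {:L})) : mx (x * y) i k = \sum_j mx y i j * mx x j k.
Proof.
rewrite -mulrA [in LHS](vbasis_expansion (y * _)) mulr_sumr linear_sum /=.
by apply: eq_bigr => j _; rewrite -scalerAr linearZ.
Qed.

Lemma mult_coord_eq0 x : (forall i k : 'I_(\dim {:L}), mx x i k = 0) -> x = 0.
Proof.
move=> H; rewrite -[x]mulr1 [1 : L]vbasis_expansion mulr_sumr big1 // => i _.
rewrite -scalerAr [x * _]vbasis_expansion big1 ?scaler0 // => k _.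
by rewrite H scale0r.
Qed.

Lemma rat_denominators (s : seq rat) :
  exists2 N, (0 < N)%N & forall q, q \in s -> q *+ N \is a Num.int.
Proof.
elim: s => [|q s [N N0 HN]]; first by exists 1%N.
exists (N * `|denq q|)%N; first by rewrite muln_gt0 N0 absz_gt0 denq_eq0.
move=> q'; rewrite inE => /predU1P[->|/HN H]; last by rewrite mulrnA rpredMn.
rewrite mulnC mulrnA rpredMn // pmulrn absz_denq -mulrzr -numqE.
exact: intr_int.
Qed.

Lemma number_field_order : exists (Int : L -> Prop) (nu : L -> rat),
  [/\ Int 0, Int 1, forall x y, Int x -> Int y -> Int (x + y),
      forall x y, Int x -> Int y -> Int (x * y) &
      forall x, exists2 N, (0 < N)%N & Int (x *+ N)] /\
  [/\ forall x, 0 <= nu x, forall x y, nu (x + y) <= nu x + nu y, nu 0 = 0 &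
      forall x y, nu (x * y) <= nu x * nu y] /\
  [/\ forall x k, nu (x *+ k) = nu x *+ k &
      forall x, Int x -> x != 0 -> 1 <= nu x].
Proof.
exists order_int, order_norm; split; [split|split; [split|split]].
- by move=> i k; rewrite mul0r linear0.
- move=> i k; rewrite mul1r coord_free ?(basis_free (vbasisP _)) //.
- by move=> x y Ix Iy i k; rewrite mulrDl linearD; apply: rpredD; [exact: Ix|exact: Iy].
- by move=> x y Ix Iy i k; rewrite mult_coordM rpred_sum // => j _; apply: rpredM; [exact: Iy|exact: Ix].
- move=> x.
  have [N N0 HN] := rat_denominators [seq mx x p.1 p.2 | p : 'I_(\dim {:L}) * 'I_(\dim {:L})].
  exists N => // i k; rewrite mulrnAl linearMn HN //.
  by apply/codomP; exists (i, k).
- by move=> x; rewrite sumr_ge0 // => i _; rewrite sumr_ge0.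
- move=> x y; rewrite -big_split; apply: ler_sum => i _ /=.
  rewrite -big_split; apply: ler_sum => k _ /=.
  by rewrite mulrDl linearD ler_normD.
- by rewrite /order_norm big1 // => i _; rewrite big1 // => k _; rewrite mul0r linear0 normr0.
- move=> x y; rewrite /order_norm [X in _ <= X]mulrC mulr_suml; apply: ler_sum => i _.
  rewrite mulr_suml.
  apply: le_trans (_ : \sum_k \sum_j `|mx y i j| * `|mx x j k| <= _).
    apply: ler_sum => k _; rewrite mult_coordM; apply: le_trans (ler_norm_sum _ _ _) _.
    by apply: ler_sum => j _; rewrite normrM.
  rewrite exchange_big /=; apply: ler_sum => j _; rewrite -mulr_sumr ler_wpM2l //.
  by rewrite [X in _ <= X](bigD1 j) //= lerDl sumr_ge0 // => j' _; rewrite sumr_ge0.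
- move=> x k; rewrite /order_norm -sumrMnl; apply: eq_bigr => i _.
  rewrite -sumrMnl; apply: eq_bigr => j _.
  by rewrite mulrnAl linearMn normrMn.
- move=> x Ix x0.
  have [i [k nz]] : exists i k : 'I_(\dim {:L}), mx x i k != 0.
    apply: contrapT => H; move/eqP: x0; apply; apply: mult_coord_eq0 => i k; apply/eqP/negP => /negP nz.
    by apply: H; exists i, k.
  have h1 := norm_intr_ge1 (Ix i k) nz; apply: (le_trans h1).
  rewrite /order_norm (bigD1 i) //= (bigD1 k) //= -addrA lerDl addr_ge0 //.
    by rewrite sumr_ge0.
  by rewrite sumr_ge0 // => j _; rewrite sumr_ge0.
Qed.
End NumberField.

(** Coefficients of [K] can be moved to algebraic numbers while a given one
    stays nonzero.  The ring [A] merely covers a subring of [K]: polynomial rings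
    will serve, and killing the kernel of [iota] is all that is needed to carry
    identities over. *)
Definition specializable (A : comNzRingType) (K : fieldType) (iota : {rmorphism A -> K}) :=
  forall u, iota u != 0 -> exists phi : {rmorphism A -> algC},
    phi u != 0 /\ forall a, iota a = 0 -> phi a = 0.

Lemma map_poly_coef_eq0 (A : comNzRingType) (K K' : fieldType) (iota : {rmorphism A -> K})
    (phi : {rmorphism A -> K'}) (p : {poly A}) :
  (forall a, iota a = 0 -> phi a = 0) -> map_poly iota p = 0 -> map_poly phi p = 0.
Proof.
move=> H /polyP p0; apply/polyP => i; rewrite coef_map coef0 /= H //.
by have := p0 i; rewrite coef_map coef0.
Qed.

Lemma map_poly_neq0_coef (A : comNzRingType) (K : fieldType) (iota : {rmorphism A -> K})
  (p : {poly A}) : map_poly iota p != 0 -> exists i, iota p`_i != 0.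
Proof.
move=> p0; exists (size (map_poly iota p)).-1; by rewrite -coef_map -/(lead_coef _) lead_coef_eq0.
Qed.

(** A relation of least size among those that do not vanish in [K] keeps its
    leading coefficient in [K]: without it there would be a smaller one. *)
Lemma minimal_relation (A : comNzRingType) (K : fieldType) (iota : {rmorphism A -> K}) (z : K)
    (g0 : {poly A}) : map_poly iota g0 != 0 -> (map_poly iota g0).[z] = 0 ->
  exists g : {poly A}, [/\ iota (lead_coef g) != 0, (map_poly iota g).[z] = 0 &
    forall r : {poly A}, (map_poly iota r).[z] = 0 -> (size r < size g)%N ->
      map_poly iota r = 0].
Proof.
have [k] := ubnP (size g0); elim: k g0 => // k IH g0 ltgk g0n g0z.
have [[r [rz ltr /eqP rn]]|H] := pselect (exists r : {poly A},
  [/\ (map_poly iota r).[z] = 0, (size r < size g0)%N & map_poly iota r <> 0]).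
  by apply: (IH r) => //; apply: leq_trans ltr _; rewrite -ltnS.
exists g0; split=> // [|r rz ltr]; last by apply: contrapT => rn; apply: H; exists r.
apply/eqP => lg; apply: H; exists (take_poly (size g0).-1 g0).
have g00 : (0 < size g0)%N.
  by rewrite lt0n size_poly_eq0; apply: contraNneq g0n => ->; rewrite raddf0.
have E : map_poly iota (take_poly (size g0).-1 g0) = map_poly iota g0.
  apply/polyP => i; rewrite !coef_map coef_take_poly; case: ltnP => // le_i.
  move: le_i; rewrite leq_eqVlt => /predU1P[<-|lt_i]; first by rewrite -/(lead_coef g0) /= raddf0 lg.
  by rewrite nth_default //; move: lt_i; rewrite prednK.
rewrite E; split=> //; last exact/eqP.
by apply: leq_ltn_trans (size_take_poly _ _) _; rewrite prednK.
Qed.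

(** If z is transcendental, keep one coefficient of u nonzero and send the
    variable outside of the roots.  If z has a minimal relation g, the variable
    must go to a root of g that is not a root of u.  Such a root exists:
    otherwise g would divide a power of u after specialization, and the
    remainder of that power modulo g would vanish, whereas one of its
    coefficients was kept nonzero. *)
Lemma specializable_adjoin (A : comNzRingType) (K : fieldType) (iota : {rmorphism A -> K}) (z : K) :
  specializable iota ->
  specializable (horner_eval z \o map_poly iota : {rmorphism {poly A} -> K}).
Proof.
move=> spA u; rewrite /= /horner_eval => uz.
have [[g0 [g0n g0z]]|trans] := pselect (exists g0 : {poly A},
  map_poly iota g0 != 0 /\ (map_poly iota g0).[z] = 0); last first.
  have un : map_poly iota u != 0 by apply: contraNneq uz => ->; rewrite horner0.
  have [i ui] := map_poly_neq0_coef un.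
  have [phi [phiu ker]] := spA _ ui.
  have phin : map_poly phi u != 0.
    by apply: contraNneq phiu => /polyP/(_ i); rewrite coef_map coef0 => /eqP.
  have [x /negP xr] := closed_nonrootP _ phin.
  exists (horner_eval x \o map_poly phi : {rmorphism {poly A} -> algC}).
  split; rewrite /= /horner_eval; first by apply/negP.
  move=> p pz; rewrite (map_poly_coef_eq0 ker) ?horner0 //.
  by apply: contrapT => /eqP pn; apply: trans; exists p.
have [g [lg gz gmin]] := minimal_relation g0n g0z.
pose N := size g; pose v := u ^+ N.
pose r := Pdiv.Ring.rmodp v g.
have gn : g != 0 by apply: contraNneq lg => ->; rewrite lead_coef0 raddf0.
have divE p := Pdiv.ComRing.rdivp_eq g p.
have ltr p : (size (Pdiv.Ring.rmodp p g) < size g)%N by rewrite Pdiv.Ring.ltn_rmodp.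
have rn : map_poly iota r != 0.
  apply: contraNneq uz => r0.
  have := congr1 (fun p => (map_poly iota p).[z]) (divE v).
  rewrite /= -/r rmorphD rmorphM /= r0 addr0 hornerM gz mulr0 map_polyZ /= hornerZ /v.
  rewrite !rmorphXn /= horner_exp => /eqP; rewrite mulf_eq0 expf_eq0 (negbTE lg) andbF /=.
  by rewrite expf_eq0 => /andP[_ /eqP ->].
have [i ri] := map_poly_neq0_coef rn.
have [|phi [phin ker]] := spA (lead_coef g * r`_i); first by rewrite rmorphM mulf_neq0.
move: phin; rewrite rmorphM mulf_eq0 negb_or => /andP[phig phir].
have szg : size (map_poly phi g) = size g by rewrite size_map_poly_id0.
have lg0 : lead_coef (map_poly phi g) != 0.
  by rewrite lead_coef_eq0 -size_poly_eq0 szg size_poly_eq0.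
have [x gx ux] : exists2 x, root (map_poly phi g) x & ~~ root (map_poly phi u) x.
  apply: contrapT => H.
  have dv : map_poly phi g %| map_poly phi v.
    have [s Es] := closed_field_poly_normal (map_poly phi g).
    rewrite Es dvdpZl //.
    have szs : size s = N.-1.
      move: szg; rewrite {1}Es size_scale; last exact: lg0.
      by rewrite size_prod_XsubC /N => <-.
    have rt y : y \in s -> root (map_poly phi u) y.
      move=> ys; apply: contrapT => /negP nr; apply: H; exists y => //.
      by rewrite Es rootZ // root_prod_XsubC.
    rewrite /v rmorphXn /=.
    apply: dvdp_trans (_ : (map_poly phi u) ^+ size s %| _); last by rewrite dvdp_exp2l // szs leq_pred.
    elim: s rt {Es szs} => [|y s IH] rt; first by rewrite big_nil dvd1p.
    rewrite big_cons exprS dvdp_mul ?IH //; first by rewrite dvdp_XsubCl rt ?mem_head.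
    by move=> y' ys; rewrite rt // inE ys orbT.
  have : map_poly phi g %| map_poly phi r.
    have := congr1 (map_poly phi) (divE v); rewrite -/r rmorphD rmorphM /= map_polyZ /=.
    rewrite -(dvdp_addr _ (dvdp_mull (map_poly phi (Pdiv.Ring.rdivp v g)) (dvdpp _))) => <-.
    by rewrite dvdpZr // rmorphXn expf_neq0.
  have rphin : map_poly phi r != 0.
    by apply: contraNneq phir => /polyP/(_ i); rewrite coef_map coef0 /= => ->.
  move/(dvdp_leq rphin); rewrite szg leqNgt (leq_ltn_trans _ (ltr v)) //.
  exact: size_poly.
exists (horner_eval x \o map_poly phi : {rmorphism {poly A} -> algC}).
split; rewrite /= /horner_eval //.
move=> p pz; have := congr1 (map_poly phi) (divE p); rewrite rmorphD rmorphM /= map_polyZ /=.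
rewrite [X in _ = _ + X](@map_poly_coef_eq0 _ _ _ iota) //; last first.
  apply: gmin => //; have := congr1 (fun p => (map_poly iota p).[z]) (divE p).
  by rewrite /= rmorphD rmorphM /= map_polyZ /= hornerD hornerM hornerZ gz pz !mulr0 add0r.
move/(congr1 (horner^~ x)); rewrite hornerD hornerM hornerZ (rootP gx) mulr0 horner0 addr0.
move/eqP; rewrite mulf_eq0 rmorphXn expf_eq0 (negbTE phig) andbF /= => /eqP //.
Qed.

Lemma specialization_ring (K : numFieldType) (s : seq K) :
  exists (A : comNzRingType) (iota : {rmorphism A -> K}), specializable iota /\
    forall z, z \in s -> exists a, iota a = z.
Proof.
elim: s => [|z s [A [iota [sp im]]]].
  exists int, (intr : {rmorphism int -> K}); split=> // u u0.
  exists (intr : {rmorphism int -> algC}); split.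
    by rewrite intr_eq0; apply: contraNneq u0 => ->; rewrite raddf0.
  by move=> a /eqP; rewrite intr_eq0 => /eqP ->; rewrite raddf0.
exists {poly A}, (horner_eval z \o map_poly iota : {rmorphism {poly A} -> K}).
split; first exact: specializable_adjoin.
move=> y; rewrite inE => /predU1P[->|/im[a <-]].
  by exists 'X; rewrite /= /horner_eval map_polyX hornerX.
by exists a%:P; rewrite /= /horner_eval map_polyC hornerC.
Qed.

Lemma map_diff_op (R S : comNzRingType) (g : {rmorphism R -> S}) n d (phi : seq 'I_n -> R)
    (p : {mpoly R[n]}) :
  map_mpoly g (diff_op d phi p) = diff_op d (g \o phi) (map_mpoly g p).
Proof.
elim: d phi => [|d IH] phi /=; first by rewrite map_mpolyZ.
rewrite raddf_sum; apply: eq_bigr => i _.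
by rewrite -IH; apply/mpolyP => m; rewrite mcoeff_map_mpoly !mcoeff_deriv raddfMn mcoeff_map_mpoly.
Qed.

Definition power_identity (K : fieldType) n d (phi : seq 'I_n -> K) (f : {mpoly K[n]}) (b : {poly K}) :=
  forall k, diff_op d phi (f ^+ k.+1) = b.[k%:R] *: f ^+ k.

Section Transfer.
Variables (A : comNzRingType) (K K' : fieldType).
Variables (iota : {rmorphism A -> K}) (psi : {rmorphism A -> K'}).
Hypothesis ker : forall a, iota a = 0 -> psi a = 0.

Lemma power_identity_transfer n d (phi : seq 'I_n -> A) (f : {mpoly A[n]}) (b : {poly A}) :
  power_identity d (iota \o phi) (map_mpoly iota f) (map_poly iota b) ->
  power_identity d (psi \o phi) (map_mpoly psi f) (map_poly psi b).
Proof.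
move=> H k; pose X := diff_op d phi (f ^+ k.+1) - b.[k%:R] *: f ^+ k.
have mapX (K0 : fieldType) (g : {rmorphism A -> K0}) : map_mpoly g X =
    diff_op d (g \o phi) (map_mpoly g f ^+ k.+1) - (map_poly g b).[k%:R] *: map_mpoly g f ^+ k.
  rewrite raddfB /= map_diff_op map_mpolyZ !rmorphXn; congr (_ - _ *: _).
  by rewrite -(rmorph_nat g) horner_map.
apply/eqP; rewrite -subr_eq0 -mapX; apply/eqP/mpolyP => m.
rewrite mcoeff_map_mpoly mcoeff0; apply: ker.
by rewrite -mcoeff_map_mpoly mapX H subrr mcoeff0.
Qed.

Lemma lift_mpoly n (f : {mpoly K[n]}) : (forall m, exists a, iota a = f@_m) ->
  exists fA, map_mpoly iota fA = f.
Proof.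
move=> /choice[g Hg]; exists (\sum_(m <- msupp f) g m *: 'X_[m]).
rewrite raddf_sum [RHS]mpolyE; apply: eq_bigr => m _.
by rewrite /= map_mpolyZ map_mpolyX Hg.
Qed.

Lemma lift_poly (b : {poly K}) : (forall i, exists a, iota a = b`_i) ->
  exists bA, map_poly iota bA = b.
Proof.
move=> /choice[g Hg]; exists (\poly_(i < size b) g i); apply/polyP => i.
rewrite coef_map coef_poly /=; case: ltnP => lti; first by rewrite Hg.
by rewrite raddf0 nth_default.
Qed.
End Transfer.

Definition identity_values (K : fieldType) n d (phi : seq 'I_n -> K) (f : {mpoly K[n]}) (b : {poly K}) : seq K :=
  0 :: [seq phi t | t : d.-tuple 'I_n] ++ [seq f@_m | m <- msupp f] ++ b.

(** An identity involves finitely many coefficients, which can be lifted one by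
    one. *)
Lemma power_identity_lift (A : comNzRingType) (K : fieldType) (iota : {rmorphism A -> K})
    n d (phi : seq 'I_n -> K) (f : {mpoly K[n]}) (b : {poly K}) :
  (forall z, z \in identity_values d phi f b -> exists a, iota a = z) ->
  power_identity d phi f b ->
  exists phiA fA bA, [/\ map_mpoly iota fA = f, map_poly iota bA = b &
    power_identity d (iota \o phiA) (map_mpoly iota fA) (map_poly iota bA)].
Proof.
move=> im H.
have [fA EfA] : exists fA, map_mpoly iota fA = f.
  apply: lift_mpoly => m; apply: im; rewrite inE !mem_cat.
  have [mf|mf] := boolP (m \in msupp f); last by rewrite memN_msupp_eq0 ?eqxx.
  by apply/or4P; apply: Or43; apply: map_f.
have [bA EbA] : exists bA, map_poly iota bA = b.
  apply: lift_poly => i; apply: im; rewrite inE !mem_cat.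
  have [ib|ib] := ltnP i (size b); last by rewrite nth_default ?eqxx.
  by rewrite mem_nth // !orbT.
have /choice[phiA EphiA] : forall s, exists a, size s = d -> iota a = phi s.
  move=> s; have [/eqP hs|hs] := eqVneq (size s) d; last by exists 0 => /eqP; rewrite (negbTE hs).
  have [|a Ha] := im (phi s); last by exists a.
  rewrite inE !mem_cat; apply/orP; right; apply/orP; left.
  by apply/codomP; exists (Tuple hs).
exists phiA, fA, bA; rewrite EfA EbA; split=> // k.
by rewrite -H; apply: eq_tensor_op.
Qed.

(** The identity is moved to algebraic numbers, keeping one coefficient of f and
    one of b nonzero, and from there to the number field generated by the
    coefficients, where [growth_contradiction] applies. *)
Theorem power_identity_degree (K : numFieldType) n d (phi : seq 'I_n -> K)
    (f : {mpoly K[n]}) (b : {poly K}) :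
  b != 0 -> f != 0 -> power_identity d phi f b -> (d < size b)%N.
Proof.
move=> b0 f0 H; rewrite ltnNge; apply/negP => sb.
have [A [iota [sp im]]] := specialization_ring (identity_values d phi f b).
have [phiA [fA [bA [Ef Eb {}H]]]] := power_identity_lift im H.
have [i bi] : exists i, iota bA`_i != 0 by apply: map_poly_neq0_coef; rewrite Eb.
have [m fm] : exists m, iota fA@_m != 0.
  apply: contrapT => Hn; move/eqP: f0; apply; apply/mpolyP => m.
  rewrite -Ef mcoeff_map_mpoly mcoeff0; apply/eqP/negP => /negP nz.
  by apply: Hn; exists m.
have [|psi [psin ker]] := sp (bA`_i * fA@_m); first by rewrite rmorphM mulf_neq0.
have {}H := power_identity_transfer ker H.
move: psin; rewrite rmorphM mulf_eq0 negb_or => /andP[psib psif].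
set f1 := map_mpoly psi fA in H; set b1 := map_poly psi bA in H.
have f1n : f1 != 0.
  by apply: contraNneq psif => /mpolyP/(_ m); rewrite mcoeff_map_mpoly mcoeff0 => ->.
have b1n : b1 != 0.
  by apply: contraNneq psib => /polyP/(_ i); rewrite coef_map coef0 /= => ->.
have sb1 : (size b1 <= d)%N.
  apply/leq_sizeP => j /(leq_sizeP _ _ sb); rewrite -Eb !coef_map /=; exact: ker.
move: {H}(H : power_identity d (psi \o phiA) f1 b1).
move: (psi \o phiA) => phi1; move: f1 b1 f1n b1n sb1 => f1 b1 f1n b1n sb1 H.
have [Qs [QsC [s1 Es _]]] := num_field_exists (identity_values d phi1 f1 b1).
have im1 z : z \in identity_values d phi1 f1 b1 -> exists a, QsC a = z.
  by rewrite -Es => /mapP[a _ ->]; exists a.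
have [phi2 [f2 [b2 [Ef2 Eb2 {}H]]]] := power_identity_lift im1 H.
have kerQ a : QsC a = 0 -> (idfun : {rmorphism Qs -> Qs}) a = 0.
  by move/eqP; rewrite fmorph_eq0 => /eqP.
have {}H := power_identity_transfer kerQ H.
have mf2 : map_mpoly idfun f2 = f2 by apply/mpolyP => u; rewrite mcoeff_map_mpoly.
rewrite map_poly_id // mf2 in H.
have [Int [nu [[I0 I1 ID IM Iden] [[nu0 nuD nu00 nuM] [nuMn nuI]]]]] := number_field_order Qs.
have charQs (k : nat) : (0 < k)%N -> k%:R != 0 :> Qs.
  by move=> k0; rewrite -(fmorph_eq0 QsC) rmorph_nat pnatr_eq0 -lt0n.
apply: (growth_contradiction charQs I0 I1 ID IM Iden nu0 nuD nu00 nuM nuMn nuI (b := b2) _ _ _ H).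
- by apply: contraNneq b1n => b20; rewrite -Eb2 b20 raddf0.
- by rewrite -(size_map_poly QsC) Eb2.
- by apply: contraNneq f1n => f20; rewrite -Ef2 f20 raddf0.
Qed.

(** * The direct image under the graph embedding *)

Section DmoduleLinear.
Variables (C : fieldType) (n : nat) (M : dmodule C n).

Lemma dm_O_is_linear p : linear (@dm_O C n M p).
Proof. by move=> c u v; rewrite dm_O_addr -!dm_O_scal -!dm_O_mul mulrC. Qed.
HB.instance Definition _ p := GRing.isLinear.Build C M M *:%R (@dm_O C n M p) (dm_O_is_linear p).

Lemma dm_d_is_linear i : linear (@dm_d C n M i).
Proof. by move=> c u v; rewrite dm_d_add -dm_O_scal dm_d_leibniz mderivC -{1}mpolyC0 dm_O_scal scale0r add0r dm_O_scal. Qed.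
HB.instance Definition _ i := GRing.isLinear.Build C M M *:%R (@dm_d C n M i) (dm_d_is_linear i).

Lemma dm_OZ (c : C) p (m : M) : dm_O (c *: p) m = c *: dm_O p m.
Proof. by rewrite -mul_mpolyC dm_O_mul dm_O_scal. Qed.
Lemma dm_O0 (m : M) : dm_O 0 m = 0.
Proof. by rewrite -mpolyC0 dm_O_scal scale0r. Qed.
Lemma dm_O1 (m : M) : dm_O 1 m = m.
Proof. by rewrite -mpolyC1 dm_O_scal scale1r. Qed.
Lemma dm_O_comm p q (m : M) : dm_O p (dm_O q m) = dm_O q (dm_O p m).
Proof. by rewrite -!dm_O_mul mulrC. Qed.
Lemma dm_ON p (m : M) : dm_O (- p) m = - dm_O p m.
Proof. by apply/eqP; rewrite -addr_eq0 -dm_O_addl addNr dm_O0. Qed.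
Lemma dm_OB p q (m : M) : dm_O (p - q) m = dm_O p m - dm_O q m.
Proof. by rewrite dm_O_addl dm_ON. Qed.
Lemma dm_O_sum (I : Type) (r : seq I) (P : pred I) F (m : M) :
  dm_O (\sum_(i <- r | P i) F i) m = \sum_(i <- r | P i) dm_O (F i) m.
Proof. by elim/big_rec2: _ => [|i x y _ <-]; rewrite ?dm_O0 ?dm_O_addl. Qed.
Lemma dm_O_exp p k (m : M) : dm_O (p ^+ k) m = iter k (dm_O p) m.
Proof. by elim: k => [|k IH]; rewrite ?dm_O1 // exprS dm_O_mul IH. Qed.
End DmoduleLinear.

Section FseqLinear.
Variables (C : fieldType) (M : lmodType C).
Implicit Types (u v : fseq M).

Lemma fmono_is_linear l : linear (@fmono C M l).
Proof.
move=> c u v; apply/malgP => k.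
rewrite monalg.mcoeffD fseq_scaleE !monalg.mcoeffU.
by case: eqP; rewrite ?mulr1n ?mulr0n ?scaler0 ?addr0.
Qed.
HB.instance Definition _ l := GRing.isLinear.Build C M (fseq M) *:%R (@fmono C M l) (fmono_is_linear l).

Lemma fseqE u : u = \sum_(l <- monalg.msupp u) fmono l (monalg.mcoeff l u).
Proof. exact: (monalg.monalgE u). Qed.

Lemma mcoeff_sum_fmono (m_ : nat -> M) L k :
  monalg.mcoeff k (\sum_(j < L) fmono j (m_ j) : fseq M) = if (k < L)%N then m_ k else 0.
Proof.
rewrite raddf_sum /=; case: ltnP => [ltk|lek].
  rewrite (bigD1 (Ordinal ltk)) //= monalg.mcoeffUU big1 ?addr0 // => i ik.
  rewrite monalg.mcoeffU (_ : (i == k :> nat) = false) ?mulr0n //.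
  by apply/negbTE; apply: contra ik => /eqP ik; apply/eqP; apply: val_inj.
rewrite big1 // => i _; rewrite monalg.mcoeffU ltn_eqF ?mulr0n //.
exact: leq_trans lek.
Qed.

Variables (W : lmodType C) (h : nat -> M -> W).
Hypothesis lin_h : forall l, linear (h l).

Lemma fseq_extEw (A : {fset nat}) u : (monalg.msupp u `<=` A)%fset ->
  fseq_ext h u = \sum_(l <- A) h l (monalg.mcoeff l u).
Proof.
move=> sA; rewrite /fseq_ext; apply: big_fset_incl => // l _ lu.
by rewrite monalg.mcoeff_outdom // -(scale0r (0 : M)) linear_scale // scale0r.
Qed.

Lemma fseq_ext_linear : linear (fseq_ext h).
Proof.
move=> c u v; pose A := (monalg.msupp u `|` monalg.msupp v `|` monalg.msupp (c *: u + v))%fset.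
rewrite (@fseq_extEw A (c *: u + v)) ?fsubsetUr //.
rewrite (@fseq_extEw A u); last by rewrite /A -fsetUA fsubsetUl.
rewrite (@fseq_extEw A v); last by rewrite /A fsetUAC fsubsetUr.
rewrite scaler_sumr -big_split; apply: eq_bigr => l _ /=.
by rewrite monalg.mcoeffD fseq_scaleE lin_h.
Qed.

Lemma fseq_ext_mono l m : fseq_ext h (fmono l m) = h l m.
Proof.
rewrite (@fseq_extEw [fset l]%fset) ?monalg.msuppU_le // big_seq_fset1.
by rewrite monalg.mcoeffUU.
Qed.
End FseqLinear.

Lemma fseq_linear_ext (C : fieldType) (M W : lmodType C) (F G : {linear fseq M -> W}) :
  (forall l m, F (fmono l m) = G (fmono l m)) -> F =1 G.
Proof.
by move=> H u; rewrite [u]fseqE !linear_sum; apply: eq_bigr => l _; apply: H.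
Qed.

Lemma eq_on_monomials (C : fieldType) (M W : lmodType C) (F K : fseq M -> W) : linear F -> linear K ->
  (forall k m, F (fmono k m) = K (fmono k m)) -> F =1 K.
Proof.
move=> lF lK.
pose F' : {linear fseq M -> W} := HB.pack F (GRing.isLinear.Build _ _ _ _ F lF).
pose K' : {linear fseq M -> W} := HB.pack K (GRing.isLinear.Build _ _ _ _ K lK).
exact: (fseq_linear_ext (F := F') (G := K')).
Qed.

Section IotaLinear.
Variables (C : fieldType) (n : nat) (f : {mpoly C[n]}) (M : dmodule C n).
Notation N := (fseq M).

Let lin_comp_mono l (T : {linear M -> M}) : linear (fun m => fmono l (T m)).
Proof. by move=> c u v; rewrite !linearP. Qed.
Let lin_sub_mono l l' (T T' : {linear M -> M}) : linear (fun m => fmono l (T m) - fmono l' (T' m)).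
Proof. by move=> c u v; rewrite !linearP /= addrACA scalerDr. Qed.

Lemma iota_O_linear p : linear (@iota_O C n M p).
Proof. by apply: fseq_ext_linear => l; apply: lin_comp_mono. Qed.
HB.instance Definition _ p := GRing.isLinear.Build C N N *:%R (@iota_O C n M p) (iota_O_linear p).
Lemma iota_O_mono p l m : @iota_O C n M p (fmono l m) = fmono l (dm_O p m).
Proof. by rewrite /iota_O fseq_ext_mono // => l'; apply: lin_comp_mono. Qed.

Lemma iota_d_linear i : linear (@iota_d C n f M i).
Proof. by apply: fseq_ext_linear => l; apply: lin_sub_mono. Qed.
HB.instance Definition _ i := GRing.isLinear.Build C N N *:%R (@iota_d C n f M i) (iota_d_linear i).
Lemma iota_d_mono i l m :
  @iota_d C n f M i (fmono l m) = fmono l (dm_d i m) - fmono l.+1 (dm_O f^`M(i) m).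
Proof. by rewrite /iota_d fseq_ext_mono // => l'; apply: lin_sub_mono. Qed.

Lemma iota_dt_linear : linear (@iota_dt C n M).
Proof. by apply: fseq_ext_linear => l; apply: (lin_comp_mono _ idfun). Qed.
HB.instance Definition _ := GRing.isLinear.Build C N N *:%R (@iota_dt C n M) iota_dt_linear.
Lemma iota_dt_mono l m : @iota_dt C n M (fmono l m) = fmono l.+1 m.
Proof. by rewrite /iota_dt fseq_ext_mono // => l'; apply: (lin_comp_mono _ idfun). Qed.

Let lin_t l : linear (fun m : M => fmono l (dm_O f m) - fmono l.-1 (m *+ l)).
Proof. by move=> c u v; rewrite mulrnDl scalerMnr !linearP /= addrACA scalerDr. Qed.
Lemma iota_t_linear : linear (@iota_t C n f M).
Proof. exact: fseq_ext_linear. Qed.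
HB.instance Definition _ := GRing.isLinear.Build C N N *:%R (@iota_t C n f M) iota_t_linear.
Lemma iota_t_mono l m : @iota_t C n f M (fmono l m) = fmono l (dm_O f m) - fmono l.-1 (m *+ l).
Proof. by rewrite /iota_t fseq_ext_mono. Qed.

Lemma iota_s_linear : linear (@iota_s C n f M).
Proof. by move=> c u v; rewrite /iota_s !linearP. Qed.
HB.instance Definition _ := GRing.isLinear.Build C N N *:%R (@iota_s C n f M) iota_s_linear.
Lemma iota_s_mono l m : @iota_s C n f M (fmono l m) = fmono l (m *+ l) - fmono l.+1 (dm_O f m).
Proof.
rewrite /iota_s iota_t_mono linearB /= !iota_dt_mono opprB.
by case: l => [|l] //=; rewrite !mulr0n !linear0.
Qed.

Lemma mfs_s_linear : linear (@mfs_s C n M).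
Proof. by apply: fseq_ext_linear => l; apply: (lin_comp_mono _ idfun). Qed.
HB.instance Definition _ := GRing.isLinear.Build C N N *:%R (@mfs_s C n M) mfs_s_linear.
Lemma mfs_s_mono l m : @mfs_s C n M (fmono l m) = fmono l.+1 m.
Proof. by rewrite /mfs_s fseq_ext_mono // => l'; apply: (lin_comp_mono _ idfun). Qed.

Let lin_iter_s l : linear (fun m : M => iter l (@iota_s C n f M) (fmono 0 m)).
Proof.
move=> c u v; rewrite linearP; elim: l => //= l ->.
by rewrite linearP.
Qed.
Lemma mfs_to_iota_linear : linear (@mfs_to_iota C n f M).
Proof. exact: fseq_ext_linear. Qed.
HB.instance Definition _ := GRing.isLinear.Build C N N *:%R (@mfs_to_iota C n f M) mfs_to_iota_linear.
Lemma mfs_to_iota_mono l m :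
  @mfs_to_iota C n f M (fmono l m) = iter l (@iota_s C n f M) (fmono 0 m).
Proof. by rewrite /mfs_to_iota fseq_ext_mono. Qed.
Lemma mfs_to_iota_s u : mfs_to_iota f (@mfs_s C n M u) = iota_s f (mfs_to_iota f u).
Proof.
apply: (@fseq_linear_ext _ _ _ (mfs_to_iota f (M := M) \o @mfs_s C n M)
   (@iota_s C n f M \o mfs_to_iota f (M := M))) => l m /=.
by rewrite mfs_s_mono !mfs_to_iota_mono.
Qed.

Local Notation s := (@iota_s C n f M).
Local Notation t := (@iota_t C n f M).
Local Notation O := (@iota_O C n M).
Local Notation d := (@iota_d C n f M).

Lemma iota_ts w : t (s w) = s (t w) + t w.
Proof.
apply: (@fseq_linear_ext _ _ _ (t \o s) ((s \o t) \+ t)) => l m /=.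
rewrite !(iota_s_mono, iota_t_mono) !linearB /= !(iota_s_mono, iota_t_mono) /=.
case: l => [|l] /=; first by rewrite !mulr0n !linear0 !addr0 sub0r sub0r subr0 opprB mulr1n addrC.
rewrite !raddfMn /= !mulNrn; move: (fmono l.+1 (dm_O f m)) (fmono l m) (fmono l.+2 _) => a b c.
rewrite [a *+ l.+2]mulrS [_ *+ l.+1 *+ l.+1]mulrS.
move: (a *+ l.+1) (b *+ l.+1) (b *+ l.+1 *+ l) => A B B'.
by rewrite !opprB !opprD !addrA [RHS](ACl (1*6*4*5*3*2)).
Qed.
Lemma iota_Os p w : O p (s w) = s (O p w).
Proof.
apply: (@fseq_linear_ext _ _ _ (O p \o s) (s \o O p)) => l m /=.
rewrite !(iota_s_mono, iota_O_mono) linearB /= !iota_O_mono.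
by rewrite raddfMn /= dm_O_comm.
Qed.
Lemma iota_Ot p w : O p (t w) = t (O p w).
Proof.
apply: (@fseq_linear_ext _ _ _ (O p \o t) (t \o O p)) => l m /=.
rewrite !(iota_t_mono, iota_O_mono) linearB /= !iota_O_mono.
by rewrite raddfMn /= dm_O_comm.
Qed.

Lemma iota_ds i w : d i (s w) = s (d i w).
Proof.
apply: (@fseq_linear_ext _ _ _ (d i \o s) (s \o d i)) => l m /=.
rewrite !(iota_s_mono, iota_d_mono) !linearB /= !(iota_d_mono, iota_s_mono) dm_d_leibniz !linearD /=.
rewrite (dm_O_comm f^`M(i) f) !raddfMn /= mulrSr !mulNrn.
move: (fmono l _) (fmono l.+1 (dm_O f (dm_d i m))) (fmono l.+1 (dm_O f^`M(i) m)) (fmono l.+2 _) => a a' b c.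
move: (a *+ l) (b *+ l) => A B.
by rewrite !opprK !addrA [RHS](ACl (1*3*4*2*5)).
Qed.
Lemma iota_dt_comm i w : d i (t w) = t (d i w).
Proof.
apply: (@fseq_linear_ext _ _ _ (d i \o t) (t \o d i)) => l m /=.
rewrite !(iota_t_mono, iota_d_mono) !linearB /= !(iota_d_mono, iota_t_mono) dm_d_leibniz !linearD /=.
rewrite (dm_O_comm f^`M(i) f).
case: l => [|l] /=; first by rewrite !mulr0n !linear0 !addr0 !opprK mulr1n addrA [RHS](ACl (3*1*2)).
rewrite !raddfMn /= [_ *+ l.+2]mulrS !mulNrn.
move: (fmono l (dm_d i m)) (fmono l.+1 (dm_O f^`M(i) m)) (fmono l.+1 (dm_O f (dm_d i m))) (fmono l.+2 _) => u p q r.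
move: (u *+ l.+1) (p *+ l.+1) => U P.
by rewrite ?opprD !opprK !addrA [RHS](ACl (4*1*3*2*5)).
Qed.

Lemma iota_d_comm i j w : d i (d j w) = d j (d i w).
Proof.
apply: (@fseq_linear_ext _ _ _ (d i \o d j) (d j \o d i)) => l m /=.
rewrite !iota_d_mono !linearB /= !iota_d_mono !dm_d_leibniz !linearD /= ?opprD ?opprK.
rewrite (dm_d_comm j i) (dm_O_comm f^`M(j)) (mderiv_comm j i).
by rewrite ?opprK !addrA [RHS](ACl (1*4*3*2*5)).
Qed.
Lemma iota_d_leibniz i p w : d i (O p w) = O p^`M(i) w + O p (d i w).
Proof.
apply: (@fseq_linear_ext _ _ _ (d i \o O p) (O p^`M(i) \+ (O p \o d i))) => l m /=.
rewrite !(iota_O_mono, iota_d_mono) !linearB /= !iota_O_mono dm_d_leibniz linearD /=.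
by rewrite (dm_O_comm p) addrA.
Qed.
End IotaLinear.

(** * Polynomials in s *)

Section OpPoly.
Variables (C : fieldType) (W : lmodType C) (S : {linear W -> W}).
Implicit Types (p q : {poly C}) (w : W).

Lemma op_polyEw k p w : (size p <= k)%N -> op_poly p S w = \sum_(i < k) p`_i *: iter i S w.
Proof.
move=> lek; rewrite /op_poly (big_ord_widen k (fun i => p`_i *: iter i S w)) // big_mkcond /=.
by apply: eq_bigr => i _; case: ltnP => // /(nth_default 0) ->; rewrite scale0r.
Qed.

Lemma op_polyD p q w : op_poly (p + q) S w = op_poly p S w + op_poly q S w.
Proof.
pose k := maxn (size p) (size q).
rewrite !(@op_polyEw k) ?leq_maxl ?leq_maxr ?(leq_trans (size_polyD _ _)) //.
by rewrite -big_split; apply: eq_bigr => i _; rewrite coefD scalerDl.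
Qed.

Lemma op_polyZ c p w : op_poly (c *: p) S w = c *: op_poly p S w.
Proof.
rewrite !(@op_polyEw (size p)) ?size_scale_leq // scaler_sumr.
by apply: eq_bigr => i _; rewrite coefZ scalerA.
Qed.

Lemma op_poly0 w : op_poly 0 S w = 0.
Proof. by rewrite /op_poly size_poly0 big_ord0. Qed.

Lemma op_polyC c w : op_poly c%:P S w = c *: w.
Proof. by rewrite (@op_polyEw 1) ?size_polyC_leq1 // big_ord1 coefC. Qed.

Lemma op_poly1 w : op_poly 1 S w = w.
Proof. by rewrite op_polyC scale1r. Qed.

Lemma op_polyXn k w : op_poly 'X^k S w = iter k S w.
Proof.
rewrite (@op_polyEw k.+1) ?size_polyXn // big_ord_recr /= coefXn eqxx scale1r.
by rewrite big1 ?add0r // => i _; rewrite coefXn ltn_eqF // scale0r.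
Qed.

Lemma op_polyX w : op_poly 'X S w = S w.
Proof. by rewrite -['X]expr1 op_polyXn. Qed.

Lemma op_poly_is_linear p : linear (op_poly p S).
Proof.
have lin_iter i : linear (iter i S) by move=> c u v; elim: i => //= i ->; rewrite linearP.
move=> c u v; rewrite /op_poly scaler_sumr -big_split; apply: eq_bigr => i _ /=.
by rewrite lin_iter scalerDr !scalerA mulrC.
Qed.
HB.instance Definition _ p := GRing.isLinear.Build C W W *:%R (op_poly p S) (op_poly_is_linear p).

Lemma op_poly_intertwine (T S' : W -> W) q w : linear T -> (forall u, T (S' u) = S' (T u)) ->
  T (op_poly q S' w) = op_poly q S' (T w).
Proof.
move=> lT TS; pose T' : {linear W -> W} := HB.pack T (GRing.isLinear.Build _ _ _ _ T lT).
rewrite /op_poly -[LHS]/(T' _) linear_sum; apply: eq_bigr => i _; rewrite linearZ /=.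
by congr (_ *: _); elim: {i}(i : nat) => //= i <-.
Qed.

Lemma op_poly_comm (T : {linear W -> W}) p w : (forall u, T (S u) = S (T u)) ->
  T (op_poly p S w) = op_poly p S (T w).
Proof. by apply: op_poly_intertwine => c u v; apply: linearP. Qed.

Lemma op_polyM p q w : op_poly (p * q) S w = op_poly p S (op_poly q S w).
Proof.
elim/poly_ind: p => [|p c IH]; first by rewrite mul0r !op_poly0.
have opXM r u : op_poly (r * 'X) S u = S (op_poly r S u).
  rewrite (@op_polyEw (size r).+1); last first.
    have [->|r0] := eqVneq r 0; first by rewrite mul0r size_poly0.
    by rewrite size_mulX.
  rewrite big_ord_recl coefMX eqxx scale0r add0r /op_poly linear_sum.
  by apply: eq_bigr => i _; rewrite coefMX linearZ.
rewrite mulrDl mulrAC !op_polyD !opXM IH.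
by rewrite mul_polyC op_polyZ op_polyC.
Qed.

Lemma op_poly_commute p q w : op_poly p S (op_poly q S w) = op_poly q S (op_poly p S w).
Proof. by rewrite -!op_polyM mulrC. Qed.

Lemma op_poly_shift (T : {linear W -> W}) p w : (forall u, T (S u) = S (T u) + T u) ->
  T (op_poly p S w) = op_poly (p \Po ('X + 1)) S (T w).
Proof.
move=> TS; elim/poly_ind: p => [|p c IH]; first by rewrite comp_poly0 !op_poly0 linear0.
rewrite comp_polyD comp_polyM comp_polyX comp_polyC !op_polyD linearD /=.
rewrite !op_polyC linearZ /=; congr (_ + _).
have -> : op_poly (p * 'X) S w = S (op_poly p S w) by rewrite mulrC op_polyM op_polyX.
by rewrite TS IH mulrDr mulr1 op_polyD [_ * 'X]mulrC op_polyM op_polyX.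
Qed.
End OpPoly.

Section Expansion.
Variables (C : numFieldType) (n : nat) (f : {mpoly C[n]}) (M : dmodule C n).
Variable finv : M -> M.
Hypotheses (fK : cancel (dm_O f) finv) (finvK : cancel finv (dm_O f)).

Local Notation s := (@iota_s C n f M).
Local Notation t := (@iota_t C n f M).
Local Notation e m := (fmono 0 m : fseq M).
Local Notation coef := (@monalg.mcoeff nat M).

Lemma f_inj : injective (dm_O f : M -> M). Proof. exact: can_inj fK. Qed.
Lemma f_eq0 (m : M) : dm_O f m = 0 -> m = 0.
Proof. by move=> h; apply: f_inj; rewrite h linear0. Qed.

Lemma mcoeff_fseqZ k c w : coef k (c *: w : fseq M) = c *: coef k w.
Proof. exact: fseq_scaleE. Qed.

Lemma mcoeff_s w k : coef k.+1 (s w) = coef k.+1 w *+ k.+1 - dm_O f (coef k w).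
Proof.
rewrite [w]fseqE linear_sum !raddf_sum /= -sumrMnl -big_split /=.
apply: eq_bigr => l _; rewrite iota_s_mono monalg.mcoeffB !monalg.mcoeffU eqSS.
move: (monalg.mcoeff l w) => m; congr (_ - _).
  by case: eqP => [->|]; rewrite ?mulr1n // !mulr0n mul0rn.
by case: eqP => _; rewrite ?mulr1n // !mulr0n linear0.
Qed.
(** The position of the last nonzero coefficient is a degree in s: there s acts
    by -f, which is injective, and shifts the position by one
    ([has_sdeg_s]). *)
Definition has_sdeg L (w : fseq M) := coef L w <> 0 /\ forall k, (L < k)%N -> coef k w = 0.
Definition sdeg_lt L (w : fseq M) := forall k, (L <= k)%N -> coef k w = 0.

Lemma has_sdeg_unique L L' w : has_sdeg L w -> has_sdeg L' w -> L = L'.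
Proof.
move=> [h1 h2] [h3 h4]; have [lt|lt|//] := ltngtP L L'.
  by case: (h3 (h2 _ lt)).
by case: (h1 (h4 _ lt)).
Qed.

Lemma sdeg_lt_s L w : sdeg_lt L w -> sdeg_lt L.+1 (s w).
Proof.
by move=> h [//|k] lek; rewrite mcoeff_s (h _ (ltnW lek)) (h k lek) mul0rn linear0 subr0.
Qed.
Lemma sdeg_lt_add L u v : sdeg_lt L u -> sdeg_lt L v -> sdeg_lt L (u + v).
Proof. by move=> hu hv k lek; rewrite monalg.mcoeffD hu // hv // addr0. Qed.
Lemma sdeg_lt_scale L c u : sdeg_lt L u -> sdeg_lt L (c *: u).
Proof. by move=> hu k lek; rewrite mcoeff_fseqZ hu // scaler0. Qed.
Lemma sdeg_lt_le L L' u : (L <= L')%N -> sdeg_lt L u -> sdeg_lt L' u.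
Proof. by move=> le h k lek; apply: h; apply: leq_trans lek. Qed.
Lemma sdeg_lt_iter L i w : sdeg_lt L w -> sdeg_lt (i + L)%N (iter i s w).
Proof. by move=> h; elim: i => //= i; apply: sdeg_lt_s. Qed.
Arguments sdeg_lt_iter [L] i [w].
Lemma sdeg_lt_e m : sdeg_lt 1 (e m).
Proof. by move=> [|k] // _; rewrite monalg.mcoeffU. Qed.

Lemma sdeg_lt_exists w : exists L, sdeg_lt L w.
Proof.
exists (\max_(l <- monalg.msupp w) l).+1 => k lek; apply: monalg.mcoeff_outdom.
by apply/negP => kw; move: lek; rewrite ltnNge leq_bigmax_seq.
Qed.
Lemma sdeg_lt_has_sdeg L w : sdeg_lt L w -> w <> 0 -> exists2 l, has_sdeg l w & (l < L)%N.
Proof.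
elim: L => [|L IH] h w0.
  by exfalso; apply: w0; apply/malgP => k; rewrite monalg.mcoeff0; apply: h.
have [c0|c0] := pselect (coef L w = 0); last by exists L => //; split.
have [k lek|l tl ltl] := IH _ w0; last by exists l => //; apply: ltnW.
by move: lek; rewrite leq_eqVlt => /predU1P[<-//|/h].
Qed.
Lemma has_sdeg_exists w : w <> 0 -> exists l, has_sdeg l w.
Proof. by move=> w0; have [L hL] := sdeg_lt_exists w; have [l] := sdeg_lt_has_sdeg hL w0; exists l. Qed.

Lemma has_sdeg_s L w : has_sdeg L w -> has_sdeg L.+1 (s w).
Proof.
move=> [h1 h2]; split; first by rewrite mcoeff_s h2 // mul0rn sub0r => /eqP; rewrite oppr_eq0 => /eqP/f_eq0.
by move=> [|k] // ltk; rewrite mcoeff_s (h2 _ (ltnW ltk)) (h2 k ltk) mul0rn linear0 subr0.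
Qed.
Lemma has_sdeg_iter L i w : has_sdeg L w -> has_sdeg (i + L)%N (iter i s w).
Proof. by move=> h; elim: i => //= i; apply: has_sdeg_s. Qed.
Arguments has_sdeg_iter [L] i [w].
Lemma has_sdeg_lt L w : has_sdeg L w -> sdeg_lt L.+1 w. Proof. by case. Qed.
Lemma has_sdeg_add L u v : sdeg_lt L u -> has_sdeg L v -> has_sdeg L (u + v).
Proof.
move=> hu [h1 h2]; split; first by rewrite monalg.mcoeffD hu // add0r.
by move=> k ltk; rewrite monalg.mcoeffD hu 1?ltnW // h2 // addr0.
Qed.
Lemma has_sdeg_scale L c u : c != 0 -> has_sdeg L u -> has_sdeg L (c *: u).
Proof.
move=> c0 [h1 h2]; split; first by rewrite mcoeff_fseqZ => /eqP; rewrite scaler_eq0 (negbTE c0) /= => /eqP.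
by move=> k ltk; rewrite mcoeff_fseqZ h2 // scaler0.
Qed.

Lemma sdeg_lt_sum (I : Type) (r : seq I) (P : pred I) F L :
  (forall i, P i -> sdeg_lt L (F i)) -> sdeg_lt L (\sum_(i <- r | P i) F i).
Proof.
by move=> h; elim/big_ind: _ => // [k _|u v]; [rewrite monalg.mcoeff0|apply: sdeg_lt_add].
Qed.

Lemma has_sdeg_op_poly L (B : {poly C}) w : B != 0 -> has_sdeg L w -> has_sdeg ((size B).-1 + L)%N (op_poly B s w).
Proof.
move=> B0 tw; rewrite /op_poly; have : (0 < size B)%N by rewrite size_poly_gt0.
case E: (size B) => [|k] //= _; rewrite big_ord_recr /=; apply: has_sdeg_add.
  apply: sdeg_lt_sum => i _; apply: sdeg_lt_scale; apply: (@sdeg_lt_le (i + L.+1)%N).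
    by rewrite addnS -addSn leq_add2r.
  exact: (sdeg_lt_iter i (has_sdeg_lt tw)).
apply: has_sdeg_scale; last exact: has_sdeg_iter.
by move: B0; rewrite -lead_coef_eq0 /lead_coef E.
Qed.

Lemma op_poly_s_neq0 (B : {poly C}) w : B != 0 -> w <> 0 -> op_poly B s w <> 0.
Proof.
move=> B0 /has_sdeg_exists[L /(has_sdeg_op_poly B0)[h _] h0]; apply: h.
by rewrite h0 monalg.mcoeff0.
Qed.

Lemma s_inj : injective s.
Proof.
move=> u v suv; apply/eqP; rewrite -subr_eq0; apply/eqP; apply: contrapT => uv0.
have := @op_poly_s_neq0 'X _ _ uv0; rewrite polyX_eq0 op_polyX linearB /= suv subrr.
by move=> /(_ isT); apply.
Qed.

Lemma e_neq0 m : m <> 0 -> e m <> 0.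
Proof. by move=> m0 /(congr1 (coef 0)); rewrite monalg.mcoeffUU monalg.mcoeff0. Qed.
Lemma has_sdeg_e m : m <> 0 -> has_sdeg 0 (e m).
Proof. by move=> m0; split; [rewrite monalg.mcoeffUU|move=> [|k] // _; rewrite monalg.mcoeffU]. Qed.

(** The remainder of A modulo B applied to [e x] has a degree in s below
    deg B, while a nonzero element of B(s) N has degree at least deg B. *)
Lemma op_poly_dvd (A B : {poly C}) (x : M) u : x <> 0 -> B != 0 ->
  op_poly A s (e x) = op_poly B s u -> B %| A.
Proof.
move=> x0 B0 E; pose u' := u - op_poly (A %/ B) s (e x).
have E' : op_poly (A %% B) s (e x) = op_poly B s u'.
  rewrite /u' linearB /= -E -op_polyM; apply/eqP.
  by rewrite eq_sym subr_eq addrC mulrC -op_polyD -divp_eq.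
have [u0|u0] := pselect (u' = 0).
  apply/modp_eq0P; apply/eqP; apply: contrapT => /negP R0.
  by apply: (op_poly_s_neq0 R0 (e_neq0 x0)); rewrite E' u0 linear0.
have [L tL] := has_sdeg_exists u0; have tB := has_sdeg_op_poly B0 tL.
have [R0|R0] := eqVneq (A %% B) 0; first by rewrite /dvdp R0.
have tR := has_sdeg_op_poly R0 (has_sdeg_e x0); rewrite E' in tR.
have := has_sdeg_unique tB tR; rewrite addn0.
have : (size (A %% B)%R < size B)%N by rewrite ltn_modp.
have : (0 < size (A %% B)%R)%N by rewrite size_poly_gt0.
move: (size (A %% B)%R) (size B) => a b a0 ab.
by case: a a0 ab => // a _; case: b => // b; rewrite ltnS /= => ltab E2; move: ltab; rewrite -E2 ltnNge leq_addr.
Qed.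

Lemma mcoeff_iter_e l m : coef l (iter l s (e m)) = iter l (fun x => - dm_O f x) m.
Proof.
elim: l => [|l IH]; first by rewrite /= monalg.mcoeffUU.
by rewrite /= mcoeff_s IH (sdeg_lt_iter l (sdeg_lt_e m) ) ?addn1 // mul0rn sub0r.
Qed.

(** m s^l maps to (-1)^l f^l m in position l plus terms in lower positions. *)
Lemma mfs_to_iota_sdeg L u : has_sdeg L u -> has_sdeg L (mfs_to_iota f u).
Proof.
move=> [h1 h2]; pose m := coef L u.
have -> : mfs_to_iota f u = (mfs_to_iota f u - iter L s (e m)) + iter L s (e m) by rewrite subrK.
apply: has_sdeg_add; last by rewrite -{1}[L]addn0; apply: has_sdeg_iter; apply: has_sdeg_e.
have Lu : L \in monalg.msupp u by rewrite -monalg.mcoeff_neq0; apply/eqP.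
rewrite /mfs_to_iota /fseq_ext (big_fsetD1 L) //= -/m addrAC subrr add0r.
rewrite big_seq_cond; apply: sdeg_lt_sum => l; rewrite in_fsetD1 andbT => /andP[lL lu].
have ltlL : (l < L)%N.
  rewrite ltn_neqAle lL leqNgt; apply/negP => /h2 l0.
  by move: lu; rewrite -monalg.mcoeff_neq0 l0 eqxx.
by apply: sdeg_lt_le (sdeg_lt_iter l (sdeg_lt_e _)); rewrite addn1.
Qed.

Lemma mfs_to_iota_inj : injective (mfs_to_iota f (M := M)).
Proof.
move=> u v uv; apply/eqP; rewrite -subr_eq0; apply/eqP; apply: contrapT => /has_sdeg_exists[L].
by move/mfs_to_iota_sdeg => [h _]; apply: h; rewrite linearB /= uv subrr monalg.mcoeff0.
Qed.

Lemma mfs_to_iota_surj (w : fseq M) : exists u : fseq M, mfs_to_iota f u = w.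
Proof.
have [L] := sdeg_lt_exists w; elim: L w => [|L IH] w hw.
  by exists 0; rewrite linear0; apply/malgP => k; rewrite monalg.mcoeff0 hw.
have [m Hm] : exists m, iter L (fun x => - dm_O f x) m = coef L w.
  elim: L (coef L w) {IH hw} => [|L IH] x; first by exists x.
  by have [m Hm] := IH (- finv x); exists m; rewrite /= Hm linearN /= opprK finvK.
have [k|u Hu] := IH (w - iter L s (e m)).
  rewrite leq_eqVlt => /predU1P[<-|ltk]; first by rewrite monalg.mcoeffB mcoeff_iter_e Hm subrr.
  by rewrite monalg.mcoeffB hw // (sdeg_lt_iter L (sdeg_lt_e m)) ?addn1 // subr0.
by exists (u + fmono L m); rewrite linearD /= Hu mfs_to_iota_mono subrK.
Qed.

Lemma s_expansion w : exists m_ : nat -> M, exists L, w = \sum_(i < L) iter i s (e (m_ i)).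
Proof.
have [u <-] := mfs_to_iota_surj w; have [L hL] := sdeg_lt_exists u.
exists (fun i => coef i u), L.
have Eu : u = \sum_(i < L) fmono i (coef i u).
  by apply/malgP => k; rewrite (mcoeff_sum_fmono (fun i => coef i u)); case: ltnP => // /hL.
by rewrite {1}Eu linear_sum; apply: eq_bigr => i _; rewrite /= mfs_to_iota_mono.
Qed.

Lemma iota_t_e m : t (e m) = e (dm_O f m).
Proof. by rewrite iota_t_mono mulr0n linear0 subr0. Qed.
Lemma iota_d_e i m : iota_d f i (e m) = e (dm_d i m) + s (e (dm_O f^`M(i) (finv m))).
Proof.
by rewrite iota_d_mono iota_s_mono mulr0n linear0 sub0r dm_O_comm finvK.
Qed.

End Expansion.

(** * Operators with constant coefficients on the direct image *)

Section QopCommutation.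
Variables (C : fieldType) (W : lmodType C) (n : nat) (D : 'I_n -> {linear W -> W}).
Local Notation Q := (tensor_op (fun i => D i)).

Lemma tensor_op_commute d phi (T : {linear W -> W}) w :
  (forall i u, T (D i u) = D i (T u)) -> T (Q d phi w) = Q d phi (T w).
Proof.
move=> TD; elim: d phi => [|d IH] phi /=; first by rewrite linearZ.
by rewrite linear_sum; apply: eq_bigr => i _; rewrite TD IH.
Qed.

(** The commutator of [tensor_op] with the coordinate x_i, by the Leibniz rule
    along each word. *)
Fixpoint tensor_op_bracket d (phi : seq 'I_n -> C) (i : 'I_n) (w : W) : W :=
  if d is d'.+1 then
    \sum_j (D j (tensor_op_bracket d' (fun s => phi (j :: s)) i w) +
            (j == i)%:R *: Q d' (fun s => phi (j :: s)) w)
  else 0.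

Lemma tensor_op_bracket_commute d phi i (T : {linear W -> W}) w :
  (forall i u, T (D i u) = D i (T u)) -> T (tensor_op_bracket d phi i w) = tensor_op_bracket d phi i (T w).
Proof.
move=> TD; elim: d phi => [|d IH] phi /=; first by rewrite linear0.
rewrite linear_sum; apply: eq_bigr => j _.
by rewrite linearD linearZ /= TD IH tensor_op_commute.
Qed.

Lemma tensor_op_coordinate d phi i (X : {linear W -> W}) w :
  (forall j u, D j (X u) = (j == i)%:R *: u + X (D j u)) ->
  Q d phi (X w) = X (Q d phi w) + tensor_op_bracket d phi i w.
Proof.
move=> DX; elim: d phi => [|d IH] phi /=; first by rewrite linearZ addr0.
rewrite linear_sum -big_split; apply: eq_bigr => j _ /=.
by rewrite IH linearD /= DX -addrA addrC -addrA.
Qed.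
End QopCommutation.

Section LinearProducts.
Variable C : numFieldType.
Definition linfactor (q : rat) : {poly C} := 'X + (ratr q)%:P.
Definition linprod (s : seq rat) : {poly C} := \prod_(q <- s) linfactor q.

Lemma linfactor_monic q : linfactor q \is monic.
Proof. by rewrite /linfactor -[_%:P]opprK -polyCN monicXsubC. Qed.
Lemma linprod_monic s : linprod s \is monic.
Proof. by rewrite monic_prod // => q _; apply: linfactor_monic. Qed.
Lemma linprod_cat s s' : linprod (s ++ s') = linprod s * linprod s'.
Proof. exact: big_cat. Qed.
Lemma linfactor_shift q c : linfactor q \Po ('X + (ratr c)%:P) = linfactor (q + c).
Proof.
by rewrite /linfactor comp_polyD comp_polyX comp_polyC rmorphD /= polyCD addrAC addrA.
Qed.

Lemma linprod_coprime (s s' : seq rat) : (forall q, q \in s -> q \notin s') ->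
  coprimep (linprod s) (linprod s').
Proof.
move=> dis; rewrite /linprod big_seq; apply: (big_ind (fun g => coprimep g _)).
- exact: coprime1p.
- by move=> g h; rewrite coprimepMl => -> ->.
move=> q qs; rewrite big_seq; apply: (big_ind (fun g => coprimep _ g)).
- exact: coprimep1.
- by move=> g h; rewrite coprimepMr => -> ->.
move=> q' qs'; rewrite /linfactor -[(ratr q')%:P]opprK -polyCN coprimep_XsubC /root !hornerE.
by rewrite addrC subr_eq0 (inj_eq (fmorph_inj _)); apply: contraNneq (dis _ qs) => ->.
Qed.
End LinearProducts.

(** * The V-filtration on the generators *)

Section Core.
Variables (C : numFieldType) (n : nat) (f : {mpoly C[n]}) (M : dmodule C n).
Variable finv : M -> M.
Hypotheses (fK : cancel (dm_O f) finv) (finvK : cancel finv (dm_O f)).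
Local Notation N := (fseq M).
Local Notation s := (@iota_s C n f M).
Local Notation t := (@iota_t C n f M).
Local Notation e m := (fmono 0 m : N).
Local Notation P_ q w := (op_poly q s w).

Lemma Os_poly p q w : iota_O p (P_ q w) = P_ q (iota_O p w).
Proof. by apply: (@op_poly_comm _ _ (s : {linear N -> N}) (@iota_O C n M p : {linear N -> N})) => u; apply: iota_Os. Qed.
Lemma ds_poly i q w : iota_d f i (P_ q w) = P_ q (iota_d f i w).
Proof. by apply: (@op_poly_comm _ _ (s : {linear N -> N}) (@iota_d C n f M i : {linear N -> N})) => u; apply: iota_ds. Qed.
Lemma t_poly q w : t (P_ q w) = P_ (q \Po ('X + 1)) (t w).
Proof. by apply: (@op_poly_shift _ _ (s : {linear N -> N}) (t : {linear N -> N})) => u; apply: iota_ts. Qed.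

Variables (d : nat) (phi : seq 'I_n -> C).
Local Notation Q := (tensor_op (fun i => @iota_d C n f M i) d phi).

Lemma dual_op_linear : linear Q.
Proof. exact: (tensor_op_linear (fun i => iota_d f i : {linear N -> N})). Qed.
HB.instance Definition _ := GRing.isLinear.Build C N N *:%R Q dual_op_linear.

Lemma iota_OD p q (w : N) : iota_O (p + q) w = iota_O p w + iota_O q w.
Proof.
rewrite [w]fseqE !linear_sum -big_split; apply: eq_bigr => l _ /=.
by rewrite !iota_O_mono dm_O_addl linearD.
Qed.
Lemma iota_OM p q (w : N) : iota_O (p * q) w = iota_O p (iota_O q w).
Proof.
rewrite [w]fseqE [LHS]linear_sum [X in _ = iota_O p X]linear_sum [RHS]linear_sum.
by apply: eq_bigr => l _ /=; rewrite !iota_O_mono dm_O_mul.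
Qed.
Lemma iota_OC c (w : N) : iota_O c%:MP w = c *: w.
Proof.
rewrite [w]fseqE linear_sum scaler_sumr; apply: eq_bigr => l _ /=.
by rewrite iota_O_mono dm_O_scal linearZ.
Qed.
Lemma iota_OZ c p (w : N) : iota_O (c *: p) w = c *: iota_O p w.
Proof. by rewrite -mul_mpolyC iota_OM iota_OC. Qed.

Lemma dual_op_s w : Q (s w) = s (Q w).
Proof.
symmetry; apply: (@tensor_op_commute C N n (fun i => iota_d f i : {linear N -> N}) d phi (s : {linear N -> N})).
by move=> i u /=; rewrite iota_ds.
Qed.
Lemma dual_op_t w : Q (t w) = t (Q w).
Proof.
symmetry; apply: (@tensor_op_commute C N n (fun i => iota_d f i : {linear N -> N}) d phi (t : {linear N -> N})).
by move=> i u /=; rewrite iota_dt_comm.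
Qed.
Lemma dual_op_d i w : Q (iota_d f i w) = iota_d f i (Q w).
Proof.
symmetry; apply: (@tensor_op_commute C N n (fun i => iota_d f i : {linear N -> N}) d phi (iota_d f i : {linear N -> N})).
by move=> j u /=; rewrite iota_d_comm.
Qed.
Lemma dual_op_poly q w : Q (P_ q w) = P_ q (Q w).
Proof.
by apply: (@op_poly_comm _ _ (s : {linear N -> N}) (Q : {linear N -> N})) => u; apply: dual_op_s.
Qed.

Local Notation T i := (@tensor_op_bracket C N n (fun i => iota_d f i : {linear N -> N}) d phi i).

Lemma bracket_poly i q w : T i (P_ q w) = P_ q (T i w).
Proof.
symmetry; apply: (@tensor_op_bracket_commute C N n (fun i => iota_d f i : {linear N -> N}) d phi i (op_poly q s : {linear N -> N})).
by move=> j u /=; rewrite ds_poly.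
Qed.
Lemma bracket_dual_op i w : T i (Q w) = Q (T i w).
Proof.
symmetry; apply: (@tensor_op_bracket_commute C N n (fun i => iota_d f i : {linear N -> N}) d phi i (Q : {linear N -> N})).
by move=> j u /=; rewrite dual_op_d.
Qed.
Lemma dual_op_coordinate i w : Q (iota_O 'X_i w) = iota_O 'X_i (Q w) + T i w.
Proof.
apply: (@tensor_op_coordinate C N n (fun i => iota_d f i : {linear N -> N}) d phi i (iota_O 'X_i : {linear N -> N})).
move=> j u /=; rewrite iota_d_leibniz mderivX; congr (_ + _).
rewrite iota_OZ mnm1E [i == j]eq_sym; have [->|ji] := eqVneq j i; last by rewrite !scale0r.
have -> : (U_(i) - U_(i) = 0 :> 'X_{1..n})%MM by rewrite -{1}[U_(i)%MM]add0m addmK.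
by rewrite mpolyX0 -mpolyC1 iota_OC !scale1r.
Qed.

Lemma dual_op_Mn u m : Q (u *+ m) = Q u *+ m.
Proof. by rewrite -scaler_nat (linear_scale _ _ dual_op_linear) scaler_nat. Qed.

Lemma iter_dual_op_coordinate h i w :
  iter h.+1 Q (iota_O 'X_i w) = iota_O 'X_i (iter h.+1 Q w) + T i (iter h Q w) *+ h.+1.
Proof.
elim: h => [|h IH]; first by rewrite /= dual_op_coordinate mulr1n.
rewrite iterS IH linearD /= dual_op_coordinate -addrA; congr (_ + _).
rewrite dual_op_Mn -(bracket_dual_op i (iter h Q w)) -[Q (iter h Q w)]/(iter h.+1 Q w).
exact: esym (mulrS _ _).
Qed.

Lemma iter_dual_op_poly h q w : iter h Q (P_ q w) = P_ q (iter h Q w).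
Proof. by elim: h => //= h ->; rewrite dual_op_poly. Qed.
Lemma iter_dual_op_t h w : iter h Q (t w) = t (iter h Q w).
Proof. by elim: h => //= h ->; rewrite dual_op_t. Qed.

Variable lams : seq rat.
(** b(s + i), when [lams] lists the lambda_j. *)
Definition bshift i : {poly C} := linprod C [seq q + i%:R | q <- lams].
Definition bprod a k : {poly C} := \prod_(i <- iota a k) bshift i.

Lemma bshift_neq0 i : bshift i != 0. Proof. exact: monic_neq0 (linprod_monic _ _). Qed.
Lemma bprod_neq0 a k : bprod a k != 0.
Proof. by rewrite /bprod prodf_seq_neq0; apply/allP => i _; apply: bshift_neq0. Qed.

Lemma linprod_shift1 r : linprod C r \Po ('X + 1) = linprod C [seq q + 1 | q <- r].
Proof.
rewrite /linprod big_map rmorph_prod; apply: eq_bigr => q _ /=.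
by rewrite -[X in linfactor C q \Po X]/('X + 1%:P) -(rmorph1 (@ratr C)) linfactor_shift.
Qed.

Lemma bshift_shift i : bshift i \Po ('X + 1) = bshift i.+1.
Proof.
rewrite /bshift linprod_shift1 -map_comp; congr (linprod C _); apply: eq_map => q /=.
by rewrite -addrA -natr1.
Qed.
Lemma bprod_shift a k : bprod a k \Po ('X + 1) = bprod a.+1 k.
Proof.
rewrite /bprod rmorph_prod; elim: k a => [|k IH] a; first by rewrite !big_nil.
by rewrite /= !big_cons IH /= bshift_shift.
Qed.
Lemma bprodD a k k' : bprod a (k + k') = bprod a k * bprod (a + k) k'.
Proof. by rewrite /bprod iotaD big_cat. Qed.
Lemma bprod_iter a k h : iter h (fun p => p \Po ('X + 1)) (bprod a k) = bprod (a + h) k.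
Proof. by elim: h => [|h IH]; rewrite ?addn0 //= IH bprod_shift addnS. Qed.

Variable E : M -> Prop.
Hypothesis HQ : forall x, E x -> Q (e (dm_O f x)) = P_ (bshift 0) (e x).
Local Notation fpow k x := (iter k (dm_O f) x).

Lemma t_e_iter h x : iter h t (e x) = e (fpow h x).
Proof. by elim: h => //= h ->; rewrite iota_t_e. Qed.

Lemma dual_op_fpow j x : E x -> Q (e (fpow j.+1 x)) = P_ (bshift j) (e (fpow j x)).
Proof.
move=> Ex; elim: j => [|j IH]; first exact: HQ.
by rewrite iterS -iota_t_e dual_op_t IH t_poly bshift_shift iota_t_e.
Qed.

Lemma iter_dual_op_fpow h k x : E x -> iter h Q (e (fpow (h + k) x)) = P_ (bprod k h) (e (fpow k x)).
Proof.
move=> Ex; elim: h => [|h IH]; first by rewrite /bprod big_nil op_poly1.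
rewrite iterSr addSn dual_op_fpow // iter_dual_op_poly IH -op_polyM.
by rewrite -[h.+1]addn1 bprodD /bprod /= big_seq1 mulrC addnC.
Qed.

(** The D_X[s]-submodule generated by the e (f^k x), x in E. *)
Definition fgen k (w : N) := forall P : N -> Prop, subspace P ->
  (forall p u, P u -> P (iota_O p u)) -> (forall i u, P u -> P (iota_d f i u)) ->
  (forall u, P u -> P (s u)) -> (forall x, E x -> P (e (fpow k x))) -> P w.

(** The property that detects [fgen k]: on the generator e (f^k x), Q^h t^h is
    the polynomial b(s+k) ... b(s+k+h-1), and elsewhere in the module at most
    the first r factors are lost. *)
Definition dual_divisible k (w : N) := exists r, forall h, (r <= h)%N ->
  exists u, iter h Q (iter h t w) = P_ (bprod (k + r) (h - r)) u.

Lemma dual_divisible_le k w r r' h : (r <= r')%N -> (r' <= h)%N ->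
  (exists u, iter h Q (iter h t w) = P_ (bprod (k + r) (h - r)) u) ->
  exists u, iter h Q (iter h t w) = P_ (bprod (k + r') (h - r')) u.
Proof.
move=> rr' r'h [u ->]; exists (P_ (bprod (k + r) (r' - r)) u).
rewrite -op_polyM mulrC; congr (P_ _ _).
have -> : (k + r' = k + r + (r' - r))%N by rewrite -addnA subnKC.
by rewrite -bprodD; congr (bprod _ _); lia.
Qed.

Lemma iter_dual_op_linear h : linear (iter h Q).
Proof. by move=> c u v; elim: h => //= h ->; rewrite linearP. Qed.
Lemma iter_t_linear h : linear (iter h t).
Proof. by move=> c u v; elim: h => //= h ->; rewrite linearP. Qed.

Lemma dual_divisible_subspace k : subspace (dual_divisible k).
Proof.
split.
  exists 0%N => h _; exists 0.
  by rewrite linear0 -(scale0r (0 : N)) linear_scale ?linear_scale ?scale0r //; [apply: iter_dual_op_linear|apply: iter_t_linear].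
move=> c u v [r Hr] [r' Hr']; exists (maxn r r') => h; rewrite geq_max => /andP[rh r'h].
have mh : (maxn r r' <= h)%N by rewrite geq_max rh.
have [u1 E1] := dual_divisible_le (leq_maxl r r') mh (Hr h rh).
have [u2 E2] := dual_divisible_le (leq_maxr r r') mh (Hr' h r'h).
by exists (c *: u1 + u2); rewrite iter_t_linear iter_dual_op_linear E1 E2 linearP.
Qed.

Lemma iter_t_O h p w : iter h t (iota_O p w) = iota_O p (iter h t w).
Proof. by elim: h => //= h ->; rewrite iota_Ot. Qed.
Lemma iter_t_d h i w : iter h t (iota_d f i w) = iota_d f i (iter h t w).
Proof. by elim: h => //= h ->; rewrite iota_dt_comm. Qed.
Lemma iter_t_poly h q w :
  iter h t (P_ q w) = P_ (iter h (fun p => p \Po ('X + 1)) q) (iter h t w).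
Proof. by elim: h => //= h ->; rewrite t_poly. Qed.

(** Q^(h+1) x_i = x_i Q^(h+1) + (h+1) [Q, x_i] Q^h: the multiplication by a
    coordinate loses one power of Q, whence r + 1. *)
Lemma dual_divisible_X k i w : dual_divisible k w -> dual_divisible k (iota_O 'X_i w).
Proof.
move=> [r Hr]; exists r.+1 => -[//|h] rh; rewrite iter_t_O iter_dual_op_coordinate.
have [u1 E1] : exists u, iter h.+1 Q (iter h.+1 t w) = P_ (bprod (k + r.+1) (h.+1 - r.+1)) u.
  by apply: (dual_divisible_le (r := r)) => //; apply: Hr; apply: ltnW.
have [u2 E2] := Hr h rh.
exists (iota_O 'X_i u1 + T i (t u2) *+ h.+1); rewrite E1 iterS iter_dual_op_t E2 t_poly bracket_poly bprod_shift.
by rewrite subSS addnS linearD linearMn /= Os_poly.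
Qed.

Lemma subspace_poly (P : N -> Prop) q w : subspace P -> (forall u, P u -> P (s u)) ->
  P w -> P (P_ q w).
Proof.
move=> sP sS Pw; rewrite /op_poly; apply: subspace_sum => // i _; apply: subspaceZ => //.
by elim: {i}(i : nat) => //= i; apply: sS.
Qed.

Lemma coordinate_stable_O (P : N -> Prop) : subspace P -> (forall i u, P u -> P (iota_O 'X_i u)) ->
  forall p u, P u -> P (iota_O p u).
Proof.
move=> sP sX p; elim/mpolyind: p => [|c m p _ _ IH] u Pu.
  by rewrite -mpolyC0 iota_OC; apply: subspaceZ.
rewrite iota_OD iota_OZ; apply: subspaceD => //; last exact: IH.
apply: subspaceZ => //; rewrite mpolyXE_id.
elim/big_rec: _ u Pu => [|i q _ IHq] u Pu; first by rewrite -mpolyC1 iota_OC scale1r.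
rewrite iota_OM; have : P (iota_O q u) by apply: IHq.
elim: (m i) (iota_O q u) => [|k IHk] v Pv; first by rewrite expr0 -mpolyC1 iota_OC scale1r.
by rewrite exprS iota_OM; apply: sX; apply: IHk.
Qed.

Lemma iter_Q_d h i w : iter h Q (iota_d f i w) = iota_d f i (iter h Q w).
Proof. by elim: h => //= h ->; rewrite dual_op_d. Qed.

Lemma fgen_dual_divisible k w : fgen k w -> dual_divisible k w.
Proof.
apply; first exact: dual_divisible_subspace.
- by apply: coordinate_stable_O; [exact: dual_divisible_subspace|move=> i u; apply: dual_divisible_X].
- move=> i u [r Hr]; exists r => h /Hr[v Ev]; exists (iota_d f i v).
  by rewrite iter_t_d iter_Q_d Ev ds_poly.
- move=> u [r Hr]; exists r => h /Hr[v Ev].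
  rewrite -(op_polyX s) iter_t_poly iter_dual_op_poly Ev op_poly_commute.
  by eexists.
- move=> x Ex; exists 0%N => h _; exists (e (fpow k x)).
  by rewrite -t_e_iter -iterD t_e_iter iter_dual_op_fpow // addn0 subn0 t_e_iter.
Qed.

Lemma seq_upper_bound (r : seq rat) : exists b : nat, forall q, q \in r -> q < b%:R.
Proof.
elim: r => [|q r [b Hb]]; first by exists 0%N.
exists (maxn b (Num.bound `|q|)) => q'; rewrite inE => /predU1P[->|/Hb h].
  apply: lt_le_trans (_ : (Num.bound `|q|)%:R <= _); last by rewrite ler_nat leq_maxr.
  by have := archi_boundP (normr_ge0 q); apply: le_lt_trans (ler_norm q).
by apply: lt_le_trans h _; rewrite ler_nat leq_maxl.
Qed.

Definition bprod_roots a k := flatten [seq [seq q + i%:R | q <- lams] | i <- iota a k].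
Lemma bprod_linprod a k : bprod a k = linprod C (bprod_roots a k).
Proof.
rewrite /bprod /bprod_roots; elim: (iota a k) => [|i l IH]; first by rewrite big_nil /linprod big_nil.
by rewrite big_cons /= linprod_cat IH.
Qed.
Lemma bprod_rootsP a k q' : reflect (exists q i, [/\ q \in lams, (a <= i < a + k)%N & q' = q + i%:R]) (q' \in bprod_roots a k).
Proof.
apply: (iffP flatten_mapP) => [[i ik /mapP[q ql ->]]|[q [i [ql ik ->]]]].
  by exists q, i; split; rewrite // -mem_iota.
by exists i; rewrite ?mem_iota //; apply: map_f.
Qed.

(** The opposites of the roots of the first product are pushed to the right by
    h, beyond those of the second. *)
Lemma bprod_coprime k k' : exists h0, forall h, (h0 <= h)%N -> coprimep (bprod h k) (bprod 0 k').
Proof.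
have [b Hb] := seq_upper_bound [seq q' - q | q <- lams, q' <- lams].
exists (b + k')%N => h lth; rewrite !bprod_linprod; apply: linprod_coprime => x /bprod_rootsP[q [i [ql /andP[hi _] ->]]].
apply/negP => /bprod_rootsP[q' [j [ql' /andP[_ jk] E']]].
have := Hb (q' - q) (allpairs_f (fun q q' => q' - q) ql ql').
rewrite (_ : q' - q = i%:R - j%:R); last by lra.
rewrite ltrBlDr -natrD ltr_nat ltnNge => /negP; apply.
by apply: leq_trans hi; apply: leq_trans lth; rewrite leq_add2l ltnW.
Qed.

Lemma iter_shift_dvd h (p q : {poly C}) :
  iter h (fun p => p \Po ('X + 1)) p %| iter h (fun p => p \Po ('X + 1)) q -> p %| q.
Proof.
elim: h => //= h IH /(dvdp_comp_poly ('X - 1)); rewrite -!comp_polyA.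
rewrite (_ : ('X + 1) \Po ('X - 1) = 'X :> {poly C}); last first.
  by rewrite comp_polyD comp_polyX -polyC1 comp_polyC subrK.
by rewrite !comp_polyXr; apply: IH.
Qed.

(** By [fgen_dual_divisible], b(s+k+r) ... b(s+k+h-1) divides
    q(s+h) b(s) ... b(s+h-1).  The common factors cancel, and for large h the
    rest b(s+h) ... b(s+h+k-1) of the first product is prime to the rest
    b(s) ... b(s+k+r-1) of the second; so it divides q(s+h). *)
Lemma fgen_dvd k q x : E x -> x <> 0 -> fgen k (P_ q (e x)) -> bprod 0 k %| q.
Proof.
move=> Ex x0 /fgen_dual_divisible[r Hr]; have [h0 Hh0] := bprod_coprime k (k + r).
have [|u] := Hr (k + r + h0)%N; first by rewrite -addnA addnCA leq_addr.
rewrite iter_t_poly iter_dual_op_poly t_e_iter.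
have := iter_dual_op_fpow (k + r + h0)%N 0 Ex; rewrite addn0 => ->; rewrite -op_polyM.
move/(op_poly_dvd fK x0 (bprod_neq0 _ _)).
have -> : (k + r + h0 - r = h0 + k)%N by rewrite addnAC addnK addnC.
rewrite [bprod _ (h0 + k)]bprodD [bprod 0 (k + r + h0)]bprodD add0n.
rewrite [X in _ %| X]mulrA [X in X %| _]mulrC dvdp_mul2r ?bprod_neq0 //.
rewrite Gauss_dvdpl; last by apply: Hh0; rewrite leq_addl.
by have := bprod_iter 0 k (k + r + h0)%N; rewrite add0n => <-; apply: iter_shift_dvd.
Qed.

Lemma fgen_subspace k : subspace (fgen k).
Proof.
split; first by move=> P [P0 _].
move=> c u v Uu Uv P sP hO hd hs hE; case: (sP) => _; apply; [exact: Uu|exact: Uv].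
Qed.
Lemma fgen_O k p u : fgen k u -> fgen k (iota_O p u).
Proof. by move=> Uu P sP hO hd hs hE; apply: (hO); apply: Uu. Qed.
Lemma fgen_d k i u : fgen k u -> fgen k (iota_d f i u).
Proof. by move=> Uu P sP hO hd hs hE; apply: (hd); apply: Uu. Qed.
Lemma fgen_s k u : fgen k u -> fgen k (s u).
Proof. by move=> Uu P sP hO hd hs hE; apply: (hs); apply: Uu. Qed.
Lemma fgen_e k x : E x -> fgen k (e (fpow k x)).
Proof. by move=> Ex P sP hO hd hs hE; apply: hE. Qed.

Lemma fgen_t_ind k (P : N -> Prop) : subspace P -> (forall p u, P u -> P (iota_O p u)) ->
  (forall i u, P u -> P (iota_d f i u)) -> (forall u, P u -> P (s u)) ->
  (forall x, E x -> P (t (e (fpow k x)))) -> forall w, fgen k w -> P (t w).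
Proof.
move=> sP hO hd hs hE w Uw; apply: (Uw (fun w => P (t w))) => //.
- split; first by rewrite linear0; case: sP.
  by move=> c u v Pu Pv; rewrite linearP; case: sP => _; apply.
- by move=> p u; rewrite -iota_Ot; apply: hO.
- by move=> i u; rewrite -iota_dt_comm; apply: hd.
- by move=> u Pu; rewrite iota_ts; apply: (subspaceD sP) => //; apply: hs.
Qed.

Lemma t_fgen k w : fgen k w -> fgen k.+1 (t w).
Proof.
apply: fgen_t_ind; [exact: fgen_subspace|exact: fgen_O|exact: fgen_d|exact: fgen_s|].
by move=> x Ex; rewrite iota_t_e; apply: (@fgen_e k.+1).
Qed.
Lemma t_fgen0 w : fgen 0 w -> fgen 0 (t w).
Proof.
apply: fgen_t_ind; [exact: fgen_subspace|exact: fgen_O|exact: fgen_d|exact: fgen_s|].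
move=> x Ex; rewrite /= iota_t_e -[dm_O f x]/(dm_O f x) -iota_O_mono.
by apply: fgen_O; apply: (@fgen_e 0).
Qed.
Lemma iter_t_fgen h w : fgen 0 w -> fgen h (iter h t w).
Proof. by move=> Uw; elim: h => //= h; apply: t_fgen. Qed.
Hypothesis gen : forall P : M -> Prop, subspace P -> (forall p m, P m -> P (dm_O p m)) ->
  (forall i m, P m -> P (dm_d i m)) -> (forall m, P (dm_O f m) -> P m) ->
  (forall x, E x -> P x) -> forall m, P m.

Lemma dm_d_fpow i k (m : M) : dm_d i (fpow k.+1 m) = fpow k.+1 (dm_d i m) + dm_O f^`M(i) (fpow k m) *+ k.+1.
Proof.
elim: k => [|k IH]; first by rewrite /= dm_d_leibniz addrC mulr1n.
rewrite iterS dm_d_leibniz IH linearD /= addrCA linearMn /=; congr (_ + _).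
by rewrite (dm_O_comm f) -mulrS.
Qed.

(** M is generated by E over D_X[1/f]; a derivation applied to a fraction costs
    one more power of f. *)
Lemma fgen0_eventually (m : M) : exists k0, forall k, (k0 <= k)%N -> fgen 0 (e (fpow k m)).
Proof.
apply: (gen (P := fun m => exists k0, forall k, (k0 <= k)%N -> fgen 0 (e (fpow k m)))).
- split.
    exists 0%N => k _; rewrite (_ : fpow k 0 = 0 :> M) ?linear0; first by case: (fgen_subspace 0).
    by elim: k => //= k ->; rewrite linear0.
  move=> c u v [k1 H1] [k2 H2]; exists (maxn k1 k2) => k; rewrite geq_max => /andP[l1 l2].
  rewrite -!dm_O_exp linearP linearP /= !dm_O_exp.
  by case: (fgen_subspace 0) => _; apply; [apply: H1|apply: H2].
- move=> p {}m [k0 H]; exists k0 => k lek; rewrite -dm_O_exp dm_O_comm dm_O_exp -iota_O_mono.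
  by apply: fgen_O; apply: H.
- move=> i {}m [k0 H]; exists k0.+1 => -[//|k] lek.
  have -> : fpow k.+1 (dm_d i m) = dm_d i (fpow k.+1 m) - dm_O f^`M(i) (fpow k m) *+ k.+1.
    by rewrite dm_d_fpow addrK.
  have -> : e (dm_d i (fpow k.+1 m) - dm_O f^`M(i) (fpow k m) *+ k.+1) =
            iota_d f i (e (fpow k.+1 m)) + (-1) *: (s (iota_O f^`M(i) (e (fpow k m))) + k.+1%:R *: iota_O f^`M(i) (e (fpow k m))).
    rewrite (iota_d_e finvK) iterS fK !iota_O_mono linearB /= linearMn /= scaleN1r opprD scaler_nat.
    by rewrite [RHS]addrA addrK.
  have Uk : fgen 0 (iota_O f^`M(i) (e (fpow k m))) by apply: fgen_O; apply: H.
  have sU := fgen_subspace 0.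
  apply: (subspaceD sU); first by apply: fgen_d; apply: H; apply: leqW.
  by apply: (subspaceZ _ sU); apply: (subspaceD sU); [exact: fgen_s|exact: (subspaceZ _ sU)].
- by move=> {}m [k0 H]; exists k0.+1 => -[//|k] lek; rewrite iterSr; apply: H.
- by move=> x Ex; exists 0%N => k _; rewrite -dm_O_exp -iota_O_mono; apply: fgen_O; apply: (@fgen_e 0).
Qed.

Lemma fgen0_t_eventually w : exists K, forall k, (K <= k)%N -> fgen 0 (iter k t w).
Proof.
have [m_ [L ->]] := s_expansion finvK w.
elim: L => [|L [K IH]].
  exists 0%N => k _; rewrite big_ord0 -(scale0r (0 : N)) linear_scale; last exact: iter_t_linear.
  by rewrite scale0r; case: (fgen_subspace 0).
have [K' HK'] := fgen0_eventually (m_ L).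
exists (maxn K K') => k; rewrite geq_max => /andP[l1 l2].
rewrite big_ord_recr /= -[_ + _]scale1r linear_scale; last exact: iter_t_linear.
rewrite scale1r -[X in X + _]scale1r iter_t_linear scale1r.
apply: (subspaceD (fgen_subspace 0)); first exact: IH.
rewrite -(op_polyXn s) iter_t_poly t_e_iter; apply: (subspace_poly _ (fgen_subspace 0) (@fgen_s 0)).
exact: HK'.
Qed.

Variable V : rat -> N -> Prop.
Hypothesis hV : is_Vfiltration f V.

Lemma V_fin a : exists gs, forall u, V a u <-> gen_mod (@Dst_gen _ _ f M) gs u.
Proof. by case: hV => _ h _ _ _; apply: h. Qed.
Lemma V_subspace a : subspace (V a).
Proof.
have [gs H] := V_fin a; split; first by apply/H => P [P0 _].
by move=> c u v /H Pu /H Pv; apply/H => P sP sA sg; case: (sP) => _; apply; [apply: Pu|apply: Pv].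
Qed.
Lemma V_Dst a T0 u : Dst_gen f T0 -> V a u -> V a (T0 u).
Proof.
have [gs H] := V_fin a; move=> DT /H Pu; apply/H => P sP sA sg.
by apply: (sA) => //; apply: Pu.
Qed.
Lemma V_poly a q u : V a u -> V a (P_ q u).
Proof.
move=> Vu; apply: (subspace_poly _ (V_subspace a)) => // v.
by apply: V_Dst; constructor.
Qed.
Lemma V_le a b w : a <= b -> V b w -> V a w.
Proof. by case: hV => -[h _ _] _ _ _ _; apply: h. Qed.
Lemma V_dual_op a u : V a u -> V a (Q u).
Proof.
elim: d phi => [|d' IH] phi' Vu /=; first by apply: (subspaceZ _ (V_subspace a)).
apply: (subspace_sum _ (V_subspace a)).
by move=> i _; apply: V_Dst; [constructor|apply: IH].
Qed.

(** Some power t^K takes the finitely many generators of V^a0 to [fgen 0], and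
    V^(a0+j) = t^j V^a0 when a0 is large. *)
Lemma V_fgen : exists A : rat, forall k w, V (A + k%:R) w -> fgen k w.
Proof.
case: (hV) => _ _ [_ [a0 Ha0]] _ _; have [gs Hgs] := V_fin a0.
have [K HK] : exists K, forall g, g \in gs -> fgen 0 (iter K t g).
  have [K HK] : exists K, forall g, g \in gs -> forall k, (K <= k)%N -> fgen 0 (iter k t g).
    elim: gs {Hgs} => [|g gs [K IH]]; first by exists 0%N.
    have [K' HK'] := fgen0_t_eventually g; exists (maxn K K') => g'.
    rewrite inE => /predU1P[->|/IH H] k; rewrite geq_max => /andP[l1 l2]; first exact: HK'.
    exact: H.
  by exists K => g /HK; apply.
have V0 w : V a0 w -> fgen 0 (iter K t w).
  move/Hgs => Vw; apply: (Vw (fun w => fgen 0 (iter K t w))) => //.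
    split.
      rewrite -(scale0r (0 : N)) linear_scale; last exact: iter_t_linear.
      by rewrite scale0r; case: (fgen_subspace 0).
    by move=> c u v Uu Uv; rewrite iter_t_linear; case: (fgen_subspace 0) => _; apply.
  move=> _ u [p|i||] Uu.
  - by rewrite iter_t_O; apply: fgen_O.
  - by rewrite iter_t_d; apply: fgen_d.
  - rewrite -(op_polyX s) iter_t_poly; exact: (subspace_poly _ (fgen_subspace 0) (@fgen_s 0)).
  - by rewrite -iterSr iterS; apply: t_fgen0.
have Vj j w : V (a0 + j%:R) w -> exists2 w', V a0 w' & w = iter j t w'.
  elim: j w => [|j IH] w; first by rewrite addr0; exists w.
  rewrite -natr1 addrA => /Ha0[|w1 /IH[w2 V2 ->] ->]; first by rewrite lerDl.
  by exists w2.
exists (a0 + K%:R) => k w; rewrite -addrA -natrD addnC => /Vj[w' /V0 Uw' ->].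
by rewrite iterD; apply: iter_t_fgen.
Qed.

(** On V^(j/r) a power of s + j/r leads to V^((j+1)/r); the factors of all the
    jumps between J/r and J'/r are collected in [qs]. *)
Lemma V_jumps : exists2 r : nat, (0 < r)%N &
  (forall a w, V a w <-> V ((Num.ceil (r%:R * a))%:~R / r%:R) w) /\
  forall (J J' : int), exists qs,
    (forall q, q \in qs -> exists2 j : int, J <= j < J' & q = j%:~R / r%:R) /\
    forall w, V (J%:~R / r%:R) w -> V (J'%:~R / r%:R) (P_ (linprod C qs) w).
Proof.
case: (hV) => -[_ _ [r r0 Hr]] _ _ _ nil; exists r => //; split=> // J J'.
have rr : 0 < r%:R :> rat by rewrite ltr0n.
have step (j : int) : exists k, forall w, V (j%:~R / r%:R) w ->
    V ((j + 1)%:~R / r%:R) (P_ (linprod C (nseq k (j%:~R / r%:R))) w).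
  have [k Hk] := nil (j%:~R / r%:R); exists k => w /Hk[b ltb Vb].
  have -> : P_ (linprod C (nseq k (j%:~R / r%:R))) w = iter k (fun u => s u + ratr (j%:~R / r%:R) *: u) w.
    elim: (k) => [|k' IH]; first by rewrite /linprod big_nil op_poly1.
    rewrite iterS -IH /linprod big_cons op_polyM /linfactor op_polyD op_polyX op_polyC //.
  apply: V_le (proj1 (Hr _ _) Vb); rewrite ler_pM2r ?invr_gt0 // ler_int.
  by rewrite lezD1 ceil_gt_int -ltr_pdivrMl // mulrC.
have [leJ|ltJ] := leP J' J.
  exists [::]; split=> // w; rewrite /linprod big_nil op_poly1; apply: V_le.
  by rewrite ler_pM2r ?invr_gt0 // ler_int.
have [m ->] : exists m : nat, J' = J + m%:Z.
  by exists `|J' - J|%N; rewrite gez0_abs ?subr_ge0 ?ltW // [RHS]addrC subrK.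
elim: m {J' ltJ} => [|m [qs [Hqs HV]]].
  by exists [::]; split=> // w; rewrite /linprod big_nil op_poly1 addr0.
have [k Hk] := step (J + m%:Z).
exists (nseq k ((J + m%:Z)%:~R / r%:R) ++ qs); split.
  move=> q; rewrite mem_cat => /orP[/nseqP[-> _]|/Hqs[j hj ->]].
    by exists (J + m%:Z) => //; lia.
  by exists j => //; lia.
have -> : J + m.+1%:Z = J + m%:Z + 1 by lia.
by move=> w /HV /Hk; rewrite linprod_cat op_polyM.
Qed.

Variable alpha : rat.
Definition shift_count q : nat := if 1 <= Num.ceil (alpha - q) then `|Num.ceil (alpha - q)|%N else 0%N.
(** The opposites of the roots of p_{lambda,alpha}. *)
Definition p_roots : seq rat := flatten [seq [seq q + i%:R | i <- iota 0 (shift_count q)] | q <- lams].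

Lemma shift_countP q i : (i < shift_count q)%N = (q + i%:R < alpha).
Proof.
rewrite -ltrBrDl -[i%:R]/((i : int)%:~R) -ceil_gt_int /shift_count.
by move: (Num.ceil _) => c; case: ifP => h; apply/idP/idP; lia.
Qed.

Lemma mem_shifts (l : seq rat) (F : rat -> seq nat) (q : rat) :
  q \in flatten [seq [seq q0 + i%:R | i <- F q0] | q0 <- l] ->
  exists (q0 : rat) (i : nat), [/\ q0 \in l, i \in F q0 & q = q0 + i%:R].
Proof.
elim: l => //= q0 l IH; rewrite mem_cat => /orP[/mapP[i iF ->]|/IH[q1 [i [ql iF ->]]]].
  by exists q0, i; rewrite mem_head.
by exists q1, i; rewrite inE ql orbT.
Qed.

Lemma p_roots_lt q : q \in p_roots -> q < alpha.
Proof. by move=> /mem_shifts[q0 [i [_]]]; rewrite mem_iota /= add0n => h ->; rewrite -shift_countP. Qed.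

(** Each lambda_j has its shifts below alpha in [p_roots], and the others up to
    K in [ps]. *)
Lemma bprod_p_roots K : (forall q, q \in lams -> (shift_count q <= K)%N) ->
  exists2 ps, forall q, q \in ps -> alpha <= q & bprod 0 K = linprod C p_roots * linprod C ps.
Proof.
move=> HK; exists (flatten [seq [seq q + i%:R | i <- iota (shift_count q) (K - shift_count q)] | q <- lams]).
  move=> q /mem_shifts[q0 [i [_]]]; rewrite mem_iota => /andP[h _] ->.
  by rewrite leNgt -shift_countP -leqNgt.
rewrite /bprod /bshift /linprod /p_roots !big_flatten /= !big_map.
under eq_bigr do rewrite big_map.
rewrite exchange_big /= -big_split /= big_seq [RHS]big_seq; apply: eq_bigr => q ql.
rewrite !big_map -big_cat -iotaD ?add0n; congr (\prod_(i <- iota 0 _) _).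
by rewrite subnKC ?HK.
Qed.

(** Let q(s) e x be in V^alpha.  Factors s + c with c >= alpha lead from V^alpha
    to the V^(A+K) of [V_fgen], and [fgen_dvd] applies; these factors are prime
    to those of p, which must divide q.  Conversely, b(s) ... b(s+k-1) e x
    is in V^alpha for large k, and so is g(s) e x for a product g of factors
    s + c with c < alpha.  Write b(s) ... b(s+k-1) as p times a product of
    factors with c >= alpha: the latter is prime to g, and p is a combination of
    the two polynomials by Bezout. *)
Theorem V_generator_dvd x q : E x -> x <> 0 -> V alpha (P_ q (e x)) <-> linprod C p_roots %| q.
Proof.
move=> Ex x0; have [r r0 [Hr jumps]] := V_jumps.
have rr : 0 < r%:R :> rat by rewrite ltr0n.
have [Kq HKq] : exists K, forall q, q \in lams -> (shift_count q <= K)%N.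
  by exists (\max_(q <- lams) shift_count q) => q' ql; apply: leq_bigmax_seq.
split.
  move=> Vq; have [A HA] := V_fgen.
  have [g [Hg HVg]] := jumps (Num.ceil (r%:R * alpha)) (Num.ceil (r%:R * (A + Kq%:R))).
  have := HVg _ (proj1 (Hr _ _) Vq) => /(proj2 (Hr _ _)) /HA.
  rewrite -op_polyM => /(fgen_dvd Ex x0).
  have [ps _ ->] := bprod_p_roots HKq => /(dvdp_trans (dvdp_mulr _ (dvdpp _))).
  rewrite Gauss_dvdpr //; apply: linprod_coprime => c /p_roots_lt ca; apply/negP => /Hg[j /andP[h _] cj].
  move: ca; rewrite ltNge => /negP; apply; rewrite cj ler_pdivlMr // mulrC.
  by rewrite -ceil_le_int.
move=> /dvdpP[q' ->]; rewrite op_polyM; apply: V_poly.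
have [a Va] : exists a, V a (e x) by case: hV => -[_ h _] _ _ _ _; apply: h.
have VB k : V (a + k%:R) (P_ (bprod 0 k) (e x)).
  elim: k => [|k IH]; first by rewrite addr0 /bprod big_nil op_poly1.
  have : V (a + k%:R + 1) (t (P_ (bprod 0 k) (e x))) by case: (hV) => _ _ [h _] _ _; apply: h.
  rewrite -natr1 addrA => /V_dual_op; rewrite t_poly bprod_shift dual_op_poly iota_t_e HQ // -op_polyM.
  by rewrite /bprod /= big_cons mulrC.
have [k Hk] : exists2 k, (Kq <= k)%N & alpha <= a + k%:R.
  exists (maxn Kq (Num.bound `|alpha - a|)); first exact: leq_maxl.
  rewrite -lerBlDl; apply: le_trans (ler_norm _) _.
  by apply: le_trans (ltW (archi_boundP (normr_ge0 _))) _; rewrite ler_nat leq_maxr.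
move=> hk; have VBk := V_le hk (VB k).
have [g [Hg HVg]] := jumps (Num.ceil (r%:R * a)) (Num.ceil (r%:R * alpha)).
have Vg : V alpha (P_ (linprod C g) (e x)) by apply: (proj2 (Hr _ _)); apply: HVg; apply: (proj1 (Hr _ _)).
have [|ps Hps EB] := @bprod_p_roots k; first by move=> q0 /HKq h; apply: leq_trans h Hk.
have cop : coprimep (linprod C ps) (linprod C g).
  apply: linprod_coprime => c /Hps ca; apply/negP => /Hg[j /andP[_ h] cj].
  by move: ca; rewrite leNgt cj ltr_pdivrMr // mulrC -ceil_gt_int h.
have /Bezout_eq1_coprimepP[[u v] /= uv] := cop.
rewrite -[linprod C p_roots]mulr1 -uv mulrDr op_polyD; apply: subspaceD; first exact: V_subspace.
  by rewrite mulrCA op_polyM -EB; apply: V_poly.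
by rewrite mulrA op_polyM; apply: V_poly.
Qed.
End Core.

(** * Polynomials and their values *)

Lemma mpoly_ring_ind (R : comNzRingType) n (P : {mpoly R[n]} -> Prop) :
  (forall c, P c%:MP) -> (forall i, P 'X_i) -> (forall p q, P p -> P q -> P (p + q)) ->
  (forall p q, P p -> P q -> P (p * q)) -> forall p, P p.
Proof.
move=> hC hX hD hM; elim/mpolyind => [|c m p _ _ IH]; first by rewrite -mpolyC0.
apply: (hD) => //; rewrite -mul_mpolyC; apply: (hM) => //; rewrite mpolyXE_id.
apply: (big_ind P) => [|//|i _]; first by rewrite -mpolyC1.
by elim: (m i) => [|k IHk]; rewrite ?expr0 -?mpolyC1 // exprS; apply: hM.
Qed.

Section Zero.
Variables (C : numFieldType) (n : nat).

(** The restriction of a polynomial to the line through v parallel to the i-th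
    axis. *)
Definition line_restriction (v : 'I_n -> C) (i : 'I_n) : {mpoly C[n]} -> {poly C} :=
  mmap (@polyC C) (fun j => (v j)%:P + (j == i)%:R *: 'X).

Lemma line_restriction_deriv v i p : (line_restriction v i p)^`() = line_restriction v i p^`M(i).
Proof.
rewrite /line_restriction; elim/mpoly_ring_ind: p => [c|j|p q Hp Hq|p q Hp Hq].
- by rewrite mmapC derivC mderivC -mpolyC0 mmapC.
- rewrite mmapX mmap1U derivD derivC add0r derivZ derivX alg_polyC mderivX mnm1E.
  have [->|ji] := eqVneq j i; last by rewrite scale0r -mpolyC0 mmapC.
  by rewrite scale1r -{1}[U_(i)%MM]add0m addmK mpolyX0 -mpolyC1 mmapC.
- by rewrite rmorphD /= derivD Hp Hq mderivD rmorphD.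
- by rewrite rmorphM /= derivM Hp Hq mderivM rmorphD !rmorphM.
Qed.

Lemma line_restriction_eval v i p t :
  (line_restriction v i p).[t] = p.@[fun j => v j + (j == i)%:R * t].
Proof.
rewrite /line_restriction; elim/mpoly_ring_ind: p => [c|j|p q Hp Hq|p q Hp Hq].
- by rewrite mmapC hornerC mevalC.
- by rewrite mmapX mmap1U mevalXU !hornerE.
- by rewrite rmorphD /= hornerD mevalD Hp Hq.
- by rewrite rmorphM /= hornerM mevalM Hp Hq.
Qed.

Lemma poly_eval_eq0 (p : {poly C}) : (forall t, p.[t] = 0) -> p = 0.
Proof.
move=> H; apply/eqP; apply: contraT => p0.
have charC (m : nat) : (0 < m)%N -> m%:R != 0 :> C by rewrite pnatr_eq0 -lt0n.
have [j /(_ j (leqnn _))] := nat_roots_bounded charC p0.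
by rewrite H eqxx.
Qed.

(** Restricted to lines parallel to the axes, p has zero derivatives, so all the
    partial derivatives of p have zero values too; at the origin these are the
    coefficients of p, up to factorials. *)
Lemma mpoly_eval_eq0 (p : {mpoly C[n]}) : (forall v, p.@[v] = 0) -> p = 0.
Proof.
have deriv_zero i (q : {mpoly C[n]}) : (forall v, q.@[v] = 0) -> forall v, (q^`M(i)).@[v] = 0.
  move=> H v; have L0 : line_restriction v i q = 0 by apply: poly_eval_eq0 => t; rewrite line_restriction_eval.
  have := line_restriction_eval v i q^`M(i) 0; rewrite -line_restriction_deriv L0 deriv0 horner0 => ->.
  by apply: meval_eq => j; rewrite mulr0 addr0.
have derivm_zero m (q : {mpoly C[n]}) : (forall v, q.@[v] = 0) -> forall v, (q^`M[m]).@[v] = 0.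
  move=> H; rewrite mderivm_foldr; elim: (flatten _) => //= i s IH.
  exact: deriv_zero.
move=> H; apply/mpolyP => m; rewrite mcoeff0.
have := derivm_zero m p H (fun=> 0).
have ev0 (q : {mpoly C[n]}) : q.@[fun=> 0] = q@_0.
  elim/mpoly_ring_ind: q => [c|j|q1 q2 H1 H2|q1 q2 H1 H2].
  - by rewrite mevalC mcoeffC eqxx mulr1.
  - by rewrite mevalXU mcoeffX mnm1_eq0.
  - by rewrite mevalD mcoeffD H1 H2.
  - by rewrite mevalM H1 H2 rmorphM.
rewrite ev0 mcoeff_mderivm addm0 => /eqP; rewrite mulrn_eq0 => /orP[|/eqP //].
rewrite -leqn0 leqNgt prodn_gt0 // => i.
by rewrite ffact_gt0.
Qed.

Lemma mpoly_eval_neq0 (p : {mpoly C[n]}) : p != 0 -> exists v, p.@[v] != 0.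
Proof.
move=> p0; apply: contrapT => H; move/eqP: p0; apply; apply: mpoly_eval_eq0 => v.
by apply/eqP/negP => /negP h; apply: H; exists v.
Qed.
End Zero.

(** * The group action on functions and on equivariant modules *)

Section Group.
Variables (C : numClosedFieldType) (N n : nat) (G : 'M[C]_N -> Prop) (rho : 'M[C]_N -> 'M[C]_n).
Hypotheses (hG : linear_algebraic_group G) (hrho : linear_action G rho).

Lemma group_unit g : G g -> g \in unitmx.
Proof. by case: hG => -[I HI] _ _ _ /HI[]. Qed.
Lemma group_1 : G 1%:M. Proof. by case: hG. Qed.
Lemma group_mul g h : G g -> G h -> G (g *m h). Proof. by case: hG => _ _ H _; apply: H. Qed.
Lemma group_inv g : G g -> G (invmx g). Proof. by case: hG => _ _ _; apply. Qed.

Lemma mx_col_ext (A B : 'M[C]_n) : (forall v : 'cV[C]_n, A *m v = B *m v) -> A = B.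
Proof.
move=> H; apply/matrixP => i j; have := H (delta_mx j 0); rewrite -!colE.
by move/matrixP/(_ i 0); rewrite !mxE.
Qed.

Lemma rho_1 : rho 1%:M = 1%:M.
Proof. by apply: mx_col_ext => v; case: hrho => _ -> _ _; rewrite mul1mx. Qed.
Lemma rho_mul g h : G g -> G h -> rho (g *m h) = rho g *m rho h.
Proof. by move=> Gg Gh; apply: mx_col_ext => v; case: hrho => _ _ -> // _; rewrite mulmxA. Qed.
Lemma rho_invl g : G g -> rho (invmx g) *m rho g = 1%:M.
Proof. by move=> Gg; rewrite -rho_mul ?mulVmx ?rho_1 ?group_unit //; apply: group_inv. Qed.

Local Notation actf g := (act_fun rho g).
Lemma act_fun_is_additive g : additive (actf g).
Proof. by move=> p q; rewrite /act_fun rmorphB. Qed.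
HB.instance Definition _ g := GRing.isAdditive.Build {mpoly C[n]} {mpoly C[n]} (actf g) (act_fun_is_additive g).
Lemma act_fun_is_multiplicative g : multiplicative (actf g).
Proof. by split=> [p q|]; rewrite /act_fun ?rmorphM ?rmorph1. Qed.
HB.instance Definition _ g := GRing.isMultiplicative.Build {mpoly C[n]} {mpoly C[n]} (actf g) (act_fun_is_multiplicative g).
Lemma act_funZ g c p : actf g (c *: p) = c *: actf g p.
Proof. by rewrite /act_fun comp_mpolyZ. Qed.
Lemma act_fun_eval g h (v : 'cV[C]_n) :
  (actf g h).@[fun i => v i 0] = h.@[fun i => (rho (invmx g) *m v) i 0].
Proof.
rewrite /act_fun comp_mpoly_meval; apply: meval_eq => i.
rewrite tnth_mktuple raddf_sum mxE; apply: eq_bigr => j _ /=.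
by rewrite mevalZ mevalXU.
Qed.
Lemma eval_ext (p q : {mpoly C[n]}) :
  (forall v : 'cV[C]_n, p.@[fun i => v i 0] = q.@[fun i => v i 0]) -> p = q.
Proof.
move=> H; apply/eqP; rewrite -subr_eq0; apply/eqP; apply: mpoly_eval_eq0 => v.
have E r : r.@[v] = r.@[fun i => (\col_i v i) i 0] by apply: meval_eq => i; rewrite mxE.
by rewrite mevalB !E H subrr.
Qed.
Lemma act_funK g p : G g -> actf (invmx g) (actf g p) = p.
Proof.
move=> Gg; apply: eval_ext => v; rewrite !act_fun_eval invmxK; apply: meval_eq => i.
by rewrite mulmxA rho_invl // mul1mx.
Qed.
Lemma act_fun_neq0 g p : G g -> p != 0 -> actf g p != 0.
Proof. by move=> Gg; apply: contraNneq => p0; rewrite -(act_funK p Gg) p0 rmorph0. Qed.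
Lemma act_fun_const g p : (actf g p)@_0 = p@_0.
Proof.
elim/mpoly_ring_ind: p => [c|i|p q Hp Hq|p q Hp Hq].
- by rewrite /act_fun comp_mpolyC.
- rewrite /act_fun comp_mpolyXU -tnth_nth tnth_mktuple raddf_sum big1 => [|j _] /=.
    by rewrite mcoeffX mnm1_eq0.
  by rewrite mcoeffZ mcoeffX mnm1_eq0 mulr0.
- by rewrite rmorphD !mcoeffD Hp Hq.
- by rewrite rmorphM !rmorphM /= Hp Hq.
Qed.

Variables (sigma : 'M[C]_N -> C) (f : {mpoly C[n]}).
Hypotheses (hsigma : alg_character G sigma) (hf0 : f != 0) (hf : semi_invariant G rho sigma f).

Lemma sigma_neq0 g : G g -> sigma g != 0. Proof. by case: hsigma => _ h _; apply: h. Qed.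
Lemma sigma_mul g h : G g -> G h -> sigma (g *m h) = sigma g * sigma h.
Proof. by case: hsigma => _ _; apply. Qed.
Lemma sigma_1 : sigma 1%:M = 1.
Proof.
have := sigma_mul group_1 group_1; rewrite mul1mx => h.
by apply: (mulfI (sigma_neq0 group_1)); rewrite mulr1.
Qed.
Lemma sigma_inv g : G g -> sigma (invmx g) = (sigma g)^-1.
Proof.
move=> Gg; apply: (mulfI (sigma_neq0 Gg)); rewrite mulfV ?sigma_neq0 //.
by rewrite -sigma_mul ?mulmxV ?sigma_1 ?group_unit //; apply: group_inv.
Qed.
Lemma act_fun_f g : G g -> actf g f = sigma g *: f.
Proof.
move=> Gg; apply: eval_ext => v; rewrite act_fun_eval mevalZ hf; last exact: group_inv.
by rewrite sigma_inv // invrK.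
Qed.
Lemma act_fun_fX g k : G g -> actf g (f ^+ k) = sigma g ^+ k *: f ^+ k.
Proof. by move=> Gg; rewrite rmorphXn /= act_fun_f // exprZn. Qed.

Section Equivariant.
Variables (S : dmodule C n) (tauS : 'M[C]_N -> S -> S).
Hypothesis heq : equivariant G rho tauS.

Lemma tau_linear g : G g -> linear (tauS g).
Proof. by case: heq => -[h _ _ _] _ _ _ Gg c u v; apply: h. Qed.
Lemma tau_1 m : tauS 1%:M m = m. Proof. by case: heq => -[]. Qed.
Lemma tau_mul g h m : G g -> G h -> tauS (g *m h) m = tauS g (tauS h m).
Proof. by case: heq => -[_ _ H _] _ _ _ Gg Gh; apply: H. Qed.
Lemma tau_O g p m : G g -> tauS g (dm_O p m) = dm_O (actf g p) (tauS g m).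
Proof. by case: heq => _ H _ _ Gg; apply: H. Qed.
Lemma tau_d g j m : G g -> tauS g (dm_d j m) = \sum_i rho g i j *: dm_d i (tauS g m).
Proof. by case: heq => _ _ H _ Gg; apply: H. Qed.
Definition dmod_stable (P : S -> Prop) :=
  [/\ subspace P, forall p m, P m -> P (dm_O p m) & forall i m, P m -> P (dm_d i m)].

Lemma dmod_stable_tau g P : G g -> dmod_stable P -> dmod_stable (fun m => P (tauS g m)).
Proof.
move=> Gg [sP hO hd]; have lg := tau_linear Gg; split.
- split; first by rewrite -(scale0r (0 : S)) linear_scale // scale0r; case: sP.
  by move=> c u v Pu Pv; rewrite lg; case: sP => _; apply.
- by move=> p m Pm; rewrite tau_O //; apply: hO.
- move=> j m Pm; rewrite tau_d //; apply: subspace_sum => // i _.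
  by apply: subspaceZ => //; apply: hd.
Qed.

(** h (h^k)' is a multiple of h^k; so h^(k+1) kills d_i m when h^k kills m. *)
Lemma torsion_power_dmod_stable (h : {mpoly C[n]}) :
  dmod_stable (fun m => exists k, dm_O (h ^+ k) m = 0).
Proof.
split.
- split; first by exists 0%N; rewrite linear0.
  move=> c u v [k Hk] [k' Hk']; exists (k + k')%N.
  rewrite exprD linearP /= !dm_O_mul Hk' linear0 addr0 dm_O_comm Hk linear0 scaler0 //.
- by move=> p m [k Hk]; exists k; rewrite dm_O_comm Hk linear0.
- move=> i m [k Hk]; exists k.+1.
  have := dm_d_leibniz i (h ^+ k) m; rewrite Hk linear0 => /esym/eqP.
  rewrite addrC addr_eq0 => /eqP E.
  rewrite exprS dm_O_mul E linearN /= -dm_O_mul.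
  have [q ->] : exists q, h * (h ^+ k)^`M(i) = q * h ^+ k.
    elim: (k) => [|k' [q Hq]]; first by exists 0; rewrite expr0 -mpolyC1 mderivC mul0r mulr0.
    by exists (q + h^`M(i)); rewrite exprS mderivM mulrDr Hq; ring.
  by rewrite dm_O_mul Hk linear0 oppr0.
Qed.
End Equivariant.
End Group.

(** * Tensor representations *)

Section RegularFunctions.
Variables (C : fieldType) (N : nat) (G : 'M[C]_N -> Prop).
Hypothesis unitG : forall g, G g -> g \in unitmx.

Definition generic_det : {mpoly C[N * N]} := \det (\matrix_(i < N, j < N) 'X_(mxvec_index i j)).
Lemma generic_det_eval g : generic_det.@[entries g] = \det g.
Proof.
rewrite /generic_det -det_map_mx; congr (\det _); apply/matrixP => i j.
by rewrite !mxE /= mevalXU /entries mxvecE.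
Qed.

Lemma regular_const c : regular_on G (fun=> c).
Proof. by exists (c%:MP, 0%N) => g _; rewrite /rf_eval mevalC expr0 divr1. Qed.
Lemma regular_add a b : regular_on G a -> regular_on G b -> regular_on G (fun g => a g + b g).
Proof.
move=> [[p i] Hp] [[q j] Hq]; exists (p * generic_det ^+ j + q * generic_det ^+ i, (i + j)%N) => g Gg.
rewrite Hp // Hq // /rf_eval /= mevalD !mevalM !rmorphXn /= generic_det_eval exprD.
have d0 : \det g != 0 by rewrite -unitfE -unitmxE unitG.
by field; rewrite !expf_neq0.
Qed.
Lemma regular_mul a b : regular_on G a -> regular_on G b -> regular_on G (fun g => a g * b g).
Proof.
move=> [[p i] Hp] [[q j] Hq]; exists (p * q, (i + j)%N) => g Gg.
rewrite Hp // Hq // /rf_eval /= mevalM exprD.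
have d0 : \det g != 0 by rewrite -unitfE -unitmxE unitG.
by field; rewrite !expf_neq0.
Qed.
Lemma regular_sum (I : Type) (r : seq I) (F : I -> 'M[C]_N -> C) :
  (forall i, regular_on G (F i)) -> regular_on G (fun g => \sum_(i <- r) F i g).
Proof.
move=> H; elim: r => [|i r IH].
  by have [a Ha] := regular_const 0; exists a => g Gg; rewrite big_nil -Ha.
by have [a Ha] := regular_add (H i) IH; exists a => g Gg; rewrite big_cons -Ha.
Qed.
Lemma regular_entry n (rho : 'M[C]_N -> 'M[C]_n) i j : linear_action G rho ->
  regular_on G (fun g => rho g i j).
Proof.
case=> _ _ _ /(_ (delta_mx j 0))[k [a [v Hv]]].
have [b Hb] : regular_on G (fun g => \sum_(k' < k) rf_eval (a k') g * v k' i 0).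
  apply: regular_sum => k'; apply: regular_mul; last exact: regular_const.
  by exists (a k').
exists b => g Gg; rewrite -Hb //; have /colP/(_ i) := Hv g Gg.
by rewrite -colE mxE summxE => ->; apply: eq_bigr => k' _; rewrite mxE.
Qed.
End RegularFunctions.

Section Tensors.
Variables (C : fieldType) (n : nat).
Implicit Types (A B : 'M[C]_n) (phi : seq 'I_n -> C).

Fixpoint tensor_power A phi (s : seq 'I_n) : C :=
  if s is i :: s' then \sum_j A i j * tensor_power A (fun r => phi (j :: r)) s' else phi [::].

Lemma eq_tensor_power A phi psi s : (forall r, size r = size s -> phi r = psi r) ->
  tensor_power A phi s = tensor_power A psi s.
Proof.
elim: s phi psi => [|i s IH] phi psi H /=; first exact: H.
by apply: eq_bigr => j _; congr (_ * _); apply: IH => r hr; apply: H; rewrite /= hr.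
Qed.
Lemma tensor_power_sum A (I : Type) (r : seq I) (c : I -> C) (F : I -> seq 'I_n -> C) s :
  tensor_power A (fun w => \sum_(i <- r) c i * F i w) s = \sum_(i <- r) c i * tensor_power A (F i) s.
Proof.
elim: s F => [|i s IH] F //=.
under eq_bigr do rewrite IH mulr_sumr.
rewrite exchange_big; apply: eq_bigr => k _; rewrite mulr_sumr; apply: eq_bigr => j _.
by rewrite mulrCA.
Qed.
Lemma tensor_power_linear A phi psi c s :
  tensor_power A (fun r => c * phi r + psi r) s = c * tensor_power A phi s + tensor_power A psi s.
Proof.
elim: s phi psi => [|i s IH] phi psi //=.
rewrite mulr_sumr -big_split; apply: eq_bigr => j _.
by rewrite IH mulrDr mulrCA.
Qed.
Lemma tensor_power_mul A B phi s : tensor_power (A *m B) phi s = tensor_power A (tensor_power B phi) s.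
Proof.
elim: s phi => [|i s IH] phi //=.
under [RHS]eq_bigr do rewrite tensor_power_sum mulr_sumr.
rewrite exchange_big; apply: eq_bigr => k _.
rewrite IH mxE mulr_suml; apply: eq_bigr => j _.
by rewrite -mulrA.
Qed.
Lemma tensor_power_1 phi s : tensor_power 1%:M phi s = phi s.
Proof.
elim: s phi => [|i s IH] phi //=.
rewrite (bigD1 i) //= big1 => [|j ji]; rewrite mxE ?eqxx ?mul1r ?addr0 ?IH //.
by rewrite eq_sym (negbTE ji) mul0r.
Qed.

Section Action.
Variables (W : lmodType C) (D : 'I_n -> {linear W -> W}).
Lemma tensor_op_tensor_sum (I : Type) (r : seq I) (c : I -> C) (F : I -> seq 'I_n -> C) d w :
  tensor_op (fun i => D i) d (fun s => \sum_(i <- r) c i * F i s) w =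
  \sum_(i <- r) c i *: tensor_op (fun i => D i) d (F i) w.
Proof.
elim: d F => [|d IH] F /=.
  by rewrite scaler_suml; apply: eq_bigr => i _; rewrite scalerA.
under eq_bigr do rewrite IH linear_sum.
rewrite exchange_big; apply: eq_bigr => k _; rewrite scaler_sumr.
by apply: eq_bigr => j _; rewrite linearZ.
Qed.

Lemma tensor_op_equivariant A (T : W -> W) d phi w : linear T ->
  (forall j u, T (D j u) = \sum_i A i j *: D i (T u)) ->
  T (tensor_op (fun i => D i) d phi w) = tensor_op (fun i => D i) d (tensor_power A phi) (T w).
Proof.
move=> lT TD; pose T' : {linear W -> W} := HB.pack T (GRing.isLinear.Build _ _ _ _ T lT).
elim: d phi => [|d IH] phi /=; first by rewrite linear_scale.
rewrite -[LHS]/(T' _) linear_sum /=.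
under eq_bigr do rewrite TD IH.
rewrite exchange_big; apply: eq_bigr => i _; rewrite tensor_op_tensor_sum linear_sum.
by apply: eq_bigr => j _; rewrite linearZ.
Qed.

Lemma tensor_op_tensor_linear c phi psi d w :
  tensor_op (fun i => D i) d (fun s => c * phi s + psi s) w =
  c *: tensor_op (fun i => D i) d phi w + tensor_op (fun i => D i) d psi w.
Proof.
elim: d phi psi => [|d IH] phi psi /=; first by rewrite scalerDl scalerA.
rewrite scaler_sumr -big_split; apply: eq_bigr => i _ /=.
by rewrite IH linearP.
Qed.

Lemma tensor_op_tensor_scale c phi d w :
  tensor_op (fun i => D i) d (fun s => c * phi s) w = c *: tensor_op (fun i => D i) d phi w.
Proof.
elim: d phi => [|d IH] phi /=; first by rewrite scalerA.
by rewrite scaler_sumr; apply: eq_bigr => i _; rewrite IH linearZ.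
Qed.

Lemma tensor_op_0 d w : tensor_op (fun i => D i) d (fun=> 0) w = 0.
Proof. by elim: d => [|d IH] /=; rewrite ?scale0r // big1 // => i _; rewrite IH linear0. Qed.

Lemma tensor_op_delta d (s0 : seq 'I_n) w : size s0 = d ->
  tensor_op (fun i => D i) d (fun s => (s == s0)%:R) w = foldr (fun i => D i) w s0.
Proof.
elim: s0 d => [|i s0 IH] [|d] //= => [_|[hs]]; first by rewrite scale1r.
rewrite (bigD1 i) //= big1 ?addr0 => [|j ji].
  by congr (D i _); rewrite -(IH d hs); apply: eq_tensor_op => s _; rewrite eqseq_cons eqxx.
rewrite (@eq_tensor_op C W n (fun i => D i) d _ (fun=> 0)) ?tensor_op_0 ?linear0 // => s _.
by rewrite eqseq_cons (negbTE ji).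
Qed.
End Action.
End Tensors.

(** * The structure of M *)

Section Main.
Variables (C : numClosedFieldType) (N n l : nat).
Variables (G : 'M[C]_N -> Prop) (rho : 'M[C]_N -> 'M[C]_n).
Hypotheses (hG : linear_algebraic_group G) (hrho : linear_action G rho).
Variables (sigma : 'M[C]_N -> C) (f : {mpoly C[n]}).
Hypotheses (hsigma : alg_character G sigma) (hf0 : f != 0) (hf : semi_invariant G rho sigma f).
Variables (S : dmodule C n) (tauS : 'M[C]_N -> S -> S).
Hypotheses (hS : simple_equivariant G rho tauS) (hSsupp : full_support S).
Variables (M : dmodule C n) (tau : 'M[C]_N -> M -> M) (loc : S -> M).
Hypotheses (hloc : is_localization f loc) (hM : equivariant G rho tau).
Hypothesis (hlocG : forall g m, G g -> loc (tauS g m) = tau g (loc m)).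
Variable tauL : 'M[C]_N -> 'cV[C]_l -> 'cV[C]_l.
Hypotheses (hLrat : rational_rep tauL G) (hLirr : irreducible tauL G (@whole _ _)).
Hypothesis (hMirr : irreducible tau G (isotypic tau G tauL (@whole _ M))).

Local Notation actf g := (act_fun rho g).
Local Notation E := (isotypic tau G tauL (@whole _ M)).

Lemma S_equivariant : equivariant G rho tauS. Proof. by case: hS. Qed.

Lemma loc_linear : linear loc.
Proof. by case: hloc => -[hA hO _] _ _ _ c u v; rewrite hA -dm_O_scal hO dm_O_scal. Qed.
Lemma loc_O p m : loc (dm_O p m) = dm_O p (loc m).
Proof. by case: hloc => -[_ h _] _ _ _; apply: h. Qed.
Lemma loc_d i m : loc (dm_d i m) = dm_d i (loc m).
Proof. by case: hloc => -[_ _ h] _ _ _; apply: h. Qed.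
Lemma loc_surj u : exists k m, dm_O (f ^+ k) u = loc m.
Proof. by case: hloc => _ _ h _; apply: h. Qed.
Lemma loc_0 : loc 0 = 0.
Proof. by rewrite -(scale0r (0 : S)) (linear_scale _ _ loc_linear) scale0r. Qed.
Lemma f_bij : bijective (dm_O f : M -> M). Proof. by case: hloc. Qed.
Lemma fX_eq0 k (m : M) : dm_O (f ^+ k) m = 0 -> m = 0.
Proof.
case: f_bij => finv fK _; rewrite dm_O_exp; elim: k => //= k IH h.
by apply: IH; apply: (can_inj fK); rewrite h linear0.
Qed.

Lemma simple_dichotomy (P : S -> Prop) : dmod_stable P -> (forall g m, G g -> P m -> P (tauS g m)) ->
  (forall m, P m -> m = 0) \/ (forall m, P m).
Proof.
by move=> [sP hO hd] hg; case: hS => _ _; apply.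
Qed.

(** The torsion elements form an equivariant submodule; suppose that it is all
    of S.  The translates of an element m0 span a finite-dimensional space,
    killed by a single polynomial H, and they generate S over D_X; so every
    element of S is killed by a power of H.  At a point where H does not vanish,
    this contradicts the full support of S. *)
Lemma S_torsion_free h (m : S) : h != 0 -> dm_O h m = 0 -> m = 0.
Proof.
move=> h0 hm; have heq := S_equivariant.
have [|||all] := @simple_dichotomy (fun m => exists2 h, h != 0 & dm_O h m = 0).
- split.
  + split; first by exists 1; rewrite ?oner_eq0 // linear0.
    move=> c u v [h1 h10 H1] [h2 h20 H2]; exists (h1 * h2); first by rewrite mulf_neq0.
    by rewrite linearP /= !dm_O_mul H2 linear0 addr0 dm_O_comm H1 linear0 scaler0.
  + by move=> p u [h1 h10 H1]; exists h1 => //; rewrite dm_O_comm H1 linear0.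
  + move=> i u [h1 h10 H1]; exists (h1 * h1); first by rewrite mulf_neq0.
    have E0 : dm_O (h1 * h1)^`M(i) u = 0.
      by rewrite mderivM dm_O_addl [h1 * _]mulrC !dm_O_mul H1 linear0 addr0.
    by have := dm_d_leibniz i (h1 * h1) u; rewrite E0 dm_O_mul H1 !linear0 add0r => <-.
- move=> g u Gg [h1 h10 H1]; exists (actf g h1); first exact: (act_fun_neq0 hG hrho).
  rewrite -(tau_O heq) // H1 -(scale0r (0 : S)) linear_scale ?scale0r //.
  exact: (tau_linear heq).
- by apply; exists h.
case: (hS) => _ [m0 m00] _; exfalso.
have [k [a [v Hv]]] : exists k (a : 'I_k -> regfun C N) (v : 'I_k -> S), orbit_expansion tauS G m0 a v.
  by case: heq => -[_ _ _ ex] _ _ _; apply: ex.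
have /choice[hh Hh] : forall i, exists h, h != 0 /\ dm_O h (v i) = 0.
  by move=> i; have [h1 h10 H1] := all (v i); exists h1.
pose H := \prod_i hh i.
have H0 : H != 0 by apply/prodf_neq0 => i _; case: (Hh i).
have Hv0 i : dm_O H (v i) = 0.
  by rewrite /H (bigD1 i) //= mulrC dm_O_mul; case: (Hh i) => _ ->; rewrite linear0.
pose W m := forall P : S -> Prop, dmod_stable P -> (forall g, G g -> P (tauS g m0)) -> P m.
have WP : dmod_stable W.
  split; first split.
  - by move=> P [[P0 _] _ _].
  - move=> c u u' Wu Wu' P dP hP; have [[_ sP] _ _] := dP.
    by apply: sP; [apply: Wu|apply: Wu'].
  - by move=> p u Wu P dP hP; have [_ hO _] := dP; apply: hO; apply: Wu.
  - by move=> i u Wu P dP hP; have [_ _ hd] := dP; apply: hd; apply: Wu.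
have [|W0|Wall] := simple_dichotomy WP.
- move=> g u Gg Wu P dP hP; apply: (Wu (fun m => P (tauS g m))) => [|g' Gg']; first exact: (dmod_stable_tau heq Gg dP).
  by rewrite -(tau_mul heq) //; apply: hP; apply: (group_mul hG).
- apply: m00; apply: W0 => P dP hP; rewrite -(tau_1 heq m0); apply: hP; exact: (group_1 hG).
have [x Hx] := mpoly_eval_neq0 H0; have [m1 Hm1] := hSsupp x.
have HY g : G g -> exists k, dm_O (H ^+ k) (tauS g m0) = 0.
  move=> Gg; exists 1%N; rewrite expr1 Hv // linear_sum big1 // => i _.
  by rewrite linearZ /= Hv0 scaler0.
have [k1 Hk1] := Wall m1 _ (torsion_power_dmod_stable S H) HY.
by case: (Hm1 (H ^+ k1) _ Hk1); rewrite rmorphXn expf_neq0.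
Qed.

Lemma torsion_free h (m : M) : h != 0 -> dm_O h m = 0 -> m = 0.
Proof.
move=> h0 hm; have [k [s Es]] := loc_surj m.
apply: (@fX_eq0 k); rewrite Es; have ls : loc (dm_O h s) = 0 by rewrite loc_O -Es dm_O_comm hm linear0.
have [k1 Hk1] : exists k, dm_O (f ^+ k) (dm_O h s) = 0 by case: hloc => _ _ _; apply.
have s0 : s = 0.
  by apply: (@S_torsion_free (f ^+ k1 * h)); rewrite ?dm_O_mul // mulf_neq0 // expf_neq0.
by rewrite s0 loc_0.
Qed.

Lemma isotypic_subspace : subspace E. Proof. by case: hMirr => -[]. Qed.
Lemma isotypic_tau g x : G g -> E x -> E (tau g x). Proof. by case: hMirr => -[_ h] _ _; apply: h. Qed.
Lemma isotypic_nonzero : exists2 x, E x & x <> 0. Proof. by case: hMirr. Qed.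

(** M = D_X[1/f] E: the elements of S whose image lies in D_X[1/f] E form an
    equivariant submodule, which is not zero since a power of f takes a nonzero
    vector of E into the image of S. *)
Lemma isotypic_generates (P : M -> Prop) : subspace P -> (forall p m, P m -> P (dm_O p m)) ->
  (forall i m, P m -> P (dm_d i m)) -> (forall m, P (dm_O f m) -> P m) ->
  (forall x, E x -> P x) -> forall m, P m.
Proof.
move=> sP hO hd hf' hE.
pose W m := forall P : M -> Prop, dmod_stable P -> (forall m, P (dm_O f m) -> P m) ->
  (forall x, E x -> P x) -> P m.
suff all m : W m by move=> m; apply: (all m P).
have WfX k u : W (dm_O (f ^+ k) u) -> W u.
  move=> Wu P' dP' hP' hE'; have := Wu P' dP' hP' hE'; rewrite dm_O_exp.
  by elim: k {Wu} => //= k IH /hP'.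
have WP : dmod_stable (fun s => W (loc s)).
  split; first split.
  - by move=> P' [[P0 _] _ _] _ _; rewrite loc_0.
  - move=> c u u' Wu Wu' P' dP hP hE'; rewrite loc_linear; have [[_ sP'] _ _] := dP.
    by apply: sP'; [apply: Wu|apply: Wu'].
  - by move=> p u Wu P' dP hP hE'; rewrite loc_O; have [_ hO' _] := dP; apply: hO'; apply: Wu.
  - by move=> i u Wu P' dP hP hE'; rewrite loc_d; have [_ _ hd'] := dP; apply: hd'; apply: Wu.
have [|W0|Wall] := simple_dichotomy WP.
- move=> g u Gg Wu P' dP hP hE'; rewrite hlocG //.
  apply: (Wu (fun m => P' (tau g m))); first exact: (dmod_stable_tau hM Gg dP); last by move=> x Ex; apply: hE'; apply: isotypic_tau.
  move=> v; rewrite (tau_O hM) // (act_fun_f hG hsigma hf) // dm_OZ => h.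
  apply: hP; rewrite -[dm_O f _]scale1r -(mulVf (sigma_neq0 hsigma Gg)) -scalerA.
  by case: dP => sP' _ _; apply: subspaceZ.
- exfalso; have [x Ex x0] := isotypic_nonzero; have [k [s Es]] := loc_surj x.
  apply: x0; apply: (@fX_eq0 k); rewrite Es.
  have Ws : W (loc s).
    by rewrite -Es => P' [sP' hO' hd'] hP' hE'; apply: hO'; apply: hE'.
  by rewrite (W0 s Ws) loc_0.
by have [k [s Es]] := loc_surj m; apply: (WfX k); rewrite Es.
Qed.

Lemma tauL_linear g : G g -> linear (tauL g).
Proof. by case: hLrat => h _ _ _ Gg c u v; apply: h. Qed.

Definition hom_equivariant (W : lmodType C) (act : 'M[C]_N -> W -> W) (T : 'cV[C]_l -> W) :=
  linear T /\ forall g a, G g -> T (tauL g a) = act g (T a).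

Lemma hom_zero_or_injective (W : lmodType C) (act : 'M[C]_N -> W -> W) T :
  (forall g, G g -> act g 0 = 0) ->
  hom_equivariant act T -> (forall a, T a = 0) \/ injective T.
Proof.
move=> act0 [lT eT]; have T0 : T 0 = 0 by rewrite -(scale0r (0 : 'cV[C]_l)) linear_scale // scale0r.
have [_ _ irr] := hLirr; have [|//|h0|h0] := irr (fun a => T a = 0).
- split; first split=> //.
    by move=> c u v Tu Tv; rewrite lT Tu Tv scaler0 addr0.
  by move=> g u Gg Tu; rewrite eT // Tu act0.
- right=> a b Eab; apply/eqP; rewrite -subr_eq0; apply/eqP; apply: h0.
  by rewrite addrC -scaleN1r lT Eab scaleN1r addrC subrr.
- by left=> a; apply: h0.
Qed.

Lemma tau_0 g : G g -> tau g 0 = 0.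
Proof. by move=> Gg; rewrite -(scale0r (0 : M)) linear_scale ?scale0r //; apply: (tau_linear hM). Qed.

Lemma isotypic_image T : hom_equivariant tau T -> forall a, E (T a).
Proof.
move=> hT a; have [T0|injT] := hom_zero_or_injective tau_0 hT.
  by rewrite T0; case: isotypic_subspace.
case: hT => lT eT.
exists 1%N, (fun _ => T), (fun _ => a); split=> //; last by rewrite big_ord1.
Qed.

(** E contains a copy of the representation; being irreducible, E is equal to
    it. *)
Lemma isotypic_parametrization : exists h : 'cV[C]_l -> M,
  [/\ hom_equivariant tau h, injective h & forall x, E x -> exists a, x = h a].
Proof.
have [x hx x0] := isotypic_nonzero; case: hx => k [h [v [lh ih eh _ Ex]]].
have [i _] : exists i : 'I_k, True.
  case: k h v lh ih eh Ex => [|k] h v _ _ _ Ex; last by exists ord0.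
  by case: x0; rewrite Ex big_ord0.
have hh : hom_equivariant tau (h i) by split; [exact: lh|move=> g a; apply: eh].
exists (h i); split=> //; have [_ _ irr] := hMirr.
have [|y [a ->]|h0|hall] := irr (fun y => exists a, y = h i a).
- split; first split.
  + by exists 0; rewrite -(scale0r (0 : 'cV[C]_l)) (linear_scale _ _ (lh i)) scale0r.
  + by move=> c _ _ [a ->] [b ->]; exists (c *: a + b); rewrite lh.
  + by move=> g _ Gg [a ->]; exists (tauL g a); rewrite eh.
- exact: isotypic_image.
- have [_ [a _ a0] _] := hLirr; case: a0.
  have e1 : h i a = 0 by apply: h0; exists a.
  have e2 : h i 0 = 0 by apply: h0; exists 0.
  by apply: (ih i a 0); rewrite e1 e2.
- by move=> y /hall.
Qed.

Lemma irr_dim_gt0 : (0 < l)%N.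
Proof.
have [_ [a _ a0] _] := hLirr; rewrite lt0n; apply/eqP => l0; apply: a0.
by apply/matrixP => i j; have := leq_trans (ltn_ord i) (eq_leq l0); rewrite ltn0.
Qed.

(** Schur's lemma: T = h o B for a matrix B, and an eigenspace of B is a
    subrepresentation. *)
Lemma equivariant_isotypic_scalar h T : hom_equivariant tau h -> injective h -> (forall x, E x -> exists a, x = h a) ->
  hom_equivariant tau T -> exists c : C, forall a, T a = c *: h a.
Proof.
move=> [lh eh] ih hE hT; have [lT eT] := hT.
have /choice[b Hb] : forall j : 'I_l, exists b, T (delta_mx j 0) = h b.
  by move=> j; apply: hE; apply: isotypic_image.
pose B := \matrix_(i, j) b j i 0.
have HB a : T a = h (B *m a).
  have cE (a' : 'cV[C]_l) : a' = \sum_j a' j 0 *: delta_mx j 0.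
    by rewrite {1}[a']matrix_sum_delta; apply: eq_bigr => j _; rewrite big_ord1.
  pose Tl : {linear 'cV[C]_l -> M} := HB.pack T (GRing.isLinear.Build _ _ _ _ T lT).
  pose hl : {linear 'cV[C]_l -> M} := HB.pack h (GRing.isLinear.Build _ _ _ _ h lh).
  rewrite -[T a]/(Tl a) -[h _]/(hl _) [a]cE mulmx_sumr !linear_sum; apply: eq_bigr => j _.
  rewrite -scalemxAr !linearZ /= Hb; congr (_ *: h _).
  by apply/colP => i; rewrite -colE !mxE.
have [c [v v0 Bv]] : exists c : C, exists2 v : 'cV[C]_l, v != 0 & B *m v = c *: v.
  have [c] : exists c, root (char_poly B^T) c.
    by apply/closed_rootP; rewrite size_char_poly; case: (l) irr_dim_gt0.
  rewrite -eigenvalue_root_char => /eigenvalueP[v Bv v0]; exists c, v^T.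
    by apply: contraNneq v0 => v0; rewrite -[v]trmxK v0 trmx0.
  by apply: trmx_inj; rewrite trmx_mul !trmxK Bv linearZ /= trmxK.
exists c => a; rewrite HB -(linear_scale _ _ lh); congr h.
have [_ _ irr] := hLirr; have [|//|h0|hall] := irr (fun a => B *m a = c *: a).
- split; first split.
  + by rewrite mulmx0 scaler0.
  + by move=> c' u u' Hu Hu'; rewrite mulmxDr -scalemxAr Hu Hu' scalerDr !scalerA mulrC.
  + move=> g u Gg Hu; apply: ih; rewrite -HB eT // HB Hu.
    by rewrite -eh // (linear_scale _ _ (tauL_linear Gg)).
- by case/eqP: v0; apply: h0.
- by apply: hall.
Qed.

(** Take a nonzero vector x of M, and m with g m = x.  Applying g to the Leibniz
    rule for d_j (h m) shows that the two sides of this chain rule multiply x in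
    the same way; as M is torsion free, they are equal. *)
Lemma act_fun_deriv g j h : G g ->
  actf g h^`M(j) = \sum_i rho g i j *: (actf g h)^`M(i).
Proof.
move=> Gg; apply/eqP; rewrite -subr_eq0; apply: contraT => ne0.
have [x Ex x0] := isotypic_nonzero; case: x0.
pose m := tau (invmx g) x.
have tm : tau g m = x.
  rewrite /m -(tau_mul hM) ?mulmxV ?(tau_1 hM) ?(group_unit hG) //.
  exact: (group_inv hG).
have e1 : tau g (dm_d j (dm_O h m)) = \sum_i rho g i j *: dm_d i (dm_O (actf g h) x).
  by rewrite (tau_d hM) // (tau_O hM) // tm.
have e2 : tau g (dm_O h (dm_d j m)) = \sum_i rho g i j *: dm_O (actf g h) (dm_d i x).
  rewrite (tau_O hM) // (tau_d hM) // tm linear_sum.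
  by apply: eq_bigr => i _; rewrite linearZ.
have lB a b : tau g (a - b) = tau g a - tau g b.
  by rewrite [a - b]addrC -scaleN1r (tau_linear hM Gg) scaleN1r addrC.
apply: (torsion_free ne0); rewrite dm_OB -[X in dm_O _ X - _]tm -(tau_O hM) //.
have -> : dm_O h^`M(j) m = dm_d j (dm_O h m) - dm_O h (dm_d j m) by rewrite dm_d_leibniz addrK.
rewrite lB e1 e2 [X in _ - X](@dm_O_sum C n M) -sumrB -sumrB big1 // => i _.
by rewrite dm_d_leibniz dm_OZ scalerDr addrK subrr.
Qed.

(** The map x |-> f^-k h x is an equivariant map from E to M, hence a scalar. *)
Lemma weight_one_dimensional h k : (forall g, G g -> actf g h = sigma g ^+ k *: h) ->
  exists c, h = c *: f ^+ k.
Proof.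
move=> hw; have [h0 [hh0 ih0 E0]] := isotypic_parametrization; have [lh eh] := hh0.
case: f_bij => finv fK finvK.
pose T a := iter k finv (dm_O h (h0 a)).
have fT a : dm_O (f ^+ k) (T a) = dm_O h (h0 a).
  by rewrite /T dm_O_exp; elim: (k) (dm_O h (h0 a)) => [|k' IH] y //; rewrite iterSr /= finvK IH.
have fI : injective (dm_O (f ^+ k) : M -> M).
  by move=> u v /eqP; rewrite -subr_eq0 -linearB => /eqP/fX_eq0/eqP; rewrite subr_eq0 => /eqP.
have [|c Hc] := equivariant_isotypic_scalar hh0 ih0 E0 (T := T).
  split.
    by move=> c u v; apply: fI; rewrite linearP /= !fT lh linearP.
  move=> g a Gg; apply: fI; rewrite fT eh //.
  have := congr1 (tau g) (fT a); rewrite !(tau_O hM) // (act_fun_fX hG hsigma hf) // hw // !dm_OZ.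
  by move/(scalerI (expf_neq0 k (sigma_neq0 hsigma Gg))) => ->.
exists c; apply/eqP; rewrite -subr_eq0; apply: contraT => ne0.
have [x /E0[a ->] x0] := isotypic_nonzero; case: x0; apply: (torsion_free ne0).
by rewrite dm_OB dm_OZ -fT Hc linearZ /= subrr.
Qed.

(** * The dual operator *)

Hypothesis hGr : reductive G.
Local Notation d := (total_degree f).
Local Notation L := #|{: d.-tuple 'I_n}|.

(** Column vectors of length n^d as tensors of rank d, so that reductivity
    applies to them; a word of another length has component 0. *)
Definition tensor_of (v : 'cV[C]_L) (s : seq 'I_n) : C :=
  if insub s is Some t then v (enum_rank (t : d.-tuple 'I_n)) 0 else 0.

Lemma tensor_of_linear c u v s : tensor_of (c *: u + v) s = c * tensor_of u s + tensor_of v s.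
Proof. by rewrite /tensor_of; case: insubP => [t _ _|_]; rewrite ?mxE // mulr0 addr0. Qed.

Lemma tensor_of_0 s : tensor_of 0 s = 0.
Proof. by rewrite /tensor_of; case: insubP => [t _ _|_]; rewrite ?mxE. Qed.

Definition tensor_act g (v : 'cV[C]_L) : 'cV[C]_L :=
  \col_k tensor_power (rho g) (tensor_of v) (enum_val k : d.-tuple 'I_n).

Lemma tensor_of_act g v s : size s = d ->
  tensor_of (tensor_act g v) s = tensor_power (rho g) (tensor_of v) s.
Proof.
move=> /eqP hs; rewrite /tensor_of (insubT (fun s => size s == d) hs) mxE enum_rankK.
by rewrite /= -[X in tensor_power _ X]/(tensor_of v).
Qed.

Lemma tensor_rep : rational_rep tensor_act G.
Proof.
split.
- move=> g Gg c u v; apply/colP => k; rewrite !mxE -tensor_power_linear.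
  by apply: eq_tensor_power => r _; apply: tensor_of_linear.
- move=> v; apply/colP => k; rewrite !mxE (rho_1 hrho) tensor_power_1 /tensor_of valK.
  by rewrite enum_valK.
- move=> g h v Gg Gh; apply/colP => k; rewrite !mxE (rho_mul hrho) // tensor_power_mul.
  by apply: eq_tensor_power => r hr; rewrite tensor_of_act // hr size_tuple.
- move=> v.
  have reg (phi : seq 'I_n -> C) s : regular_on G (fun g => tensor_power (rho g) phi s).
    elim: s phi => [|i s IH] phi /=; first exact: regular_const.
    apply: regular_sum => [|j]; first exact: (group_unit hG).
    by apply: regular_mul; [exact: (group_unit hG)|apply: (regular_entry _ _ _ hrho); exact: (group_unit hG)|].
  have /choice[a Ha] : forall k : 'I_L, exists a, forall g, G g ->
      tensor_power (rho g) (tensor_of v) (enum_val k : d.-tuple 'I_n) = rf_eval a g.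
    by move=> k; apply: reg.
  exists L, a, (fun k => delta_mx k 0) => g Gg.
  rewrite [LHS]matrix_sum_delta; apply: eq_bigr => k _.
  by rewrite big_ord1 mxE Ha.
Qed.

Local Notation Qf phi := (diff_op d phi f).

Lemma act_fun_diff_op g phi h : G g -> actf g (diff_op d phi h) = diff_op d (tensor_power (rho g) phi) (actf g h).
Proof.
move=> Gg; apply: (@tensor_op_equivariant C n {mpoly C[n]} (fun i => mderiv i : {linear {mpoly C[n]} -> {mpoly C[n]}}) (rho g) (actf g)).
  by move=> c u v; rewrite rmorphD /= act_funZ.
by move=> j u /=; apply: act_fun_deriv.
Qed.

(** The linear form ev : phi |-> (Q_phi f)(0) has weight sigma^-1, and it is not
    zero: differentiate f along its leading monomial.  A complement of its kernel
    is a line on which the group acts like on the values of ev. *)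
Lemma dual_operator : exists phi : seq 'I_n -> C,
  (Qf phi)@_0 != 0 /\
  forall g s, G g -> size s = d -> tensor_power (rho g) phi s = (sigma g)^-1 * phi s.
Proof.
pose ev v := (Qf (tensor_of v))@_0.
have ev_lin c u v : ev (c *: u + v) = c * ev u + ev v.
  rewrite /ev -mcoeffZ -mcoeffD; congr (_@_0).
  rewrite (@eq_tensor_op _ _ _ _ _ _ (fun s => c * tensor_of u s + tensor_of v s)); last first.
    by move=> s _; apply: tensor_of_linear.
  exact: (@tensor_op_tensor_linear C n _ (fun i => mderiv i : {linear {mpoly C[n]} -> {mpoly C[n]}})).
have ev0 : ev 0 = 0 by have := ev_lin (-1) 0 0; rewrite scaler0 addr0 mulN1r addNr.
have ev_act g v : G g -> ev (tensor_act g v) = (sigma g)^-1 * ev v.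
  move=> Gg; rewrite /ev -(act_fun_const rho g (Qf (tensor_of v))) act_fun_diff_op // (act_fun_f hG hsigma hf) //.
  rewrite linear_scale ?mcoeffZ ?mulKf ?(sigma_neq0 hsigma) //; last first.
    exact: (@tensor_op_linear C {mpoly C[n]} n (fun i => mderiv i)).
  by congr (_@_0); apply: eq_tensor_op => s hs; apply: tensor_of_act.
have [v1 v10] : exists v, ev v != 0.
  (* the word s0 spells the leading monomial of f *)
  pose m := mlead f; pose s0 := flatten [seq nseq (m i) i | i <- enum 'I_n].
  have dm : mdeg m = d by rewrite /total_degree -(mlead_deg hf0).
  have hs0 : size s0 = d.
    rewrite -dm /s0 size_flatten /shape -map_comp mdegE sumnE big_map big_enum.
    by apply: eq_bigr => i _; rewrite /= size_nseq.
  exists (\col_k (val (enum_val k : d.-tuple (ordinal n)) == s0)%:R).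
  rewrite /ev (@eq_tensor_op _ _ _ _ _ _ (fun s => (s == s0)%:R)); last first.
    move=> s /eqP hs; rewrite /tensor_of (insubT (fun s => size s == d) hs) mxE enum_rankK //.
  rewrite (@tensor_op_delta C n {mpoly C[n]} (fun i => mderiv i : {linear {mpoly C[n]} -> {mpoly C[n]}})) //.
  have -> : foldr (fun i p => mderiv i p) f s0 = f^`M[m] by rewrite mderivm_foldr.
  rewrite mcoeff_mderivm addm0 mulrn_eq0 negb_or mleadc_eq0 hf0 andbT.
  by rewrite -lt0n; apply/prodn_gt0 => i; rewrite ffactnn fact_gt0.
have [|U' [[[_ sU'] gU'] dis dec]] := hGr tensor_rep (U := fun v => ev v = 0).
  split; first by split=> // c u v Hu Hv; rewrite ev_lin Hu Hv mulr0 addr0.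
  move=> g u Gg Hu; by rewrite ev_act // Hu mulr0.
have [u [u' [Hu Hu' E1]]] := dec v1.
have u'0 : ev u' != 0.
  by have := ev_lin 1 u u'; rewrite scale1r -E1 Hu mulr0 add0r => <-.
exists (tensor_of u'); split=> // g s Gg hs.
rewrite -tensor_of_act // -(addr0 (_ * _)) -[0](tensor_of_0 s) -tensor_of_linear.
congr (tensor_of _ s).
apply/eqP; rewrite -subr_eq0; apply/eqP; apply: dis.
  by rewrite addr0 addrC -scaleNr ev_lin ev_act // mulNr addNr.
by rewrite addr0 addrC -scaleNr; apply: sU' => //; apply: gU'.
Qed.

(* the principal symbol of the operator at the gradient of f *)
Local Notation symbol k phi := (tensor_op (fun i p => f^`M(i) * p) k phi (1 : {mpoly C[n]})).

(** A derivation multiplies f^j by j f' / f, so that each order of Q contributes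
    at most one factor j; the terms with a factor j from every order make up the
    symbol of Q at grad f. *)
Lemma diff_op_power_expansion k phi g : exists H : {poly {mpoly C[n]}},
  [/\ (size H <= k.+1)%N, H`_k = symbol k phi * g &
      forall j, f ^+ k * diff_op k phi (f ^+ j * g) = f ^+ j * H.[j%:R]].
Proof.
elim: k phi => [|k IH] phi.
  exists (phi [::] *: g)%:P; split; first exact: size_polyC_leq1.
    by rewrite coefC /= -scalerAl mul1r.
  by move=> j; rewrite expr0 mul1r /= hornerC scalerAr.
have /choice[H HH] := fun i : 'I_n => IH (fun s => phi (i :: s)).
pose F i := 'X * (f^`M(i)%:P * H i) + (f%:P * map_poly (mderiv i) (H i) - k%:R *: (f^`M(i)%:P * H i)).
have coefF i m : (F i)`_m = (if m is m'.+1 then f^`M(i) * (H i)`_m' else 0) +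
    (f * ((H i)`_m)^`M(i) - k%:R * (f^`M(i) * (H i)`_m)).
  by rewrite /F coefD coefXM coefCM coefB coefZ !coefCM coef_map /=; case: m.
have Hout i m : (k < m)%N -> (H i)`_m = 0.
  by move=> km; case: (HH i) => szH _ _; rewrite nth_default // (leq_trans szH).
exists (\sum_i F i); split.
- apply/leq_sizeP => m km; rewrite coef_sum big1 // => i _; rewrite coefF.
  case: m km => // m km; rewrite (Hout i m) // (Hout i m.+1) 1?ltnW //.
  by rewrite linear0 !mulr0 subrr addr0.
- rewrite coef_sum /= mulr_suml; apply: eq_bigr => i _; rewrite coefF (Hout i k.+1) //.
  by case: (HH i) => _ -> _; rewrite linear0 !mulr0 subrr addr0 mulrA.
move=> j; rewrite horner_sum !mulr_sumr; apply: eq_bigr => i _.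
case: (HH i) => _ _ /(_ j) Hj; pose q := diff_op k (fun s => phi (i :: s)) (f ^+ j * g).
have dX m : f * (f ^+ m)^`M(i) = m%:R * (f^`M(i) * f ^+ m).
  elim: m => [|m IHm]; first by rewrite expr0 -mpolyC1 mderivC mulr0 mul0r.
  rewrite exprS mderivM mulrDr [f * (f * _)]mulrCA -/(f ^+ m) IHm -natr1; ring.
have -> : f ^+ k.+1 * q^`M(i) = f * (f ^+ k * q)^`M(i) - k%:R * (f^`M(i) * (f ^+ k * q)).
  by rewrite mderivM mulrDr [f * (_ * q)]mulrA dX exprS; ring.
rewrite Hj mderivM mulrDr [f * (_^`M(i) * _)]mulrA dX /F !hornerE /=.
have -> : (map_poly (mderiv i) (H i)).[j%:R] = (H i).[j%:R]^`M(i).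
  rewrite (@horner_coef_wide _ (size (H i)) (map_poly _ _)) ?size_poly // horner_coef linear_sum.
  apply: eq_bigr => m _ /=; rewrite coef_map /= mderivM -natrX.
  by rewrite [_%:R^`M(i)]raddfMn /= -mpolyC1 mderivC mul0rn mulr0 addr0.
by ring.
Qed.

(** By [weight_one_dimensional], Q f^(k+1) = c_k f^k, where c_0 is not zero.  By
    [diff_op_power_expansion], c_k is a polynomial in k, of degree less than d if
    the symbol vanishes at grad f: this is what [power_identity_degree]
    forbids. *)
Lemma dual_symbol_neq0 phi : (Qf phi)@_0 != 0 ->
  (forall g s, G g -> size s = d -> tensor_power (rho g) phi s = (sigma g)^-1 * phi s) ->
  symbol d phi != 0.
Proof.
move=> phi0 phiw; apply/eqP => symb0.
have weight k : exists c, diff_op d phi (f ^+ k.+1) = c *: f ^+ k.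
  apply: weight_one_dimensional => g Gg.
  rewrite act_fun_diff_op // (act_fun_fX hG hsigma hf) //.
  rewrite linear_scale; last exact: (@tensor_op_linear C {mpoly C[n]} n (fun i => mderiv i)).
  rewrite (@eq_tensor_op _ _ _ _ _ _ (fun s => (sigma g)^-1 * phi s)); last by move=> s; apply: phiw.
  rewrite (@tensor_op_tensor_scale C n _ (fun i => mderiv i : {linear {mpoly C[n]} -> {mpoly C[n]}})).
  by rewrite scalerA exprSr mulfK ?(sigma_neq0 hsigma).
have /choice[c Hc] := weight.
have [H [szH topH EH]] := diff_op_power_expansion d phi 1.
have szH' : (size H <= d)%N.
  by apply/leq_sizeP => m; rewrite leq_eqVlt => /predU1P[<-|lt]; [rewrite topH symb0 mul0r|rewrite nth_default // (leq_trans szH)].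
have EH' k : c k *: f ^+ d = f * H.[k.+1%:R].
  apply: (mulfI (expf_neq0 k hf0)); have := EH k.+1.
  rewrite mulr1 Hc exprS -!mul_mpolyC [f ^+ d * _]mulrC [f ^+ k * (_ * f ^+ d)]mulrCA => h.
  by rewrite mulrA h [f * _]mulrC -mulrA.
(* c_k is read off one nonzero coefficient of f^d c_k = f H(k+1) *)
pose m := mlead (f ^+ d); have c0 : (f ^+ d)@_m != 0 by rewrite mleadc_eq0 expf_neq0.
pose b : {poly C} := ((f ^+ d)@_m)^-1 *: \poly_(i < d) (f * H`_i)@_m \Po ('X + 1).
have bE k : b.[k%:R] = c k.
  apply: (mulfI c0); rewrite [RHS]mulrC -mcoeffZ EH' horner_comp hornerZ horner_poly mulVKf //.
  rewrite !hornerE natr1 (horner_coef_wide _ szH') mulr_sumr raddf_sum.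
  by apply: eq_bigr => i _; rewrite /= mulrA -!natrX mulr_natr mulr_natr mcoeffMn.
have szb : (size b <= d)%N.
  rewrite size_comp_poly2 ?(leq_trans (size_scale_leq _ _)) ?size_poly //.
  by rewrite -polyC1 size_XaddC.
have b0 : b != 0.
  apply: contraNneq phi0 => b0; rewrite -[f]expr1 Hc -bE b0 horner0 scale0r mcoeff0 //.
have hp : power_identity d phi f b by move=> k; rewrite bE Hc.
by have := power_identity_degree b0 hf0 hp; rewrite ltnNge szb.
Qed.

(** * Equivariant maps into the direct image *)

Local Notation N_ := (fseq M).
Local Notation s_ := (@iota_s C n f M).
Local Notation t_ := (@iota_t C n f M).
Local Notation act := (iota_act sigma tau).
Local Notation Phi := (@mfs_to_iota C n f M).
Local Notation e m := (fmono 0 m : N_).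

Lemma iota_act_mono g k m : G g -> act g (fmono k m) = fmono k (sigma g ^- k *: tau g m).
Proof.
move=> Gg; rewrite /iota_act fseq_ext_mono // => j c u v.
by rewrite (tau_linear hM) // scalerDr scalerA mulrC -scalerA linearP.
Qed.
Lemma iota_act_linear g : G g -> linear (act g).
Proof.
move=> Gg; apply: fseq_ext_linear => j c u v.
by rewrite (tau_linear hM) // scalerDr scalerA mulrC -scalerA linearP.
Qed.
Lemma mfs_act_mono g k m : G g -> mfs_act tau g (fmono k m) = fmono k (tau g m).
Proof. by move=> Gg; rewrite /mfs_act fseq_ext_mono // => j c u v; rewrite (tau_linear hM) // linearP. Qed.
Lemma mfs_act_linear g : G g -> linear (mfs_act tau g : N_ -> N_).
Proof. by move=> Gg; apply: fseq_ext_linear => j c u v; rewrite (tau_linear hM) // linearP. Qed.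

Lemma iota_act_t g w : G g -> act g (t_ w) = sigma g *: t_ (act g w).
Proof.
move=> Gg; apply: (@eq_on_monomials _ _ _ (act g \o t_) (fun w => sigma g *: t_ (act g w))) w.
- by apply: linear_comp; [apply: iota_act_linear|apply: iota_t_linear].
- by move=> c u v; rewrite iota_act_linear // linearP scalerDr !scalerA mulrC.
have aB u v : act g (u - v) = act g u - act g v.
  by rewrite [u - v]addrC -scaleN1r iota_act_linear // scaleN1r addrC.
move=> k m; rewrite /= iota_t_mono aB !iota_act_mono // iota_t_mono (tau_O hM) // (act_fun_f hG hsigma hf) //.
have tMn j : tau g (m *+ j) = tau g m *+ j.
  by rewrite -!scaler_nat (linear_scale _ _ (tau_linear hM Gg)).
rewrite tMn dm_OZ !linearZ scalerBr /= !scalerA [sigma g * _]mulrC. rewrite scalerN; congr (_ + - _).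
case: k => [|k]; first by rewrite !mulr0n !linear0.
rewrite /= -!scaler_nat !linearZ /= !scalerA; congr (_ *: _).
have s0 := sigma_neq0 hsigma Gg; rewrite exprS.
by field; rewrite s0 expf_neq0.
Qed.

Lemma iota_actB g u v : G g -> act g (u - v) = act g u - act g v.
Proof. by move=> Gg; rewrite [u - v]addrC -scaleN1r iota_act_linear // scaleN1r addrC. Qed.

Lemma iota_act_dt g w : G g -> act g (iota_dt w) = (sigma g)^-1 *: iota_dt (act g w).
Proof.
move=> Gg; apply: (@eq_on_monomials _ _ _ (act g \o @iota_dt C n M) (fun w => (sigma g)^-1 *: iota_dt (act g w))) w.
- by apply: linear_comp; [apply: iota_act_linear|apply: iota_dt_linear].
- by move=> c u v; rewrite iota_act_linear // linearP scalerDr !scalerA mulrC.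
move=> k m; rewrite /= iota_dt_mono !iota_act_mono // iota_dt_mono.
by rewrite -linearZ /= scalerA exprS invfM.
Qed.

Lemma iota_act_s g w : G g -> act g (s_ w) = s_ (act g w).
Proof.
move=> Gg; have actN u : act g (- u) = - act g u.
  by rewrite -scaleN1r (linear_scale _ _ (iota_act_linear Gg)) scaleN1r.
rewrite [LHS]actN iota_act_dt // iota_act_t // (linear_scale _ _ (@iota_dt_linear C n M)).
by rewrite scalerA mulVf ?scale1r ?(sigma_neq0 hsigma).
Qed.

Lemma iota_act_d g j w : G g -> act g (iota_d f j w) = \sum_i rho g i j *: iota_d f i (act g w).
Proof.
move=> Gg; apply: (@eq_on_monomials _ _ _ (act g \o iota_d f j) (fun w => \sum_i rho g i j *: iota_d f i (act g w))) w.
- by apply: linear_comp; [apply: iota_act_linear|apply: iota_d_linear].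
- move=> c u v; rewrite scaler_sumr -big_split; apply: eq_bigr => i _ /=.
  by rewrite iota_act_linear // linearP scalerDr !scalerA mulrC.
move=> k m; rewrite /= iota_d_mono iota_actB // !iota_act_mono //.
rewrite (tau_d hM) // (tau_O hM) // act_fun_deriv // (act_fun_f hG hsigma hf) //.
rewrite dm_O_sum !scaler_sumr !linear_sum -big_split; apply: eq_bigr => i _ /=.
have s0 := sigma_neq0 hsigma Gg; have sk0 : sigma g ^+ k != 0 by rewrite expf_neq0.
rewrite iota_d_mono mderivZ !dm_OZ !linearZ /= !scalerA scalerDr !scalerA.
by congr (_ *: _ + _ *: _); rewrite ?exprS; field; rewrite ?s0 sk0.
Qed.

Lemma iota_act_mfs_to_iota g u : G g -> act g (Phi u) = Phi (mfs_act tau g u).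
Proof.
move=> Gg; apply: (@eq_on_monomials _ _ _ (act g \o Phi) (Phi \o mfs_act tau g)) u.
- by apply: linear_comp; [apply: iota_act_linear|apply: mfs_to_iota_linear].
- by apply: linear_comp; [apply: mfs_to_iota_linear|apply: mfs_act_linear].
move=> k m; rewrite /= mfs_act_mono // !mfs_to_iota_mono.
by elim: k => [|k IH]; rewrite /= ?iota_act_s ?IH // iota_act_mono // expr0 invr1 scale1r.
Qed.

(** The coefficients of T a in the s-expansion depend equivariantly on a, hence
    are multiples of h a by Schur's lemma.  Almost all of these multiples are
    zero, as one sees at a single a with h a nonzero. *)
Lemma hom_polynomial_in_s h T : hom_equivariant tau h -> injective h ->
  (forall x, E x -> exists a, x = h a) -> hom_equivariant act T ->
  exists q : {poly C}, forall a, T a = op_poly q s_ (e (h a)).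
Proof.
move=> hh ih hE [lT eT]; case: f_bij => finv fK finvK.
have Phi_inj := mfs_to_iota_inj fK.
have /choice[Psi HPsi] := mfs_to_iota_surj finvK.
have lPsi : linear Psi by move=> c u v; apply: Phi_inj; rewrite HPsi linearP /= !HPsi.
have ePsi g w : G g -> Psi (act g w) = mfs_act tau g (Psi w).
  by move=> Gg; apply: Phi_inj; rewrite HPsi -iota_act_mfs_to_iota // HPsi.
have coef_act g k (u : N_) : G g -> monalg.mcoeff k (mfs_act tau g u) = tau g (monalg.mcoeff k u).
  move=> Gg; apply: (@eq_on_monomials _ _ _ (monalg.mcoeff k \o mfs_act tau g) (tau g \o monalg.mcoeff k)) u.
  - apply: linear_comp; last exact: mfs_act_linear.
    by move=> c u v; rewrite monalg.mcoeffD fseq_scaleE.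
  - apply: linear_comp; first exact: (tau_linear hM).
    by move=> c u v; rewrite monalg.mcoeffD fseq_scaleE.
  move=> j m; rewrite /= mfs_act_mono // !monalg.mcoeffU.
  by case: eqP => _; rewrite ?mulr1n // !mulr0n tau_0.
have /choice[c Hc] : forall k, exists c : C, forall a, monalg.mcoeff k (Psi (T a)) = c *: h a.
  move=> k; apply: (equivariant_isotypic_scalar hh ih hE (T := fun a => monalg.mcoeff k (Psi (T a)))); split.
    by move=> c u v; rewrite lT lPsi monalg.mcoeffD fseq_scaleE.
  by move=> g a Gg; rewrite eT // ePsi // coef_act.
have [x /hE[a0 xa] x0] := isotypic_nonzero; rewrite {}xa in x0.
have [L HL] := sdeg_lt_exists (Psi (T a0)).
have cL k : (L <= k)%N -> c k = 0.
  move=> /HL; rewrite Hc => /eqP; rewrite scaler_eq0 => /orP[/eqP//|/eqP//].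
exists (\poly_(k < L) c k) => a; rewrite -[T a]HPsi.
have -> : Psi (T a) = \sum_(k < L) fmono k (c k *: h a).
  apply/malgP => k; rewrite Hc (mcoeff_sum_fmono (fun k => c k *: h a)).
  by case: ltnP => // /cL ->; rewrite scale0r.
rewrite (@op_polyEw _ _ s_ L) ?size_poly // linear_sum; apply: eq_bigr => k _.
by rewrite !linearZ /= mfs_to_iota_mono coef_poly ltn_ord.
Qed.

Local Notation graph_op k phi := (tensor_op (fun i => @iota_d C n f M i) k phi).

(** Since d_i e m = e (d_i m) + s e (f_i m / f), each derivation raises the
    degree in s by at most one, and the coefficient of s^k comes from the second
    terms only. *)
Lemma graph_op_expansion finv k phi m : cancel finv (dm_O f : M -> M) -> exists m_ : nat -> M,
  graph_op k phi (e m) = \sum_(j < k.+1) iter j s_ (e (m_ j)) /\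
  dm_O (f ^+ k) (m_ k) = dm_O (symbol k phi) m.
Proof.
move=> finvK; elim: k phi => [|k IH] phi.
  exists (fun=> phi [::] *: m); rewrite big_ord1 /= linearZ expr0 dm_O1.
  by rewrite dm_OZ dm_O1.
have /choice[m_ Hm] := fun i : 'I_n => IH (fun s => phi (i :: s)).
pose u i j := if (j < k.+1)%N then dm_d i (m_ i j) else 0.
pose v i j := if j is j'.+1 then dm_O f^`M(i) (finv (m_ i j')) else 0.
exists (fun j => \sum_i (u i j + v i j)); split; last first.
  rewrite /= dm_O_sum linear_sum; apply: eq_bigr => i _.
  rewrite /u ltnn add0r /= dm_O_comm exprSr dm_O_mul finvK.
  by case: (Hm i) => _ ->; rewrite dm_O_mul.
have iter_sum j : iter j s_ (e (\sum_i (u i j + v i j))) =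
    \sum_i (iter j s_ (e (u i j)) + iter j s_ (e (v i j))).
  by rewrite -(op_polyXn s_) !linear_sum; apply: eq_bigr => i _; rewrite /= !linearD /= !op_polyXn.
under [RHS]eq_bigr do rewrite iter_sum.
rewrite exchange_big /=; apply: eq_bigr => i _; case: (Hm i) => -> _.
have iter0 j : iter j s_ (e 0) = 0 by elim: j => [|j /= ->]; rewrite ?linear0.
have uk : u i k.+1 = 0 by rewrite /u ltnn.
rewrite big_split linear_sum [X in _ = X + _]big_ord_recr [in RHS]/= uk iter0 linear0 addr0.
rewrite [X in _ = _ + X]big_ord_recl /= linear0 add0r -big_split; apply: eq_bigr => j _ /=.
rewrite /u ltn_ord -(op_polyXn s_) ds_poly (iota_d_e finvK) linearD /= !op_polyXn.
by rewrite -iterS iterSr.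
Qed.

Lemma iota_act_graph_op g k phi w : G g -> act g (graph_op k phi w) = graph_op k (tensor_power (rho g) phi) (act g w).
Proof.
move=> Gg; apply: (@tensor_op_equivariant C n N_ (fun i => iota_d f i : {linear N_ -> N_}) (rho g) (act g)).
  exact: iota_act_linear.
by move=> j u; apply: iota_act_d.
Qed.

Lemma graph_op_Dst k phi : Dst f (graph_op k phi : N_ -> N_).
Proof.
elim: k phi => [|k IH] phi; first exact: gen_alg_scal.
rewrite (_ : graph_op _ _ = fun w => \sum_i iota_d f i (graph_op k (fun s => phi (i :: s)) w)) //.
elim: (index_enum _) => [|i r IHr].
  rewrite (_ : (fun w => _) = (fun w : N_ => 0 *: w)); first exact: gen_alg_scal.
  by apply: funext => w; rewrite big_nil scale0r.
rewrite (_ : (fun w => _) = (fun w : N_ => iota_d f i (graph_op k (fun s => phi (i :: s)) w) +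
   \sum_(i <- r) iota_d f i (graph_op k (fun s => phi (i :: s)) w))); last first.
  by apply: funext => w; rewrite big_cons.
apply: gen_alg_add => //; apply: gen_alg_comp; last exact: IH.
by apply: gen_alg_base; constructor.
Qed.

Variable lam : 'I_d -> rat.
Hypothesis hlam : forall m : M, E m -> m <> 0 -> is_bfun_of f m (\prod_i ('X + (ratr (lam i))%:P)).
Local Notation lams := [seq lam i | i <- enum 'I_d].

Lemma bshift0 : bshift C lams 0 = \prod_i ('X + (ratr (lam i))%:P).
Proof.
rewrite /bshift -map_comp /linprod big_map big_enum; apply: eq_bigr => i _ /=.
by rewrite addr0.
Qed.

(** [hom_polynomial_in_s] gives Q e (f x) = q(s) e x.  Here q has degree d: no
    more by [graph_op_expansion], and no less because the symbol is not zero and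
    M is torsion free.  If q were not proportional to b, subtracting a multiple
    of b would yield a functional equation of smaller degree, against the
    minimality of b. *)
Lemma dual_b_function : exists phi, forall x, E x ->
  graph_op d phi (e (dm_O f x)) = op_poly (bshift C lams 0) s_ (e x).
Proof.
have [phi [phi0 phiw]] := dual_operator.
have symb := dual_symbol_neq0 phi0 phiw.
have [h [hh ih hE]] := isotypic_parametrization; have [lh eh] := hh.
have lQ p : linear (graph_op d p) by exact: dual_op_linear.
have [|q Hq] := hom_polynomial_in_s hh ih hE (T := fun a => graph_op d phi (e (dm_O f (h a)))).
  split; first by move=> c u v; rewrite lh !linearP.
  move=> g a Gg; rewrite iota_act_graph_op // iota_act_mono // expr0 invr1 scale1r (tau_O hM) //.
  rewrite (act_fun_f hG hsigma hf) // dm_OZ eh // linearZ linear_scale //.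
  rewrite (@eq_tensor_op _ _ _ _ _ (tensor_power _ _) (fun s => (sigma g)^-1 * phi s)); last by move=> s; apply: phiw.
  rewrite (@tensor_op_tensor_scale C n N_ (fun i => iota_d f i : {linear N_ -> N_})).
  by rewrite scalerA mulfV ?scale1r ?(sigma_neq0 hsigma).
case: f_bij => finv fK finvK.
have [x Ex x0] := isotypic_nonzero; have [a xa] := hE x Ex.
have [m_ [HQ Hm]] := graph_op_expansion d phi (dm_O f x) finvK.
have Emq : \sum_(j < d.+1) fmono j (m_ j) = \sum_(j < size q) q`_j *: fmono j x.
  apply: (mfs_to_iota_inj fK); rewrite !linear_sum.
  under eq_bigr do rewrite /= mfs_to_iota_mono.
  under [RHS]eq_bigr do rewrite linearZ /= mfs_to_iota_mono.
  by rewrite -HQ xa Hq -xa.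
have Emj j : q`_j *: x = if (j < d.+1)%N then m_ j else 0.
  have := congr1 (monalg.mcoeff j) Emq; rewrite mcoeff_sum_fmono.
  under [X in monalg.mcoeff j X]eq_bigr do rewrite -linearZ /=.
  rewrite (mcoeff_sum_fmono (fun k => q`_k *: x)) => ->.
  by case: ltnP => // /(nth_default 0) ->; rewrite scale0r.
have szq : size q = d.+1.
  apply/eqP; rewrite eqn_leq; apply/andP; split.
    apply/leq_sizeP => j lej; apply/eqP; have := Emj j; rewrite ltnNge lej /= => /eqP.
    by rewrite scaler_eq0 => /orP[//|/eqP].
  rewrite ltnNge; apply/negP => le; have := Emj d; rewrite ltnSn nth_default // scale0r => md.
  move: Hm; rewrite -md linear0 -dm_O_mul => /esym h0.
  by apply: x0; apply: (torsion_free _ h0); rewrite mulf_neq0.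
have lq0 : lead_coef q != 0 by rewrite lead_coef_eq0 -size_poly_gt0 szq.
have q_b : q = lead_coef q *: bshift C lams 0.
  rewrite bshift0; pose b := \prod_i ('X + (ratr (lam i))%:P : {poly C}).
  have [mb [P HP EP] minb] := hlam Ex x0; rewrite -/b in mb EP minb *.
  rewrite !mfs_to_iota_mono /= in EP minb.
  have szb : size b = d.+1.
    rewrite /b (eq_bigr (fun i => 'X - (- ratr (lam i))%:P)) => [|i _]; last by rewrite polyCN opprK.
    by rewrite -big_enum size_prod_XsubC size_enum_ord.
  apply/eqP; rewrite -subr_eq0; apply: contraT => r0.
  pose r := q - lead_coef q *: b; have lr0 : lead_coef r != 0 by rewrite lead_coef_eq0.
  have szr : (size r < d.+1)%N.
    rewrite ltnS; apply/leq_sizeP => j; rewrite coefB coefZ leq_eqVlt => /predU1P[<-|lt].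
      have lcd (p : {poly C}) : size p = d.+1 -> p`_d = lead_coef p by rewrite lead_coefE => ->.
      by rewrite !lcd // (monicP mb) mulr1 subrr.
    by rewrite !nth_default ?szq ?szb // mulr0 subrr.
  have mr : (lead_coef r)^-1 *: r \is monic by rewrite monicE lead_coefZ mulVf.
  have Dst_lin (T T' : N_ -> N_) c c' : Dst f T -> Dst f T' -> Dst f (fun w => c *: T w + c' *: T' w).
    move=> DT DT'; apply: gen_alg_add.
      by apply: (gen_alg_comp (gen_alg_scal _ c)).
    by apply: (gen_alg_comp (gen_alg_scal _ c')).
  suff dr : divides_bfun f (e x) ((lead_coef r)^-1 *: r).
    by have := minb _ mr dr; rewrite szb size_scale ?invr_eq0 // leqNgt szr.
  exists (fun w => (lead_coef r)^-1 *: graph_op d phi w + (- (lead_coef r)^-1 * lead_coef q) *: P w).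
    by apply: Dst_lin => //; apply: graph_op_Dst.
  rewrite EP iota_t_e xa Hq -xa -!op_polyZ -op_polyD; congr (op_poly _ _ _).
  by rewrite /r scalerBr scalerA mulNr scaleNr.
exists (fun s => (lead_coef q)^-1 * phi s) => y /hE[a' ->].
rewrite (@tensor_op_tensor_scale C n N_ (fun i => iota_d f i : {linear N_ -> N_})) Hq [X in op_poly X]q_b.
by rewrite op_polyZ scalerA mulVf // scale1r.
Qed.

(** * The isotypic component of V^alpha *)

Definition hom_value (W : lmodType C) (a : 'M[C]_N -> W -> W) (P : W -> Prop) (w : W) :=
  exists h v, [/\ hom_equivariant a h, injective h, forall v, P (h v) & w = h v].

Lemma isotypicE (W : lmodType C) (a : 'M[C]_N -> W -> W) (P : W -> Prop) w :
  isotypic a G tauL P w <-> span_of (hom_value a P) w.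
Proof.
split=> [[k [h [v [lh ih eh Ph ->]]]]|[k [w_ [/choice[h /choice[v Hv]] ->]]]].
  by exists k, (fun i => h i (v i)); split=> // i; exists (h i), (v i); split; [split; [exact: lh|exact: eh]|exact: ih|exact: Ph|].
exists k, h, v; split.
- by move=> i c x y; case: (Hv i) => -[lh _] _ _ _; apply: lh.
- by move=> i; case: (Hv i).
- by move=> i g x Gg; case: (Hv i) => -[_ eh] _ _ _; apply: eh.
- by move=> i x; case: (Hv i).
- by apply: eq_bigr => i _; case: (Hv i).
Qed.

Lemma hom_valueZ (W : lmodType C) (a : 'M[C]_N -> W -> W) (P : W -> Prop) c w :
  hom_value a P w -> hom_value a P (c *: w).
Proof. by move=> [h [v [hh ih Ph ->]]]; exists h, (c *: v); split=> //; rewrite (linear_scale _ _ hh.1). Qed.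

Variable V : rat -> N_ -> Prop.
Hypothesis hV : is_Vfiltration f V.
Variable alpha : rat.
Local Notation p := (\prod_i rising (ratr (lam i) : C) (Num.ceil (alpha - lam i))).
Local Notation A := (ideal_mul p E : N_ -> Prop).
Local Notation B := (isotypic act G tauL (V alpha)).

Lemma p_roots_rising : linprod C (p_roots lams alpha) = p.
Proof.
rewrite /linprod /p_roots big_flatten /= !big_map -enumT big_enum; apply: eq_bigr => i _.
rewrite /rising /shift_count; case: ifP => _; last by rewrite big_map big_nil.
rewrite big_map; set k := (absz _); rewrite -{1}[k]subn0 -/(index_iota 0 k) big_mkord.
by apply: eq_bigr => j _; rewrite /linfactor rmorphD /= rmorph_nat.
Qed.

Lemma p_monic : p \is monic. Proof. by rewrite -p_roots_rising linprod_monic. Qed.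

Lemma V_poly_dvd x q : E x -> x <> 0 -> V alpha (op_poly q s_ (e x)) <-> p %| q.
Proof.
move=> Ex x0; have [phi Hphi] := dual_b_function; case: f_bij => finv fK finvK.
by rewrite -p_roots_rising; apply: (V_generator_dvd fK finvK Hphi (@isotypic_generates) hV alpha q Ex x0).
Qed.

Lemma mfs_to_iota_poly q u : Phi (op_poly q (@mfs_s C n M) u) = op_poly q s_ (Phi u).
Proof.
rewrite /op_poly linear_sum; apply: eq_bigr => k _; rewrite linearZ; congr (_ *: _).
by elim: {k}(k : nat) => //= k IH; rewrite mfs_to_iota_s IH.
Qed.

Lemma isotypic_pV m : E m -> m <> 0 -> is_pV f V alpha m p.
Proof.
move=> Em m0; rewrite /is_pV /p_condition mfs_to_iota_poly mfs_to_iota_mono /=.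
split; [exact: p_monic|by apply/V_poly_dvd|move=> q mq; rewrite mfs_to_iota_poly mfs_to_iota_mono /= => /V_poly_dvd h].
by apply: dvdp_leq; [exact: monic_neq0|exact: h].
Qed.

Definition ideal_term (w : N_) := exists q m, E m /\ w = op_poly (q * p) (@mfs_s C n M) (fmono 0 m).

Lemma ideal_mulE w : A w <-> span_of ideal_term w.
Proof.
split=> [[k [q [m [Em ->]]]]|[k [w_ [/choice[q /choice[m Hm]] ->]]]].
  by exists k, (fun i => op_poly (q i * p) (@mfs_s C n M) (fmono 0 (m i))); split=> // i; exists (q i), (m i).
exists k, q, m; split; first by move=> i; case: (Hm i).
by apply: eq_bigr => i _; case: (Hm i).
Qed.

Lemma ideal_termZ c w : ideal_term w -> ideal_term (c *: w).
Proof. by move=> [q [m [Em ->]]]; exists (c *: q), m; rewrite -scalerAl op_polyZ. Qed.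

Lemma ideal_mul_subspace : subspace A.
Proof.
have [h0 hD] := span_of_subspace ideal_termZ.
split; first exact/ideal_mulE.
by move=> c u v /ideal_mulE Hu /ideal_mulE Hv; apply/ideal_mulE/hD.
Qed.

Lemma mfs_act_s g w : G g -> mfs_act tau g (@mfs_s C n M w) = mfs_s (mfs_act tau g w).
Proof.
move=> Gg; apply: (@eq_on_monomials _ _ _ (mfs_act tau g \o @mfs_s C n M) (@mfs_s C n M \o mfs_act tau g)) w.
- by apply: linear_comp; [apply: mfs_act_linear|apply: mfs_s_linear].
- by apply: linear_comp; [apply: mfs_s_linear|apply: mfs_act_linear].
by move=> k m; rewrite /= mfs_s_mono !mfs_act_mono // mfs_s_mono.
Qed.

Lemma V_isotypic_subspace : subspace B.
Proof.
have [h0 hD] := span_of_subspace (@hom_valueZ N_ act (V alpha)).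
split; first exact/isotypicE.
by move=> c u v /isotypicE Hu /isotypicE Hv; apply/isotypicE/hD.
Qed.

(** Both sides are spanned by simple elements: values of embeddings of the
    representation in V^alpha on one side, vectors (q p)(s) m f^s with m in E on
    the other.  By [hom_polynomial_in_s] and [V_poly_dvd] these correspond to
    each other; for q nonzero, x |-> (q p)(s) e x is injective because s has no
    torsion on N. *)
Lemma graph_isomorphism :
  sG_isomorphism G (@mfs_s _ _ M) s_ (mfs_act tau) act Phi A B.
Proof.
case: f_bij => finv fK finvK.
have [h [hh ih hE]] := isotypic_parametrization; have [lh eh] := hh.
have [_ [a0 _ a00] _] := hLirr.
have h_neq0 a : a <> 0 -> h a <> 0.
  by move=> an0 ha0; apply: an0; apply: ih; rewrite ha0 -(scale0r (0 : 'cV[C]_l)) linear_scale // scale0r.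
split.
- split; [split; first exact: ideal_mul_subspace|].
  + move=> g u Gg /ideal_mulE Au; apply/ideal_mulE; move: Au.
    apply: span_of_stable; [exact: ideal_termZ|exact: mfs_act_linear|].
    move=> _ [q [m [Em ->]]]; exists q, (tau g m); split; first exact: isotypic_tau.
    rewrite op_poly_intertwine ?mfs_act_mono //; first exact: mfs_act_linear.
    by move=> w; apply: mfs_act_s.
  + move=> u /ideal_mulE Au; apply/ideal_mulE; move: Au.
    apply: span_of_stable; [exact: ideal_termZ|exact: mfs_s_linear|].
    move=> _ [q [m [Em ->]]]; exists ('X * q), m; split=> //.
    by rewrite -mulrA [RHS]op_polyM op_polyX.
- split; [split; first exact: V_isotypic_subspace|].
  + move=> g u Gg /isotypicE Bu; apply/isotypicE; move: Bu.
    apply: span_of_stable; [exact: hom_valueZ|exact: iota_act_linear|].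
    move=> _ [T [v [hT iT VT ->]]]; exists T, (tauL g v); split=> //.
    by case: hT => _ ->.
  + move=> u /isotypicE Bu; apply/isotypicE; move: Bu.
    apply: span_of_stable; [exact: hom_valueZ|exact: iota_s_linear|].
    move=> _ [T [v [[lT eT] iT VT ->]]]; exists (fun a => s_ (T a)), v; split=> [|a b||].
    * split; first by move=> c a b; rewrite lT linearP.
      by move=> g a Gg; rewrite eT // iota_act_s.
    * by move=> sab; apply: iT; apply: (s_inj fK) sab.
    * by move=> a; apply: (V_Dst hV); [constructor|apply: VT].
    * by [].
- split=> [c u v _ _|u _|g u Gg _]; [exact: mfs_to_iota_linear|exact: mfs_to_iota_s|].
  by rewrite iota_act_mfs_to_iota.
- move=> u /ideal_mulE; apply: (span_of_ind (P := fun u => B (Phi u))).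
    have [B0 BD] := V_isotypic_subspace; split; first by rewrite linear0.
    by move=> c v w Bv Bw; rewrite linearP; apply: BD.
  move=> _ [q [m [Em ->]]]; rewrite mfs_to_iota_poly mfs_to_iota_mono /=.
  (* for q = 0 the map below is not injective, but its value is 0 *)
  have [->|q0] := eqVneq q 0; first by rewrite mul0r op_poly0; case: V_isotypic_subspace.
  have [v ->] := hE m Em; apply/isotypicE/span_of_mem.
  have lT : linear (fun a => op_poly (q * p) s_ (e (h a))) by move=> c a b; rewrite lh !linearP.
  exists (fun a => op_poly (q * p) s_ (e (h a))), v; split=> [|a b ab|a|//].
  + split=> // g a Gg; rewrite op_poly_intertwine; [|exact: iota_act_linear|by move=> w; apply: iota_act_s].
    by rewrite iota_act_mono // expr0 invr1 scale1r eh.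
  + apply: contrapT => nab; have ab0 : a - b <> 0 by move=> /eqP; rewrite subr_eq0 => /eqP.
    have h1 := e_neq0 (h_neq0 _ ab0).
    have qp0 : q * p != 0 by apply: mulf_neq0 q0 (monic_neq0 p_monic).
    apply: (op_poly_s_neq0 fK qp0 h1).
    by rewrite addrC -scaleN1r lT ab scaleN1r addNr.
  + have [->|a_n0] := pselect (a = 0).
      by rewrite -(scale0r (0 : 'cV[C]_l)) (linear_scale _ _ lT) scale0r; case: (V_subspace hV alpha).
    by apply/(V_poly_dvd _ _ (h_neq0 a a_n0)); [exact: isotypic_image|exact: dvdp_mulIr].
split; first by move=> u v _ _; apply: mfs_to_iota_inj.
move=> w /isotypicE; apply: (span_of_ind (P := fun w => exists2 u, A u & Phi u = w)).
  have [A0 AD] := ideal_mul_subspace; split; first by exists 0; rewrite ?linear0.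
  by move=> c _ _ [u Au <-] [v Av <-]; exists (c *: u + v); [apply: AD|rewrite linearP].
move=> _ [T [v [hT iT VT ->]]]; have [q Hq] := hom_polynomial_in_s hh ih hE hT.
have /dvdpP[q' Eq] : p %| q.
  by apply/(V_poly_dvd _ _ (h_neq0 a0 a00)); [exact: isotypic_image|rewrite -Hq; apply: VT].
exists (op_poly q (@mfs_s C n M) (fmono 0 (h v))); last by rewrite mfs_to_iota_poly mfs_to_iota_mono Hq.
by apply/ideal_mulE/span_of_mem; exists q', (h v); rewrite -Eq; split=> //; apply: isotypic_image.
Qed.
End Main.

Unset Implicit Arguments.

Theorem theorem1p1 (R : realType) (N n l : nat)
  (* the connected reductive group G acting linearly on X = C^n *)
  (G : 'M[R[i]]_N -> Prop) (rho : 'M[R[i]]_N -> 'M[R[i]]_n)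
  (hG : linear_algebraic_group G) (hGc : zariski_connected G)
  (hGr : reductive G) (hrho : linear_action G rho)
  (* the semi-invariant f of weight sigma *)
  (sigma : 'M[R[i]]_N -> R[i]) (hsigma : alg_character G sigma)
  (f : {mpoly R[i][n]}) (hf0 : f != 0) (hf : semi_invariant G rho sigma f)
  (* S and its localization M = S_f *)
  (S : dmodule R[i] n) (tauS : 'M[R[i]]_N -> S -> S)
  (hS : simple_equivariant G rho tauS) (hSsupp : full_support S)
  (M : dmodule R[i] n) (tau : 'M[R[i]]_N -> M -> M) (loc : S -> M)
  (hloc : is_localization f loc) (hM : equivariant G rho tau)
  (hlocG : forall g m, G g -> loc (tauS g m) = tau g (loc m))
  (hMreg : regular_holonomic M) (hMqu : quasi_unipotent_monodromy f M)
  (* lambda, given by an irreducible representation of G *)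
  (tauL : 'M[R[i]]_N -> 'cV[R[i]]_l -> 'cV[R[i]]_l)
  (hLrat : rational_rep tauL G) (hLirr : irreducible tauL G (@whole _ _))
  (hMirr : irreducible tau G (isotypic tau G tauL (@whole _ M)))
  (* b_lambda(s) = prod_i (s + lambda_i), with d = deg f factors *)
  (lam : 'I_(total_degree f) -> rat)
  (hlam : forall m : M, isotypic tau G tauL (@whole _ M) m -> m <> 0 ->
     is_bfun_of f m (\prod_i ('X + (ratr (lam i))%:P)))
  (* the V-filtration *)
  (V : rat -> fseq M -> Prop) (hV : is_Vfiltration f V) (alpha : rat) :
  let p := \prod_i rising (ratr (lam i) : R[i]) (Num.ceil (alpha - lam i)) in
  (forall m : M, isotypic tau G tauL (@whole _ M) m -> m <> 0 ->
     is_pV f V alpha m p) /\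
  sG_isomorphism G (@mfs_s _ _ M) (@iota_s _ _ f M)
    (mfs_act tau) (iota_act sigma tau) (@mfs_to_iota _ _ f M)
    (ideal_mul p (isotypic tau G tauL (@whole _ M)))
    (isotypic (iota_act sigma tau) G tauL (V alpha)).
Proof.
move=> p; split.
  by move=> m Em m0; apply: (isotypic_pV hG hrho hsigma hf0 hf hS hSsupp hloc hM hlocG hLrat hLirr hMirr hGr hlam hV alpha Em m0).
exact: (graph_isomorphism hG hrho hsigma hf0 hf hS hSsupp hloc hM hlocG hLrat hLirr hMirr hGr hlam hV alpha).
Qed.
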